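(* Let $\mathcal M$ be a countable (possibly infinitely branching) MDP with bounded real-valued rewards and let $s_0$ be a state of $\mathcal M$. Consider the objective of maximizing the expectation $\mathcal E_{\mathcal M,s_0,\sigma}\big(\liminf_{n} r_n\big)$ of the $\liminf$ of the sequence of rewards $r_0r_1r_2\cdots$ seen along the run. If an optimal strategy for this objective from $s_0$ exists, then an optimal strategy from $s_0$ can be chosen as (1) memoryless deterministic (MD), if $\mathcal M$ is universally transient; (2) deterministic Markov (Det(SC)) in general.
   Context: An MDP $\mathcal M$ consists of a countable set $S$ of states partitioned into controlled states $S_C$ and random states $S_R$; a transition relation $\longrightarrow\subseteq S\times S$ such that every state has at least one successor (the set $\mathrm{Succ}(s)$ of successors of $s$ may be infinite); a function $P$ assigning to each random state $s$ a probability distribution on $\mathrm{Succ}(s)$; and a reward function $r$ assigning a real number to each transition. A run is an infinite sequence $s_0e_0s_1e_1\cdots$ with $e_i=(s_i,s_{i+1})\in\longrightarrow$, and $r_n=r(e_n)$. A history is a finite prefix of a run ending in a controlled state. A (general) strategy $\sigma$ maps each history ending in $s$ to a probability distribution on $\mathrm{Succ}(s)$. It is deterministic if all these distributions are Dirac; memoryless if they depend only on the current state; Markov if they depend only on the current state and the number of steps taken so far. A strategy and a start state $s$ induce a probability measure on the Borel $\sigma$-algebra of runs from $s$, with expectation $\mathcal E_{\mathcal M,s,\sigma}$. A strategy is optimal from $s_0$ if it attains the supremum of $\mathcal E_{\mathcal M,s_0,\sigma}(\liminf_n r_n)$ over all strategies $\sigma$. $\mathcal M$ is universally transient if for every start state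 and every strategy, almost every run visits no state infinitely often. *)

(* Defs.v *)
From HB Require Import structures.
From mathcomp Require Import all_boot all_order all_algebra.
From mathcomp Require Import all_classical all_reals all_analysis.
From mathcomp Require Import lra.
Set Implicit Arguments.
Unset Strict Implicit.
Unset Printing Implicit Defensive.
Import Order.TTheory GRing.Theory Num.Theory.
Import numFieldNormedType.Exports.
Local Open Scope classical_set_scope.
Local Open Scope ring_scope.

Definition is_distr (R : realType) (S : countType) (A : pred S) (p : S -> R) :=
  [/\ forall t, 0 <= p t,
      forall t, ~~ A t -> p t = 0 &
      \esum_(t in [set: S]) (p t)%:E = 1%E].

(* The random states are those that are not controlled. [prob] is meaningful
   only at random states and [reward] only on transitions; their other values
   are never used. *)
Record mdp (R : realType) (S : countType) := MDP {
  controlled : pred S ;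
  trans : rel S ;
  prob : S -> S -> R ;
  reward : S -> S -> R ;
  trans_total : forall s, exists t, trans s t ;
  prob_distr : forall s, ~~ controlled s -> is_distr (trans s) (prob s) }.

Section mdp_defs.
Context {R : realType} {S : countType} (M : mdp R S).

Definition bounded_rewards :=
  exists B : R, forall s t, trans M s t -> `|reward M s t| <= B.

(* A history is given by the sequence [h] of its earlier states and its last
   state [s]; its transitions are determined by its states. The number of steps
   taken is [size h]. *)
Definition is_history (h : seq S) (s : S) :=
  sorted (trans M) (rcons h s) && controlled M s.

(* [play] is meaningful only on histories. *)
Record strategy := Strategy {
  play : seq S -> S -> S -> R ;
  play_distr : forall h s, is_history h s -> is_distr (trans M s) (play h s) }.

Definition is_deterministic (sigma : strategy) :=
  forall h s, is_history h s ->
    exists t, play sigma h s = (fun u => (u == t)%:R).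

Definition is_memoryless (sigma : strategy) :=
  forall h h' s, is_history h s -> is_history h' s ->
    play sigma h s = play sigma h' s.

Definition is_markov (sigma : strategy) :=
  forall h h' s, is_history h s -> is_history h' s -> size h = size h' ->
    play sigma h s = play sigma h' s.

(* Runs from [s]; the transitions taken are determined by the states. *)
Record run (s : S) := Run {
  state :> nat -> S ;
  state0 : state 0 = s ;
  state_trans : forall n, trans M (state n) (state n.+1) }.

Definition cylinder (s : S) (w : seq S) : set (run s) :=
  [set rho : run s | mkseq (fun i => rho i.+1) (size w) = w].

Definition cylinders (s : S) : set (set (run s)) := range (@cylinder s).

Lemma run_inhabited (s : S) : inhabited (run s).
Proof.
pose f (s : S) := xchoose (trans_total M s).
by split; apply: (@Run s (fun n => iter n f s)) => // n; exact: (xchooseP (trans_total M _)).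
Qed.

HB.instance Definition _ (s : S) := gen_eqMixin (run s).
HB.instance Definition _ (s : S) := gen_choiceMixin (run s).
HB.instance Definition _ (s : S) :=
  isPointed.Build (run s) (inhabited_witness (run_inhabited s)).
(* [S] being countable and discrete, the cylinders generate the Borel sets. *)
HB.instance Definition _ (s : S) :=
  Measurable.copy (run s) (g_sigma_algebraType (@cylinders s)).

Definition step (sigma : strategy) (h : seq S) (s t : S) : R :=
  if controlled M s then play sigma h s t else prob M s t.

(* The probability that the states [w] follow when the process has gone through
   the states [h] and is now in [s]. *)
Fixpoint path_prob (sigma : strategy) (h : seq S) (s : S) (w : seq S) : R :=
  if w is t :: w' then step sigma h s t * path_prob sigma (rcons h s) t w'
  else 1.

End mdp_defs.

(* Existence of the measure induced by a strategy. The outcome of a uniformly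
   distributed point of [0, 1[ is computed by repeatedly splitting the interval
   according to the successor distribution. *)
Section induced_measure.
Context {R : realType} {S : countType} (M : mdp R S) (sigma : strategy M).

Let eqle (x y : R) : x = y -> x <= y. Proof. by move=> ->. Qed.

Let pn (p : S -> R) (j : nat) : R := oapp p 0 (pickle_inv j).
Let F (p : S -> R) (t : S) : R := \sum_(j < pickle t) pn p j.
Let inI (p : S -> R) (x : R) (t : S) := F p t <= x < F p t + p t.

Let pn_ge0 p : (forall t, 0 <= p t) -> forall j, 0 <= pn p j.
Proof. by move=> p0 j; rewrite /pn; case: pickle_inv => /=. Qed.

Let sum_mono p m n : (forall t, 0 <= p t) -> (m <= n)%N ->
  \sum_(j < m) pn p j <= \sum_(j < n) pn p j.
Proof.
move=> p0 mn; rewrite -!(big_mkord xpredT (pn p)) (big_cat_nat _ mn)//=.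
by rewrite lerDl sumr_ge0// => j _; exact: pn_ge0.
Qed.

Let F_succ p t : \sum_(j < (pickle t).+1) pn p j = F p t + p t.
Proof. by rewrite big_ord_recr /= /F {2}/pn pickleK_inv. Qed.

Let F_ge0 p t : (forall t, 0 <= p t) -> 0 <= F p t.
Proof. by move=> p0; apply: sumr_ge0 => j _; exact: pn_ge0. Qed.

Let sum_fset (p : S -> R) (s : seq S) : (forall t, 0 <= p t) -> uniq s ->
  exists n, \sum_(t <- s) p t <= \sum_(j < n) pn p j.
Proof.
move=> p0 us; exists (\max_(t <- s) (pickle t).+1)%N.
set n := (X in 'I_X).
have -> : \sum_(t <- s) p t = \sum_(j <- map pickle s) pn p j.
  by rewrite big_map; apply: eq_bigr => t _; rewrite /pn pickleK_inv.
rewrite -(big_mkord xpredT (pn p)).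
apply: (@le_trans _ _ (\sum_(j <- index_iota 0 n | j \in map pickle s) pn p j)).
  rewrite -[leRHS]big_filter; apply: eqle; apply: perm_big; apply: uniq_perm.
  - by rewrite map_inj_uniq//; exact: (pcan_inj pickleK).
  - by rewrite filter_uniq// iota_uniq.
  move=> j; rewrite mem_filter mem_index_iota/=.
  apply/idP/idP => [js|/andP[]//]; rewrite js/=.
  by case/mapP: js => t ts ->; rewrite /n (big_rem t)//= leq_max leqnn.
rewrite [leRHS](bigID (mem (map pickle s)))/= lerDl.
by apply: sumr_ge0 => j _; exact: pn_ge0.
Qed.

Let fpart (A : pred S) p (n : nat) : is_distr A p -> \sum_(j < n) pn p j <= 1.
Proof.
case=> p0 _ p1; rewrite -lee_fin -p1.
pose s := pmap (@pickle_inv S) (iota 0 n).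
have us : uniq s.
  apply: (pmap_uniq (g := pickle)) => [j|]; last exact: iota_uniq.
  exact: pickle_invK.
apply: esum_ge; exists [set` s]; first by split => //; exact: finite_seq.
rewrite -(fsbig_seq _ _ us)/= sumEFin lee_fin -(big_mkord xpredT (pn p)) /s.
rewrite /index_iota subn0; apply: eqle.
elim: (iota 0 n) => [|j l IH]; first by rewrite !big_nil.
by rewrite big_cons IH /pn /=; case: pickle_inv => [t|] /=; rewrite ?big_cons ?add0r.
Qed.

Let inI_ex (A : pred S) p x : is_distr A p -> 0 <= x < 1 -> exists t, inI p x t.
Proof.
move=> pd /andP[x0 x1]; have [p0 _ p1] := pd.
have [n xn] : exists n, x < \sum_(j < n) pn p j.
  have : (x%:E < \esum_(t in [set: S]) (p t)%:E)%E by rewrite p1 lte_fin.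
  move/ereal_sup_gt => [_ [X [fX _] <-]].
  rewrite fsbig_finite//= sumEFin lte_fin => xX.
  have [n nX] := sum_fset p0 (finmap.fset_uniq (fset_set X)).
  by exists n; exact: lt_le_trans nX.
have ex : exists n, x < \sum_(j < n) pn p j by exists n.
case: (ex_minnP ex) => -[|m]; first by rewrite big_ord0 ltNge x0.
move=> xm mmin.
have mx : \sum_(j < m) pn p j <= x.
  by rewrite leNgt; apply/negP => /mmin; rewrite ltnn.
move: xm; rewrite big_ord_recr /= [X in _ + X]/pn.
move: (@pickle_invK S m); case: (pickle_inv m) => [t|] /= tm.
  by subst m => xm; exists t; apply/andP; split.
by rewrite addr0 => /lt_le_trans /(_ mx); rewrite ltxx.
Qed.

Let inI_uniq p x t t' : (forall t, 0 <= p t) -> inI p x t -> inI p x t' -> t = t'.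
Proof.
move=> p0; wlog tt' : t t' / (pickle t <= pickle t')%N.
  by move=> H; case: (leqP (pickle t) (pickle t')) => [/H//|/ltnW/H + a b]; move=> /(_ b a).
move: tt'; rewrite leq_eqVlt => /orP[/eqP/(pcan_inj pickleK)//|lt].
move=> /andP[_ h1] /andP[h2 _]; have := sum_mono p0 lt; rewrite F_succ => h3.
by have := le_lt_trans (le_trans h3 h2) h1; rewrite ltxx.
Qed.

Let step_distr h s : sorted (trans M) (rcons h s) ->
  is_distr (trans M s) (step sigma h s).
Proof.
move=> hs; have -> : step sigma h s =
    if controlled M s then play sigma h s else prob M s.
  by apply/funext => t; rewrite /step; case: ifP.
case: ifPn => cs; last exact: prob_distr.
by apply: play_distr; rewrite /is_history hs.
Qed.

Let pick h s x : S := xget s [set t | inI (step sigma h s) x t].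
Let rest h s x : R :=
  (x - F (step sigma h s) (pick h s x)) / step sigma h s (pick h s x).

Let pickP h s x : sorted (trans M) (rcons h s) -> 0 <= x < 1 ->
  [/\ inI (step sigma h s) x (pick h s x), 0 < step sigma h s (pick h s x),
      sorted (trans M) (rcons (rcons h s) (pick h s x)),
      0 <= rest h s x < 1 & trans M s (pick h s x)].
Proof.
move=> hs x01; have [p0 pA _] := step_distr hs.
have inx : inI (step sigma h s) x (pick h s x).
  exact: (@xgetPex _ s [set t | inI (step sigma h s) x t]
    (inI_ex (step_distr hs) x01)).
have px : 0 < step sigma h s (pick h s x).
  case/andP: inx => h1 h2; have := le_lt_trans h1 h2.
  by rewrite ltrDl.
have tx : trans M s (pick h s x).
  by apply/negPn/negP => /pA; move/eqP; rewrite gt_eqF.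
split => //.
- case: h hs {inx px x01} tx p0 pA => [|a h] /= hs tx _ _; first by rewrite tx.
  by rewrite rcons_path last_rcons hs.
- case/andP: inx => h1 h2; rewrite /rest.
  by rewrite ltr_pdivrMr// mul1r ltrBlDl h2 andbT divr_ge0 ?subr_ge0// ltW.
Qed.

Let next (y : seq S * S * R) : seq S * S * R :=
  let: (h, s, x) := y in (rcons h s, pick h s x, rest h s x).

Let valid (y : seq S * S * R) :=
  sorted (trans M) (rcons y.1.1 y.1.2) && (0 <= y.2 < 1).

Let next_valid y : valid y -> valid (next y) /\ trans M y.1.2 (next y).1.2.
Proof.
case: y => [[h s] x] /andP[/= hs x01]; have [_ _ h1 h2 h3] := pickP hs x01.
by split=> //; rewrite /valid /= h1.
Qed.

Let iter_valid y n : valid y -> valid (iter n next y).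
Proof. by move=> vy; elim: n => //= n /next_valid[]. Qed.

Let follow y (w : seq S) := mkseq (fun i => (iter i.+1 next y).1.2) (size w) = w.

Let follow_cons y t w :
  follow y (t :: w) <-> (next y).1.2 = t /\ follow (next y) w.
Proof.
have E : mkseq (fun i => (iter i.+1 next y).1.2) (size w).+1 =
   (next y).1.2 :: mkseq (fun i => (iter i.+1 next (next y)).1.2) (size w).
  rewrite /mkseq /= -[1%N]/(1 + 0)%N iotaDl -map_comp; congr cons.
  by apply: eq_map => i /=; rewrite -iterSr.
by rewrite /follow /= E; split => [[-> ->]|[-> ->]].
Qed.

Let follow_itv w h s : sorted (trans M) (rcons h s) ->
  exists a, [/\ 0 <= a, 0 <= path_prob sigma h s w,
    a + path_prob sigma h s w <= 1 &
    forall x, 0 <= x < 1 ->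
      follow (h, s, x) w <-> a <= x < a + path_prob sigma h s w].
Proof.
elim: w h s => [|t w IH] h s hs /=.
  by exists 0; split => //; rewrite ?add0r// => x ->; split.
have pd := step_distr hs; have [p0 pA _] := pd.
set q := step sigma h s t.
have := p0 t; rewrite le_eqVlt -/q => /orP[/eqP q0|q0].
  exists 0; rewrite -q0 !mul0r addr0; split => // x x01; split.
    move/follow_cons => -[/= xt _].
    by have [_ + _ _ _] := pickP hs x01; rewrite xt -/q -q0 ltxx.
  by move=> /andP[a b]; have := le_lt_trans a b; rewrite ltxx.
have hst : sorted (trans M) (rcons (rcons h s) t).
  have st : trans M s t.
    by apply/negPn/negP => /pA; rewrite -/q => /eqP; rewrite gt_eqF.
  case: h hs {IH pd p0 pA q q0} => [|a h] /= hs; first by rewrite st.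
  by rewrite rcons_path last_rcons hs.
have [a [a0 r0 ar1 Ha]] := IH _ _ hst.
set r := path_prob _ _ _ _ in r0 ar1 Ha *.
set G := F (step sigma h s) t.
have G0 : 0 <= G by exact: F_ge0.
have Gq : G + q <= 1 by rewrite -F_succ; exact: fpart pd.
have qa : q * (a + r) <= q by rewrite ger_pMr.
have qr0 : 0 <= q * r by rewrite mulr_ge0// ltW.
have qa0 : 0 <= q * a by rewrite mulr_ge0// ltW.
rewrite mulrDr in qa.
exists (G + q * a); split; [lra|lra|lra|].
move=> x x01; rewrite follow_cons /=.
have [inx px _ r01 _] := pickP hs x01.
split.
  move=> [xt]; rewrite xt in r01 *.
  move/(Ha _ r01).
  rewrite /rest xt -/G -/q ler_pdivlMr// ltr_pdivrMr// (mulrC a) (mulrC (a + r)).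
  by rewrite mulrDr => /andP[? ?]; apply/andP; split; lra.
move=> /andP[h1 h2].
have xt : pick h s x = t.
  apply: (inI_uniq p0 inx); rewrite /inI -/G -/q.
  by apply/andP; split; lra.
split => //; rewrite xt in r01 *; apply/(Ha _ r01).
rewrite /rest xt -/G -/q ler_pdivlMr// ltr_pdivrMr// (mulrC a) (mulrC (a + r)).
by rewrite mulrDr; apply/andP; split; lra.
Qed.

Variable s0 : S.

Let valid0 x : 0 <= x < 1 -> valid ([::], s0, x).
Proof. by move=> x01; rewrite /valid. Qed.

Let run_of x (x01 : 0 <= x < 1) : run M s0 :=
  @Run _ _ M s0 (fun n => (iter n next ([::], s0, x)).1.2) erefl
    (fun n => (next_valid (iter_valid n (valid0 x01))).2).

Let outcome (x : R) : run M s0 :=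
  if pselect (0 <= x < 1) is left x01 then run_of x01 else point.

Let D : set R := `[0, 1[.

Let outcome_cylinder w : exists a, [/\ 0 <= path_prob sigma [::] s0 w &
  D `&` outcome @^-1` cylinder w =
    [set` `[a, a + path_prob sigma [::] s0 w[ ]].
Proof.
have [//|a [a0 r0 ar1 Ha]] := @follow_itv w [::] s0.
exists a; split => //; apply/seteqP; split => x /=.
  rewrite /D /= !in_itv /= /cylinder /= => -[x01].
  by rewrite /outcome; case: pselect => // ?; exact: (Ha _ x01).1.
rewrite in_itv /= => /[dup] ax /andP[ax1 ax2].
have x01 : 0 <= x < 1 by apply/andP; split; lra.
rewrite /D /= in_itv /=; split => //.
by rewrite /cylinder /= /outcome; case: pselect => // ?; exact: (Ha _ x01).2.
Qed.

Let mD : measurable D. Proof. exact: measurable_itv. Qed.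

Let outcome_measurable : measurable_fun setT outcome.
Proof.
apply: (@measurability _ _ _ _ _ _ (@cylinders R S M s0)) => //.
move=> _ [_ [w _ <-] <-]; rewrite setTI.
rewrite -[X in measurable X](classical_sets.setUIDK _ D); apply: measurableU.
  by have [a [_ H]] := outcome_cylinder w; rewrite setIC H; exact: measurable_itv.
have -> : outcome @^-1` cylinder w `\` D =
    if point \in @cylinder R S M s0 w then ~` D else set0.
  have E x : (~` D) x -> outcome x = point.
    by rewrite /D /= in_itv /= /outcome; case: pselect.
  apply/seteqP; split => x.
    by move=> [/= + xD]; rewrite (E _ xD) => /mem_set ->.
  by case: ifPn => // /set_mem pw xD; split => //=; rewrite (E _ xD).
by case: ifP => // _; exact: measurableC.
Qed.

Lemma induced_measure_exists : exists P : probability (run M s0) R,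
  forall w, P (cylinder w) = (path_prob sigma [::] s0 w)%:E.
Proof.
pose mu := mrestr (@lebesgue_measure R) mD.
have [m mE] : exists m, m = pushforward mu outcome by eexists.
have m1 : m setT = 1%E.
  rewrite mE /mu /pushforward /mrestr preimage_setT setTI /D.
  by rewrite lebesgue_measure_itv /= lte_fin ltr01 sube0.
have m0 : m set0 = 0%E by rewrite mE /pushforward preimage_set0 /mu measure0.
have m_ge0 A : (0 <= m A)%E by rewrite mE; exact: measure_ge0.
have m_sigma : semi_sigma_additive m.
  rewrite mE.
  exact: (@measure_semi_sigma_additive _ _ _ (pushforward mu outcome)).
pose m_meas := isMeasure.Build _ _ _ m m0 m_ge0 m_sigma.
pose mm : {measure set (run M s0) -> \bar R} := HB.pack m m_meas.
pose m_prob := Measure_isProbability.Build _ _ _ mm m1.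
pose P : probability (run M s0) R := HB.pack m m_meas m_prob.
exists P => w; have [a [r0 H]] := outcome_cylinder w.
rewrite /P /= mE /pushforward /mu /mrestr setIC H lebesgue_measure_itv /=.
rewrite lte_fin ltrDl; case: ltP => [_|r1]; first by rewrite -EFinD addrAC subrr add0r.
by congr EFin; apply/eqP; rewrite eq_le r0 r1.
Qed.

End induced_measure.

Section objective.
Context {R : realType} {S : countType} (M : mdp R S).
Local Open Scope ereal_scope.

Definition induced_measure (s : S) (sigma : strategy M) :
    probability (run M s) R :=
  projT1 (cid (induced_measure_exists sigma s)).

Lemma induced_measureE (s : S) (sigma : strategy M) (w : seq S) :
  induced_measure s sigma (cylinder w) = (path_prob sigma [::] s w)%:E.
Proof. exact: (projT2 (cid (induced_measure_exists sigma s))). Qed.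

Lemma induced_measure_unique (s : S) (sigma : strategy M)
    (P : probability (run M s) R) :
  (forall w, P (cylinder w) = (path_prob sigma [::] s w)%:E) ->
  forall A, measurable A -> P A = induced_measure s sigma A.
Proof.
move=> PE A mA.
pose G := [set B | B = set0 \/ @cylinders R S M s B].
have cT : @cylinder R S M s [::] = setT by apply/seteqP; split.
have mG : G `<=` measurable.
  move=> B [->//|cB]; exact: sub_sigma_algebra.
apply: (@measure_unique _ R (run M s) G (fun=> setT)) => //.
- apply/seteqP; split; last first.
    apply: smallest_sub; first exact: sigma_algebra_measurable.
    exact: mG.
  by apply: sub_sigma_algebra2 => B cB; right.
- move=> B C [->|[w _ <-]] [->|[w' _ <-]]; rewrite ?set0I ?setI0; try by left.
  wlog ww : w w' / (size w <= size w')%N.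
    move=> H; case: (leqP (size w) (size w')) => [/H//|/ltnW/H].
    by rewrite setIC.
  have E (rho : run M s) : mkseq (fun i => rho i.+1) (size w) =
      take (size w) (mkseq (fun i => rho i.+1) (size w')).
    by rewrite /mkseq -map_take take_iota (minn_idPl ww).
  have [tw|tw] := eqVneq (take (size w) w') w.
    right; exists w' => //; apply/seteqP; split => rho /=; last by case.
    by rewrite /cylinder /= => H; split=> //=; rewrite E H.
  left; apply/seteqP; split => rho //= [].
  by rewrite /cylinder /= E => + H; rewrite H => /eqP; rewrite (negbTE tw).
- by move=> _; right; exists [::].
- by rewrite bigcup_const.
- move=> B [->|[w _ <-]]; first by rewrite !measure0.
  exact: etrans (PE w) (esym (induced_measureE s sigma w)).
- by move=> _; rewrite /= probability_setT ltry.
Qed.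

Definition expected_liminf (s : S) (sigma : strategy M) : \bar R :=
  \int[induced_measure s sigma]_rho
    limn_einf (fun n => (reward M (rho n) (rho n.+1))%:E).

Definition is_optimal (s : S) (sigma : strategy M) :=
  expected_liminf s sigma = ereal_sup (range (expected_liminf s)).

Definition universally_transient :=
  forall (s : S) (sigma : strategy M),
    \forall rho \ae induced_measure s sigma,
      forall t : S, finite_set [set n | (rho : run M s) n = t].

End objective.

(* Main.v *)
(* A randomized strategy is a policy in a gambling house: in every state one of
   the admissible distributions on the next state is chosen, and every event
   lives on the space of trajectories [nat -> X]. Part (2) is part (1) for the
   house whose states carry a step counter, which is universally transient.

   Let v be the value function. An optimal policy only uses moves that conserve
   v and lead to states that have an optimal policy, and by Levy's 0-1 law the
   values v(s_n) converge almost surely to the payoff. So it wins the objective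
   phi: for every k, eventually the reward is at least v(s_n) - 1/k. Conversely a
   conserving stationary policy that wins phi almost surely is optimal: if y is
   its payoff, then v - y is a martingale with lower limit 0.

   For phi, whose value is 1 from every state, a stationary policy is built by
   fixing choices state by state. From x some policy wins with probability
   1 - e, hence up to 2e it never makes a low-reward move of level k outside a
   finite set F_k. By transience, avoiding these moves implies phi, and avoidance
   has a stationary policy that is optimal up to e: there is a bounded potential
   that decreases in mean by delta(s) > 0 in every state s, so an error of
   e * delta(s) can be afforded at each visit of s. Fixing this policy where it
   succeeds with probability at least 1/2 costs little at x. All other states
   keep a positive value, hence the value 1, because phi is a tail event. In the
   limit the stationary policy wins with probability at least 1/2 from every
   state, hence almost surely, again because phi is a tail event. *)

From HB Require Import structures.
Require Import Defs.
From mathcomp Require Import all_boot all_order all_algebra.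
From mathcomp Require Import all_classical all_reals all_analysis.
From mathcomp Require Import measurable_realfun ring lra.
Set Implicit Arguments.
Unset Strict Implicit.
Unset Printing Implicit Defensive.
Import Order.TTheory GRing.Theory Num.Theory.
Import numFieldNormedType.Exports.
Local Open Scope classical_set_scope.
Local Open Scope ring_scope.

(** * Trajectories *)

#[short(type="pcountType")]
HB.structure Definition PCountable := {T of Countable T & isPointed T}.

Definition traj (X : pcountType) := nat -> X.

Definition cyl (X : pcountType) (w : seq X) : set (traj X) :=
  [set om | mkseq om (size w) = w].

HB.instance Definition _ (X : pcountType) := gen_eqMixin (traj X).
HB.instance Definition _ (X : pcountType) := gen_choiceMixin (traj X).
HB.instance Definition _ (X : pcountType) :=
  isPointed.Build (traj X) (fun=> point).
HB.instance Definition _ (X : pcountType) :=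
  Measurable.copy (traj X) (g_sigma_algebraType (range (@cyl X))).

Section traj_theory.
Context {X : pcountType}.
Implicit Types (w : seq X) (om : traj X).

Lemma cyl_nil : cyl [::] = setT :> set (traj X).
Proof. by apply/seteqP; split. Qed.

Lemma cyl_measurable w : measurable (cyl w).
Proof. by apply: sub_sigma_algebra; exists w. Qed.

(** There are only countably many finite sequences, so for an arbitrary set [A] the event is a
    countable union of cylinders. *)
Lemma prefix_measurable (A : set (seq X)) n :
  measurable [set om : traj X | A (mkseq om n)].
Proof.
rewrite (_ : [set _ | _] = \bigcup_k
    (if pickle_inv k is Some w then
       if (size w == n) && `[< A w >] then cyl w else set0 else set0)).
  apply: bigcupT_measurable => k; case: pickle_inv => // w.
  by case: ifP => // _; exact: cyl_measurable.
apply/seteqP; split => om /=.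
  move=> Aom; exists (pickle (mkseq om n)) => //.
  rewrite pickleK_inv size_mkseq eqxx /= asboolT//.
  by rewrite /cyl /= size_mkseq.
move=> [k _]; case: pickle_inv => // w; case: ifP => // /andP[/eqP <- /asboolP Aw].
by rewrite /cyl /= => ->.
Qed.

Lemma current_measurable (A : set (seq X * X)) n :
  measurable [set om : traj X | A (mkseq om n, om n)].
Proof.
have -> : [set om : traj X | A (mkseq om n, om n)] = [set om |
   [set u : seq X | A (take n u, last point u)] (mkseq om n.+1)].
  apply: eq_set => om.
  rewrite -[RHS]/(A (take n (mkseq om n.+1), last point (mkseq om n.+1))).
  rewrite mkseqS last_rcons -cats1.
  by rewrite take_size_cat ?size_mkseq.
exact: prefix_measurable.
Qed.

Lemma coord_measurable (A : set X) n : measurable [set om : traj X | A (om n)].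
Proof. exact: (@current_measurable [set u | A u.2]). Qed.

Lemma coord2_measurable (A : set (X * X)) n :
  measurable [set om : traj X | A (om n, om n.+1)].
Proof.
have -> : [set om : traj X | A (om n, om n.+1)] = [set om |
   [set u | A (last point u.1, u.2)] (mkseq om n.+1, om n.+1)].
  apply: eq_set => om.
  by rewrite -[RHS]/(A (last point (mkseq om n.+1), _)) mkseqS last_rcons.
exact: current_measurable.
Qed.

Definition tcons (s : X) om : traj X := fun n => if n is m.+1 then om m else s.

Lemma mkseq_tcons s om n : mkseq (tcons s om) n.+1 = s :: mkseq om n.
Proof. by rewrite /mkseq /= -[1%N]/(1 + 0)%N iotaDl -map_comp. Qed.

Lemma tcons_cyl s t w :
  tcons s @^-1` cyl (t :: w) = if t == s then cyl w else set0.
Proof.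
apply/seteqP; split => om; rewrite /= /cyl /preimage /= mkseq_tcons.
  by move=> [-> ?]; rewrite eqxx.
by case: eqP => [-> /= ->|].
Qed.

Lemma tcons_measurable s : measurable_fun setT (tcons s).
Proof.
apply: (@measurability _ _ _ _ _ _ (range (@cyl X))) => //.
move=> _ [_ [[|t w] _ <-] <-]; rewrite setTI.
  by rewrite (_ : _ @^-1` _ = setT)//; apply/seteqP.
by rewrite tcons_cyl; case: ifP => // _; exact: cyl_measurable.
Qed.

(** Two cylinders are nested or disjoint, so together with the empty set they form a generating
    family that is stable under intersection. *)
Lemma traj_measure_unique (R : realType)
    (P Q : {measure set (traj X) -> \bar R}) :
  (P setT < +oo)%E -> (forall w, P (cyl w) = Q (cyl w)) ->
  forall A, measurable A -> P A = Q A.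
Proof.
move=> Pfin PQ A mA.
pose G := [set B | B = set0 \/ range (@cyl X) B].
have mG : G `<=` measurable.
  by move=> B [->//|[w _ <-]]; exact: cyl_measurable.
apply: (@measure_unique _ R (traj X) G (fun=> setT)) => //.
- apply/seteqP; split; last first.
    apply: smallest_sub; first exact: sigma_algebra_measurable.
    exact: mG.
  by apply: sub_sigma_algebra2 => B cB; right.
- move=> B C [->|[w _ <-]] [->|[w' _ <-]]; rewrite ?set0I ?setI0; try by left.
  wlog ww : w w' / (size w <= size w')%N.
    move=> H; case: (leqP (size w) (size w')) => [/H//|/ltnW/H].
    by rewrite setIC.
  have E om : mkseq om (size w) = take (size w) (mkseq om (size w')).
    by rewrite /mkseq -map_take take_iota (minn_idPl ww).
  have [tw|tw] := eqVneq (take (size w) w') w.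
    right; exists w' => //; apply/seteqP; split => om /=; last by case.
    by rewrite /cyl /= => H; split=> //=; rewrite E H.
  left; apply/seteqP; split => om //= [].
  by rewrite /cyl /= E => + H; rewrite H => /eqP; rewrite (negbTE tw).
- by move=> _; right; exists [::] => //; exact: cyl_nil.
- by rewrite bigcup_const.
- by move=> B [->|[w _ <-]//]; rewrite !measure0.
Qed.

End traj_theory.

(** * Gambles and their averages *)

Section bounded_expectation.
Context {R : realType}.

Definition bounded_by (T : Type) (M : R) (f : T -> R) := forall x, `|f x| <= M.

Lemma bounded_byD (T : Type) M N (f h : T -> R) :
  bounded_by M f -> bounded_by N h ->
  bounded_by (M + N) (fun x => f x + h x).
Proof.
by move=> Mf Nh x; rewrite (le_trans (ler_normD _ _))// lerD ?Mf ?Nh.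
Qed.

Context d (T : measurableType d) (P : probability T R).
Implicit Types f g : T -> R.

Lemma bounded_by_integrable M f : measurable_fun setT f -> bounded_by M f ->
  P.-integrable setT (EFin \o f).
Proof.
move=> mf Mf; apply: measurable_bounded_integrable => //.
  by rewrite /= probability_setT ltry.
exists M; split; first exact: num_real.
by move=> N MN x _ /=; exact: le_trans (Mf x) (ltW MN).
Qed.

Lemma Rintegral_cstT (c : R) : \int[P]_x c = c.
Proof. by rewrite Rintegral_cst//= probability_setT mulr1. Qed.

End bounded_expectation.

Section gambles.
Context {R : realType} {X : pcountType}.

Record gamble := Gamble {
  gval :> X -> R ;
  gval_distr : is_distr xpredT gval }.

Implicit Types (g : gamble) (f : X -> R).

Lemma gamble_ge0 g x : 0 <= g x. Proof. by have [] := gval_distr g. Qed.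

(** Gambles are carried over to [nat] along [pickle], because series of numbers and of measures are
    indexed by [nat]. A number that codes no state is read as [point] and gets weight 0. *)
Definition nthX n : X := odflt point (pickle_inv n).
Definition weight g n : R := oapp g 0 (pickle_inv n).

Lemma nthX_pickle x : nthX (pickle x) = x.
Proof. by rewrite /nthX pickleK_inv. Qed.

Lemma weight_pickle g x : weight g (pickle x) = g x.
Proof. by rewrite /weight pickleK_inv. Qed.

Lemma weight_ge0 g n : 0 <= weight g n.
Proof. by rewrite /weight; case: pickle_inv => //= x; exact: gamble_ge0. Qed.

Lemma weight_nthX g n : weight g n = 0 \/ weight g n = g (nthX n).
Proof. by rewrite /weight /nthX; case: pickle_inv => /=; [right|left]. Qed.

Definition weight_nng g n : {nonneg R} := NngNum (weight_ge0 g n).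

Lemma weight_sum g : (\sum_(n <oo) (weight g n)%:E = 1)%E.
Proof.
have [_ _ <-] := gval_distr g.
rewrite nneseries_esumT; last by move=> n; rewrite lee_fin weight_ge0.
rewrite (esumID (range (@pickle X))); last first.
  by move=> n _; rewrite lee_fin weight_ge0.
rewrite !setTI [X in (_ + X)%E]esum1 ?adde0; last first.
  move=> n /= nX; rewrite /weight; move: (@pickle_invK X n).
  case: pickle_inv => //= x xn; exfalso; apply: nX; exists x => //.
rewrite (reindex_esum [set: X] (range pickle) pickle)//.
- by apply: eq_esum => x _; rewrite weight_pickle.
- by apply: inj_bij => x y _ _; exact: (pcan_inj pickleK).
Qed.

Definition mix d (T : measurableType d) g (P : X -> probability T R) :=
  mseries (fun n => mscale (weight_nng g n) (P (nthX n))) 0.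

Section mix.
Context d (T : measurableType d) (P : X -> probability T R).

Lemma mix_setT g : mix g P setT = 1%E.
Proof.
rewrite /mix /mseries -(weight_sum g); apply: eq_eseriesr => n _.
by rewrite -[LHS]/((weight g n)%:E * P (nthX n) setT)%E probability_setT mule1.
Qed.

HB.instance Definition _ g := Measure.on (mix g P).
HB.instance Definition _ g :=
  Measure_isProbability.Build _ _ _ (mix g P) (mix_setT g).

Lemma ge0_integral_mix g (f : T -> \bar R) :
  (forall t, 0 <= f t)%E -> measurable_fun setT f ->
  (\int[mix g P]_t f t =
   \sum_(n <oo) ((weight g n)%:E * \int[P (nthX n)]_t f t))%E.
Proof.
move=> f0 mf; rewrite /mix ge0_integral_measure_series//.
by apply: eq_eseriesr => n _; rewrite ge0_integral_mscale.
Qed.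

End mix.

Definition outcome_law g : probability nat R :=
  mix g (fun x => @dirac _ nat (pickle x) R).

(** The mean of [f] under [g], defined as an integral so that linearity and monotonicity are
    inherited for bounded [f] of any sign; [av_series] gives the series in the nonnegative case. *)
Definition av g f : R := \int[outcome_law g]_n f (nthX n).

Section av_theory.
Implicit Types (M c : R) (h : X -> R).

Lemma av_integrable g M f : bounded_by M f ->
  (outcome_law g).-integrable setT (EFin \o (f \o nthX)).
Proof. by move=> Mf; apply: (@bounded_by_integrable _ _ _ _ M) => // n;
  exact: Mf. Qed.

Lemma av_series g M f : (forall x, 0 <= f x) -> bounded_by M f ->
  (av g f)%:E = (\sum_(n <oo) (weight g n * f (nthX n))%:E)%E.
Proof.
move=> f0 Mf; rewrite /av /Rintegral fineK; last first.
  by apply: integrable_fin_num => //; exact: av_integrable Mf.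
rewrite ge0_integral_mix//; last by move=> n; rewrite lee_fin.
apply: eq_eseriesr => n _; rewrite integral_dirac//= diracT mul1e.
by rewrite /weight; case E : (pickle_inv n) => [x|] /=;
  rewrite ?mul0e ?mul0r// /nthX E /= pickleK_inv.
Qed.

Lemma av_cst g c : av g (fun=> c) = c.
Proof. by rewrite /av Rintegral_cstT. Qed.

Lemma avD g M N f h : bounded_by M f -> bounded_by N h ->
  av g (fun x => f x + h x) = av g f + av g h.
Proof.
by move=> Mf Nh; rewrite /av RintegralD//;
  [exact: av_integrable Mf|exact: av_integrable Nh].
Qed.

Lemma avZ g M f c : bounded_by M f ->
  av g (fun x => c * f x) = c * av g f.
Proof. by move=> Mf; rewrite /av RintegralZl//; exact: av_integrable Mf. Qed.

Lemma avB g M N f h : bounded_by M f -> bounded_by N h ->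
  av g (fun x => f x - h x) = av g f - av g h.
Proof.
by move=> Mf Nh; rewrite /av RintegralB//;
  [exact: av_integrable Mf|exact: av_integrable Nh].
Qed.

Lemma ge0_av_eq g M N f h : (forall x, 0 <= f x) -> (forall x, 0 <= h x) ->
  bounded_by M f -> bounded_by N h ->
  (forall x, 0 < g x -> f x = h x) -> av g f = av g h.
Proof.
move=> f0 h0 Mf Nh fh; apply/EFin_inj.
rewrite (av_series _ f0 Mf) (av_series _ h0 Nh); apply: eq_eseriesr => n _.
have [->|E] := weight_nthX g n; first by rewrite !mul0r.
have [g0|] := ltP 0 (g (nthX n)); first by rewrite fh.
by move=> g0; rewrite (_ : weight g n = 0) ?mul0r//; apply/eqP;
  rewrite eq_le weight_ge0 E g0.
Qed.

Lemma bounded_by_ge0 M f : bounded_by M f -> 0 <= M.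
Proof. by move=> /(_ point); apply: le_trans. Qed.

Lemma bounded_by_ge M f x : bounded_by M f -> - M <= f x.
Proof. by move=> /(_ x); rewrite ler_norml => /andP[]. Qed.

Lemma bounded_by_le M f x : bounded_by M f -> f x <= M.
Proof. by move=> /(_ x); rewrite ler_norml => /andP[]. Qed.

Lemma av_eq g M N f h : bounded_by M f -> bounded_by N h ->
  (forall x, 0 < g x -> f x = h x) -> av g f = av g h.
Proof.
(* Adding [K] makes both functions nonnegative, which reduces the claim to [ge0_av_eq]. *)
move=> Mf Nh fh; pose K := M + N.
have M0 := bounded_by_ge0 Mf; have N0 := bounded_by_ge0 Nh.
have bK : bounded_by K (fun _ : X => K).
  by move=> x; rewrite ger0_norm// addr_ge0.
apply: (@addIr _ K); rewrite -{1}(av_cst g K) -{2}(av_cst g K).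
rewrite -(avD _ Mf bK) -(avD _ Nh bK).
apply: (ge0_av_eq _ _ (bounded_byD Mf bK) (bounded_byD Nh bK)).
- by move=> x; have := bounded_by_ge x Mf; rewrite /K; lra.
- by move=> x; have := bounded_by_ge x Nh; rewrite /K; lra.
- by move=> x /fh ->.
Qed.

Lemma ler_av g M N f h : bounded_by M f -> bounded_by N h ->
  (forall x, 0 < g x -> f x <= h x) -> av g f <= av g h.
Proof.
(* [k] dominates [f] everywhere and agrees with [h] on the support of [g]. *)
move=> Mf Nh fh; pose k x := Num.max (f x) (h x).
have bk : bounded_by (M + N) k.
  move=> x; have M0 := bounded_by_ge0 Mf; have N0 := bounded_by_ge0 Nh.
  rewrite /k; case: (leP (f x) (h x)) => _;
    first by rewrite (le_trans (Nh x))// lerDr.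
  by rewrite (le_trans (Mf x))// lerDl.
rewrite (@av_eq g N (M + N) h k)//; last first.
  by move=> x /fh fhx; rewrite /k max_r.
apply: le_Rintegral => //; [exact: av_integrable Mf|exact: av_integrable bk|].
by move=> n _; rewrite /k le_max lexx.
Qed.

Lemma av_ge0 g f : (forall x, 0 <= f x) -> 0 <= av g f.
Proof. by move=> f0; apply: Rintegral_ge0 => n _. Qed.

Lemma av_ge_term g M f x : (forall y, 0 <= f y) -> bounded_by M f ->
  g x * f x <= av g f.
Proof.
move=> f0 Mf; rewrite -lee_fin (av_series _ f0 Mf).
rewrite -{1}(nthX_pickle x) -weight_pickle {1}nthX_pickle.
apply: le_trans (nneseries_lim_ge (pickle x).+1 _); last first.
  by move=> n _ _; rewrite lee_fin mulr_ge0// weight_ge0.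
rewrite big_nat_recr//= nthX_pickle leeDr// sume_ge0// => n _.
by rewrite lee_fin mulr_ge0// weight_ge0.
Qed.

(** Maximum principle: [c - f] is nonnegative on the support and has mean at most 0, so none of its
    terms of positive weight can be positive. *)
Lemma av_max g M f c : bounded_by M f -> (forall x, 0 < g x -> f x <= c) ->
  c <= av g f -> forall x, 0 < g x -> f x = c.
Proof.
move=> Mf fc cav x gx; apply/eqP; rewrite eq_le fc//=.
(* The positive part agrees with [c - f] on the support and is nonnegative off it as well, as
   [av_ge_term] requires. *)
pose k y := Num.max 0 (c - f y).
have bk : bounded_by (`|c| + M) k.
  move=> y; rewrite /k; case: (leP 0 (c - f y)) => _.
    rewrite (le_trans (ler_normB _ _))// lerD//.
  by rewrite normr0 addr_ge0//; exact: bounded_by_ge0 Mf.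
have : g x * k x <= av g k.
  by apply: av_ge_term bk => y; rewrite /k le_max lexx.
rewrite (@av_eq g (`|c| + M) (`|c| + M) k (fun y => c - f y))//; last 2 first.
- by move=> y; rewrite (le_trans (ler_normB _ _))// lerD.
- by move=> y /fc fcy; rewrite /k max_r// subr_ge0.
rewrite (@avB g `|c| M)// av_cst => H.
have kx0 : k x <= 0.
  by rewrite -(pmulr_rle0 _ gx) (le_trans H)// subr_le0.
by move: kx0; rewrite /k ge_max lexx /= subr_le0.
Qed.

(** Otherwise [f] is strictly below its mean on the whole support, against [av_max]. This is what
    lets a randomized choice be replaced by one of its outcomes. *)
Lemma av_attained g M f : bounded_by M f -> exists x, 0 < g x /\ av g f <= f x.
Proof.
move=> Mf; apply: contrapT => H.
have lt x : 0 < g x -> f x < av g f.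
  by move=> gx; rewrite ltNge; apply/negP => ?; apply: H; exists x.
have [x gx] : exists x, 0 < g x.
  apply: contrapT => G; have := av_cst g 1; rewrite (@av_eq g 1 0 _ (fun=> 0)).
  - by rewrite av_cst => /eqP; rewrite eq_sym oner_eq0.
  - by move=> ?; rewrite normr1.
  - by move=> ?; rewrite normr0.
  - by move=> y gy; exfalso; apply: G; exists y.
have := av_max Mf (fun y gy => ltW (lt y gy)) (lexx _) gx.
by move/eqP; rewrite lt_eqF// lt.
Qed.

End av_theory.

End gambles.
Arguments gamble R X : clear implicits.

(** * Policies and the laws they induce *)

Section policies.
Context {R : realType} {X : pcountType}.
Implicit Types (g : gamble R X) (f : X -> R).

Lemma dirac_distr (x : X) : is_distr xpredT (fun y => (y == x)%:R : R).
Proof.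
split=> //; rewrite (esumID [set x]); last by move=> y _; rewrite lee_fin.
rewrite setTI esum_set1; last by rewrite lee_fin.
rewrite eqxx esum1 ?adde0// => y [_ /= yx].
by case: eqP => // xy; exfalso.
Qed.

Definition dirac_gamble x : gamble R X := Gamble (dirac_distr x).

Lemma av_dirac x M f : bounded_by M f -> av (dirac_gamble x) f = f x.
Proof.
move=> Mf; rewrite -(av_cst (dirac_gamble x) (f x)).
apply: (@av_eq _ _ _ M M) => //=; move=> y.
by case: eqP => [->//|_]; rewrite ltxx.
Qed.

Section av_mix.
Context d (T : measurableType d) (P : X -> probability T R).

Lemma Rintegral_bounded (Q : probability T R) M (F : T -> R) :
  measurable_fun setT F -> bounded_by M F -> `|\int[Q]_t F t| <= M.
Proof.
move=> mF MF; have iF := bounded_by_integrable Q mF MF.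
have M0 : 0 <= M by apply: le_trans (MF point).
have iM (c : R) : Q.-integrable setT (EFin \o (fun=> c)).
  by apply: (@bounded_by_integrable _ _ _ _ `|c|).
rewrite ler_norml; apply/andP; split.
  rewrite -(Rintegral_cstT Q (- M)); apply: le_Rintegral => // t _.
  by have := MF t; rewrite ler_norml => /andP[].
rewrite -(Rintegral_cstT Q M); apply: le_Rintegral => // t _.
by have := MF t; rewrite ler_norml => /andP[].
Qed.

(** For nonnegative integrands both sides are the same series; the general case follows by adding
    the bound [M]. *)
Lemma av_mix g M (F : T -> R) : measurable_fun setT F -> bounded_by M F ->
  av g (fun x => \int[P x]_t F t) = \int[mix g P]_t F t.
Proof.
have pos N (G : T -> R) : measurable_fun setT G -> bounded_by N G ->
    (forall t, 0 <= G t) ->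
    av g (fun x => \int[P x]_t G t) = \int[mix g P]_t G t.
  move=> mG NG G0; apply: EFin_inj; rewrite (@av_series _ _ _ N).
  - rewrite /Rintegral fineK; last first.
      by apply: integrable_fin_num => //; exact: bounded_by_integrable NG.
    rewrite ge0_integral_mix//; last exact/measurable_EFinP.
    apply: eq_eseriesr => n _; rewrite EFinM /Rintegral fineK//.
    by apply: integrable_fin_num => //; exact: bounded_by_integrable NG.
  - by move=> x; exact: Rintegral_ge0.
  - by move=> x; exact: Rintegral_bounded.
move=> mF MF; have M0 : 0 <= M by apply: le_trans (MF point).
have bM : bounded_by M (fun _ : T => M) by move=> t; rewrite ger0_norm.
have bMX : bounded_by M (fun _ : X => M) by move=> t; rewrite ger0_norm.
have D (Q : probability T R) :
    \int[Q]_t (F t + M) = \int[Q]_t F t + M.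
  rewrite RintegralD ?Rintegral_cstT//; first exact: bounded_by_integrable MF.
  exact: bounded_by_integrable bM.
apply: (@addIr _ M); rewrite -D -(pos (M + M))//.
- under [in RHS]eq_fun do rewrite D.
  rewrite (@avD _ _ _ M M) ?av_cst// => x; exact: Rintegral_bounded.
- by apply: measurable_funD.
- exact: bounded_byD MF bM.
- by move=> t; have := MF t; rewrite ler_norml => /andP[]; lra.
Qed.

End av_mix.

(** With all states controlled and all transitions present, every policy is a strategy, so the
    measures already constructed for strategies serve for policies too. *)
Definition free_mdp : mdp R X :=
  @MDP R X xpredT (fun _ => xpredT) (fun _ _ => 0) (fun _ _ => 0)
    (fun s => ex_intro _ s isT) (fun s H => False_ind _ (notF H)).

Definition policy := seq X -> X -> gamble R X.
Implicit Types p q : policy.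

Definition policy_strategy p : strategy free_mdp :=
  @Strategy _ _ free_mdp (fun h s => p h s) (fun h s _ => gval_distr (p h s)).

Definition path p s w : R := path_prob (policy_strategy p) [::] s w.

Definition pshift p s : policy := fun h t => p (s :: h) t.

Lemma path_cons p s t w : path p s (t :: w) = p [::] s t * path (pshift p s) t w.
Proof.
rewrite /path /= /step /=; congr (_ * _).
suff H h : path_prob (policy_strategy p) (s :: h) t w =
    path_prob (policy_strategy (pshift p s)) h t w by exact: H.
by elim: w t h => //= u w IH t h; rewrite -IH.
Qed.

Lemma path_ge0 p s w : 0 <= path p s w.
Proof.
elim: w p s => [|t w IH] p s; first exact: ler01.
by rewrite path_cons mulr_ge0// gamble_ge0.
Qed.

Definition run_traj (M : mdp R X) s (rho : run M s) : traj X := state rho.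

Lemma run_traj_cyl (M : mdp R X) s t w :
  @run_traj M s @^-1` cyl (t :: w) =
  if t == s then cylinder w else set0.
Proof.
have E (rho : run M s) : mkseq (state rho) (size w).+1 =
    s :: mkseq (fun i => state rho i.+1) (size w).
  rewrite /mkseq /= -[1%N]/(1 + 0)%N iotaDl -map_comp.
  by congr (_ :: _); exact: state0.
apply/seteqP; split => rho.
  by rewrite -[_ rho]/(mkseq (state rho) (size w).+1 = t :: w) E
    => -[<- ?]; rewrite eqxx.
case: eqP => [->|//] /= H.
by have := E rho; rewrite H.
Qed.

Lemma run_traj_measurable (M : mdp R X) s :
  measurable_fun setT (@run_traj M s).
Proof.
apply: (@measurability _ _ _ _ _ _ (range (@cyl X))) => //.
move=> _ [_ [[|t w] _ <-] <-]; rewrite setTI.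
  by rewrite (_ : _ @^-1` _ = setT)//; apply/seteqP.
rewrite run_traj_cyl; case: ifP => // _.
by apply: sub_sigma_algebra; exists w.
Qed.

HB.instance Definition _ (M : mdp R X) s :=
  isMeasurableFun.Build _ _ _ _ _ (@run_traj_measurable M s).

(** Pushing the measure on runs forward to trajectories puts the laws for all start states on one
    space. *)
Definition run_law (M : mdp R X) (sigma : strategy M) s :
    probability (traj X) R :=
  distribution (induced_measure s sigma) (@run_traj M s).

Lemma run_law_cyl (M : mdp R X) (sigma : strategy M) s t w :
  run_law sigma s (cyl (t :: w)) =
  ((t == s)%:R * path_prob sigma [::] s w)%:E.
Proof.
rewrite -[LHS]/(induced_measure s sigma (@run_traj M s @^-1` _)) run_traj_cyl.
case: ifP => _; last by rewrite measure0 mul0r.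
by rewrite induced_measureE mul1r.
Qed.

Definition law p s := run_law (policy_strategy p) s.

HB.instance Definition _ s :=
  isMeasurableFun.Build _ _ _ _ _ (@tcons_measurable X s).

Definition law_tcons s (P : probability (traj X) R) :
    probability (traj X) R := distribution P (tcons s).

Lemma law_cyl p s t w : law p s (cyl (t :: w)) = ((t == s)%:R * path p s w)%:E.
Proof. exact: run_law_cyl. Qed.

Lemma path_le1 p s w : path p s w <= 1.
Proof.
have := probability_le1 (law p s) (cyl_measurable (s :: w)).
by rewrite law_cyl eqxx mul1r lee_fin.
Qed.

Lemma av_pred1 g x : av g (fun y => (y == x)%:R) = g x.
Proof.
apply: EFin_inj; rewrite (@av_series _ _ _ 1)//; last first.
  by move=> y; case: eqP; rewrite /= ?normr1 ?normr0.
rewrite nneseries_esumT; last first.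
  by move=> n; rewrite lee_fin mulr_ge0// weight_ge0.
rewrite (esumID [set pickle x]); last first.
  by move=> n _; rewrite lee_fin mulr_ge0// weight_ge0.
rewrite setTI esum_set1; last by rewrite lee_fin mulr_ge0// weight_ge0.
rewrite nthX_pickle weight_pickle eqxx mulr1 esum1 ?adde0// => n [_ /= nx].
rewrite /nthX /weight; move: (@pickle_invK X n).
case: pickle_inv => [y|] /=; last by rewrite mul0r.
by move=> yn; case: eqP => [yx|]; [case: nx; rewrite -yn yx|rewrite mulr0].
Qed.

(** First-step decomposition: the law is the mixture, over the first move, of the laws of the
    continuations with [s] put in front. It is enough to compare cylinders. *)
Lemma law_onestep p s A : measurable A ->
  law p s A = mix (p [::] s) (fun t => law_tcons s (law (pshift p s) t)) A.
Proof.
move=> mA; apply: traj_measure_unique => //.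
  by rewrite /= probability_setT ltry.
move=> [|u w].
  by rewrite cyl_nil; exact: etrans (probability_setT _) (esym (mix_setT _ _)).
apply: etrans (law_cyl _ _ _ _) _; apply/esym.
rewrite -[LHS]/(\sum_(0 <= n <oo) ((weight (p [::] s) n)%:E *
  law_tcons s (law (pshift p s) (nthX n)) (cyl (u :: w))))%E.
(* The probability of the cylinder given that the first move leads to [t]. *)
pose k t : R := (u == s)%:R *
  (if w is v :: w' then (t == v)%:R * path (pshift p s) v w' else 1).
have E t : law_tcons s (law (pshift p s) t) (cyl (u :: w)) = (k t)%:E.
  rewrite -[LHS]/(law (pshift p s) t (tcons s @^-1` _)) tcons_cyl /k.
  case: (u == s); last by rewrite measure0 mul0r.
  case: w {k} => [|v w].
    by rewrite cyl_nil mul1r; exact: probability_setT.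
  by rewrite law_cyl mul1r eq_sym; case: eqP => [->//|_]; rewrite !mul0r.
under eq_eseriesr => n _ do rewrite E -EFinM.
have k0 t : 0 <= k t.
  rewrite /k mulr_ge0//; case: (w) => // v w'.
  by rewrite mulr_ge0// path_ge0.
have b1 (b : bool) (r : R) : `|r| <= 1 -> `|b%:R * r| <= 1.
  by case: b; rewrite ?mul1r ?mul0r ?normr0.
have k1 : bounded_by 1 k.
  move=> t; rewrite /k; apply: (b1 (u == s)); case: (w) => [|v w'].
    by rewrite normr1.
  by apply: (b1 (t == v)); rewrite ger0_norm ?path_ge0 ?path_le1.
rewrite -(av_series _ k0 k1); congr EFin; rewrite /k.
case: w {E k k0 k1} => [|v w]; first by rewrite av_cst.
rewrite path_cons -av_pred1 (mulrC (av _ _)) mulrA.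
rewrite -(@avZ _ _ _ 1); last first.
  by move=> t; case: eqP; rewrite /= ?normr1 ?normr0.
by congr (av _); apply/funext => t; rewrite [in LHS]mulrC -[LHS]mulrA [LHS]mulrC
  [_ * (u == s)%:R]mulrC.
Qed.

Definition expect p s (F : traj X -> R) : R := \int[law p s]_om F om.

Definition Pr p s (A : set (traj X)) : R := fine (law p s A).

Lemma expect_onestep p s M F : measurable_fun setT F -> bounded_by M F ->
  expect p s F =
  av (p [::] s) (fun t => expect (pshift p s) t (F \o tcons s)).
Proof.
move=> mF MF.
have mFs : measurable_fun setT (F \o tcons s).
  by apply: measurableT_comp => //; exact: tcons_measurable.
have MFs : bounded_by M (F \o tcons s) by move=> om; exact: MF.
transitivity (\int[mix (p [::] s)
    (fun t => law_tcons s (law (pshift p s) t))]_om F om).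
  congr fine; apply: eq_measure_integral => A mA _; exact: law_onestep.
rewrite -(av_mix _ _ mF MF); congr av; apply/funext => t; congr fine.
rewrite integral_distribution//; first exact/measurable_EFinP.
exact: bounded_by_integrable MFs.
Qed.

Lemma Pr_expect p s A : measurable A -> Pr p s A = expect p s \1_A.
Proof.
by move=> mA; rewrite /Pr /expect /Rintegral integral_indic// setIT.
Qed.

Lemma indic_bounded (A : set (traj X)) : bounded_by 1 (\1_A : traj X -> R).
Proof. by move=> om; rewrite indicE; case: (_ \in _); rewrite ?normr1 ?normr0. Qed.

Lemma Pr_onestep p s A : measurable A ->
  Pr p s A = av (p [::] s) (fun t => Pr (pshift p s) t (tcons s @^-1` A)).
Proof.
move=> mA; rewrite Pr_expect// (expect_onestep _ _ _ (@indic_bounded A)).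
  congr av; apply/funext => t; rewrite Pr_expect; last first.
    by rewrite -[X in measurable X]setTI; exact: tcons_measurable.
  by congr expect; apply/funext => om; rewrite /= !indicE.
exact: measurable_indic.
Qed.

End policies.
Arguments policy R X : clear implicits.

(** * Probabilities of events *)

Section measurability.
Context d (T : measurableType d).

Lemma measurable_all (P : nat -> T -> Prop) :
  (forall n, measurable [set x | P n x]) -> measurable [set x | forall n, P n x].
Proof.
move=> mP; rewrite (_ : [set _ | _] = \bigcap_n [set x | P n x]).
  exact: bigcapT_measurable.
by apply/seteqP; split => x /= H n; [move=> _; exact: H|exact: (H n I)].
Qed.

Lemma measurable_ex (P : nat -> T -> Prop) :
  (forall n, measurable [set x | P n x]) ->
  measurable [set x | exists n, P n x].
Proof.
move=> mP; rewrite (_ : [set _ | _] = \bigcup_n [set x | P n x]).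
  exact: bigcupT_measurable.
by apply/seteqP; split => x /= [n]; exists n.
Qed.

Lemma measurable_impl (Q : Prop) (P : T -> Prop) :
  (Q -> measurable [set x | P x]) -> measurable [set x | Q -> P x].
Proof.
move=> mP; have [q|nq] := pselect Q.
  rewrite (_ : [set _ | _] = [set x | P x]); first exact: mP.
  by apply/seteqP; split => x /=; [exact|move=> ? _].
by rewrite (_ : [set _ | _] = setT)//; apply/seteqP; split => x //= _ /nq.
Qed.

Lemma measurable_conj (Q : Prop) (P : T -> Prop) :
  (Q -> measurable [set x | P x]) -> measurable [set x | Q /\ P x].
Proof.
move=> mP; have [q|nq] := pselect Q.
  rewrite (_ : [set _ | _] = [set x | P x]); first exact: mP.
  by apply/seteqP; split => x /=; [case|].
by rewrite (_ : [set _ | _] = set0)//; apply/seteqP; split => x //= -[/nq].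
Qed.

End measurability.

Section probability_toolkit.
Context {R : realType} {X : pcountType}.
Implicit Types (p q : policy R X) (s : X) (A B : set (traj X)).

Lemma transition_measurable (A : seq X -> X -> X -> Prop) n :
  measurable [set om : traj X | A (mkseq om n) (om n) (om n.+1)].
Proof.
rewrite (_ : [set _ | _] = [set om : traj X | [set u : seq X * X |
  A (take n u.1) (last point u.1) u.2] (mkseq om n.+1, om n.+1)]).
  exact: current_measurable.
apply: eq_set => om.
rewrite -[RHS]/(A (take n (mkseq om n.+1)) (last point (mkseq om n.+1)) _).
by rewrite mkseqS last_rcons -cats1 take_size_cat ?size_mkseq.
Qed.

Lemma history_measurable (A : seq X -> X -> Prop) n :
  measurable [set om : traj X | A (mkseq om n) (om n)].
Proof. exact: (@transition_measurable (fun h t _ => A h t)). Qed.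

Lemma tcons_preimage_measurable s A : measurable A ->
  measurable (tcons s @^-1` A).
Proof.
by move=> mA; rewrite -[X in measurable X]setTI; exact: tcons_measurable.
Qed.

Lemma EFin_Pr p s A : measurable A -> (Pr p s A)%:E = law p s A.
Proof. by move=> mA; rewrite /Pr fineK// fin_num_measure. Qed.

Lemma Pr_ge0 p s A : 0 <= Pr p s A.
Proof. by rewrite /Pr fine_ge0. Qed.

Lemma Pr_le1 p s A : measurable A -> Pr p s A <= 1.
Proof. by move=> mA; rewrite -lee_fin EFin_Pr// probability_le1. Qed.

Lemma Pr_bounded p s A : measurable A -> `|Pr p s A| <= 1.
Proof. by move=> mA; rewrite ger0_norm ?Pr_ge0// Pr_le1. Qed.

Lemma Pr_setT p s : Pr p s setT = 1.
Proof. by apply: EFin_inj; rewrite EFin_Pr//; exact: probability_setT. Qed.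

Lemma Pr_set0 p s : Pr p s set0 = 0.
Proof. by apply: EFin_inj; rewrite EFin_Pr// measure0. Qed.

Lemma Pr_start p s : Pr p s [set om | om 0%N = s] = 1.
Proof.
rewrite (_ : [set _ | _] = cyl [:: s]).
  apply: EFin_inj; rewrite EFin_Pr ?law_cyl; last exact: cyl_measurable.
  by rewrite eqxx mul1r /path.
apply/seteqP; split => om; last by case.
by move=> om0; rewrite /cyl /mkset /mkseq /= om0.
Qed.

Lemma sub_Pr p s A B : measurable A -> measurable B -> A `<=` B ->
  Pr p s A <= Pr p s B.
Proof.
by move=> mA mB AB; rewrite -lee_fin !EFin_Pr//; apply: le_measure;
  rewrite ?inE.
Qed.

Lemma Pr_setU p s A B : measurable A -> measurable B ->
  Pr p s (A `|` B) <= Pr p s A + Pr p s B.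
Proof.
move=> mA mB; rewrite -lee_fin EFinD !EFin_Pr//; last exact: measurableU.
exact: measureU2.
Qed.

Lemma Pr_setU_disj p s A B : measurable A -> measurable B -> A `&` B = set0 ->
  Pr p s (A `|` B) = Pr p s A + Pr p s B.
Proof.
move=> mA mB AB; apply: EFin_inj.
rewrite EFinD !EFin_Pr//; last exact: measurableU.
exact: measureU.
Qed.

Lemma Pr_setD p s A B : measurable A -> measurable B ->
  Pr p s A = Pr p s (A `&` B) + Pr p s (A `\` B).
Proof.
move=> mA mB; rewrite -Pr_setU_disj ?setUIDK//.
- exact: measurableI.
- exact: measurableD.
- by rewrite setDE setIACA setICr setI0.
Qed.

Lemma Pr_setC p s A : measurable A -> Pr p s (~` A) = 1 - Pr p s A.
Proof.
move=> mA; rewrite -(Pr_setT p s) (Pr_setD _ _ measurableT mA) setTI setTD.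
by rewrite addrAC subrr add0r.
Qed.

(** The inclusion is only asked for trajectories that start in [s], since these have full
    probability. *)
Lemma ler_Pr p s A B : measurable A -> measurable B ->
  (forall om, om 0%N = s -> A om -> B om) -> Pr p s A <= Pr p s B.
Proof.
move=> mA mB AB.
have m0 : measurable [set om : traj X | om 0%N = s].
  exact: (@coord_measurable _ [set x | x = s]).
rewrite (Pr_setD _ _ mA m0) [X in _ + X](_ : _ = 0) ?addr0.
  by apply: sub_Pr => //; [exact: measurableI|move=> om [? ?]; exact: AB].
apply/eqP; rewrite eq_le Pr_ge0 andbT.
apply: le_trans (_ : Pr p s (~` [set om | om 0%N = s]) <= 0).
  by apply: sub_Pr; [exact: measurableD|exact: measurableC|move=> om []].
by rewrite Pr_setC// Pr_start subrr.
Qed.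

Lemma eq_Pr p s A B : measurable A -> measurable B ->
  (forall om, om 0%N = s -> A om <-> B om) -> Pr p s A = Pr p s B.
Proof.
by move=> mA mB AB; apply/eqP; rewrite eq_le; apply/andP; split;
  apply: ler_Pr => // om /AB[].
Qed.

Lemma Pr_bigcap_ge p s (F : nat -> set (traj X)) (c : R) :
  (forall n, measurable (F n)) -> (forall n, F n.+1 `<=` F n) ->
  (forall n, c <= Pr p s (F n)) -> c <= Pr p s (\bigcap_n F n).
Proof.
move=> mF decF cF; have mI : measurable (\bigcap_n F n).
  exact: bigcapT_measurable.
rewrite -lee_fin EFin_Pr//.
have cvgF : law p s \o F @ \oo --> law p s (\bigcap_n F n).
  apply: nonincreasing_cvg_mu => //; first by rewrite /= -EFin_Pr// ltry.
  by apply/nonincreasing_seqP => n; apply/subsetPset.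
rewrite -(cvg_lim _ cvgF)//; apply: lime_ge; first by apply/cvg_ex; eexists;
  exact: cvgF.
by apply: nearW => n; rewrite /= -EFin_Pr// lee_fin.
Qed.

Lemma Pr_bigcup_le p s (F : nat -> set (traj X)) (c : R) :
  (forall n, measurable (F n)) -> (forall n, F n `<=` F n.+1) ->
  (forall n, Pr p s (F n) <= c) -> Pr p s (\bigcup_n F n) <= c.
Proof.
move=> mF incF cF.
have mU : measurable (\bigcup_n F n) by exact: bigcupT_measurable.
have := @Pr_bigcap_ge p s (fun n => ~` F n) (1 - c).
rewrite -setC_bigcup Pr_setC// lerD2l lerN2; apply.
- by move=> n; exact: measurableC.
- by move=> n; apply: subsetC.
- by move=> n; rewrite Pr_setC// lerD2l lerN2.
Qed.

Lemma Pr_ex_null p s (P : nat -> traj X -> Prop) :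
  (forall n, measurable [set om | P n om]) ->
  (forall n, Pr p s [set om | P n om] = 0) ->
  Pr p s [set om | exists n, P n om] = 0.
Proof.
move=> mP P0; apply/eqP; rewrite eq_le Pr_ge0 andbT.
have mbU n : measurable [set om | exists i, (i < n)%N /\ P i om].
  by apply: measurable_ex => i; exact: measurable_conj.
rewrite (_ : [set _ | _] =
    \bigcup_n [set om | exists i, (i < n)%N /\ P i om]); last first.
  apply/seteqP; split => om /= [n]; first by exists n.+1 => //; exists n.
  by move=> _ [i [_ ?]]; exists i.
apply: Pr_bigcup_le => // [n om /= [i [/ltnW ? ?]]|n]; first by exists i.
elim: n => [|n IH].
  rewrite (_ : [set _ | _] = set0) ?Pr_set0//.
  by apply/seteqP; split => om //= [i []].
apply: le_trans (_ : Pr p s ([set om | exists i, (i < n)%N /\ P i om] `|`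
  [set om | P n om]) <= _).
  apply: sub_Pr => //; first exact: measurableU.
  move=> om /= [i []]; rewrite ltnS leq_eqVlt => /orP[/eqP ->|]; first by right.
  by left; exists i.
by rewrite (le_trans (Pr_setU _ _ _ _))// P0 addr0.
Qed.

Lemma Pr1_setI p s A B : measurable A -> measurable B -> Pr p s A = 1 ->
  Pr p s (B `&` A) = Pr p s B.
Proof.
move=> mA mB A1; rewrite [RHS](Pr_setD _ _ mB mA).
suff -> : Pr p s (B `\` A) = 0 by rewrite addr0.
apply/eqP; rewrite eq_le Pr_ge0 andbT -(subrr (1 : R)) -{2}A1 -Pr_setC//.
by apply: sub_Pr; [exact: measurableD|exact: measurableC|move=> om []].
Qed.

End probability_toolkit.

(** * Avoiding bad transitions *)

Section safety.
Context {R : realType} {X : pcountType}.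
Implicit Types (p q : policy R X) (s : X) (h : seq X).

Definition pshifts p h : policy R X := fun h' t => p (h ++ h') t.

Lemma pshifts_nil p : pshifts p [::] = p.
Proof. by []. Qed.

Lemma pshift_pshifts p h s : pshift (pshifts p h) s = pshifts p (rcons h s).
Proof.
by apply/funext => h'; apply/funext => t; rewrite /pshift /pshifts cat_rcons.
Qed.

Lemma Pr_pshifts_onestep p h s A : measurable A ->
  Pr (pshifts p h) s A = av (p h s)
    (fun t => Pr (pshifts p (rcons h s)) t (tcons s @^-1` A)).
Proof. by move=> mA; rewrite Pr_onestep// pshift_pshifts /pshifts cats0. Qed.

Definition never (bad : seq X -> X -> X -> Prop) : set (traj X) :=
  [set om | forall n, ~ bad (mkseq om n) (om n) (om n.+1)].

Lemma never_measurable bad : measurable (never bad).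
Proof.
apply: measurable_all => n.
exact: (@transition_measurable _ (fun h t u => ~ bad h t u)).
Qed.

(* Optional stopping for a submartingale that is killed at the bad
   transitions. *)
Lemma never_lower_bound p s (bad : seq X -> X -> X -> Prop)
    (l : seq X -> X -> R) :
  (forall h t, 0 <= l h t <= 1) ->
  (forall h t, l h t <= av (p h t)
     (fun u => if `[< bad h t u >] then 0 else l (rcons h t) u)) ->
  l [::] s <= Pr p s (never bad).
Proof.
move=> l01 lsub.
pose F h n := [set om : traj X | forall i, (i < n)%N ->
  ~ bad (h ++ mkseq om i) (om i) (om i.+1)].
have mF h n : measurable (F h n).
  apply: measurable_all => i; apply: measurable_impl => _.
  exact: (@transition_measurable _ (fun g t u => ~ bad (h ++ g) t u)).
have bl h t : bounded_by 1 (fun u => if `[< bad h t u >] then 0 else l (rcons h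
  t) u).
  move=> u; case: ifP => _; first by rewrite normr0.
  by have /andP[? ?] := l01 (rcons h t) u; rewrite ger0_norm.
have key n h t : l h t <= Pr (pshifts p h) t (F h n).
  elim: n h t => [|n IH] h t.
    rewrite (_ : F h 0%N = setT); first by rewrite Pr_setT; case/andP: (l01 h t).
    by apply/seteqP; split.
  rewrite Pr_pshifts_onestep//; apply: le_trans (lsub h t) _.
  have bP : bounded_by 1 (fun u =>
      Pr (pshifts p (rcons h t)) u (tcons t @^-1` F h n.+1)).
    by move=> u; rewrite Pr_bounded//; exact: tcons_preimage_measurable.
  apply: (ler_av (bl h t) bP) => u _.
  case: asboolP => [_|nbad]; first exact: Pr_ge0.
  apply: le_trans (IH _ _) _; apply: ler_Pr => //.
    exact: tcons_preimage_measurable.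
  move=> om om0 Fom [|i] /=; first by rewrite cats0 om0.
  rewrite ltnS => /Fom; rewrite mkseq_tcons cat_rcons; exact.
rewrite (_ : never bad = \bigcap_n F [::] n).
  apply: Pr_bigcap_ge => // [n om Fom i /ltnW].
  exact: Fom.
apply/seteqP; split => om /=; first by move=> H n _ i _; exact: H.
by move=> H n; exact: (H n.+1 I n (ltnSn _)).
Qed.

(** [never_lower_bound] applied to the indicator of the invariant [good]. *)
Lemma never_as p s (bad : seq X -> X -> X -> Prop) (good : seq X -> X -> Prop) :
  good [::] s ->
  (forall h t, good h t -> forall u, 0 < p h t u ->
     ~ bad h t u /\ good (rcons h t) u) ->
  Pr p s (never bad) = 1.
Proof.
move=> g0 gS; apply/eqP; rewrite eq_le Pr_le1 /=; last exact: never_measurable.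
have := @never_lower_bound p s bad (fun h t => `[< good h t >]%:R).
rewrite asboolT//; apply.
  by move=> h t; case: asboolP => _; rewrite /= ?lexx ?ler01.
move=> h t; case: asboolP => [gt|_]; last first.
  by apply: av_ge0 => u; case: ifP.
rewrite -[leLHS](av_cst (p h t) 1); apply: (@ler_av _ _ _ 1 1).
- by move=> u; rewrite normr1.
- move=> u; case: ifP => _; first by rewrite normr0.
  by case: asboolP; rewrite /= ?normr1 ?normr0.
- by move=> u /(gS _ _ gt)[nb gu]; rewrite asboolF// asboolT.
Qed.

End safety.

(** * Approximation of events by prefix events *)

Section approximation.
Context {R : realType} {X : pcountType} (p : policy R X) (s : X).

Definition symdiff (T : Type) (A B : set T) := (A `\` B) `|` (B `\` A).

Lemma symdiff_measurable (A B : set (traj X)) :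
  measurable A -> measurable B -> measurable (symdiff A B).
Proof. by move=> mA mB; apply: measurableU; exact: measurableD. Qed.

(** The events that can be approximated form a sigma-algebra containing the cylinders: a finite
    union needs only the longer of two prefixes, and a countable union is close to a finite one by
    continuity. *)
Lemma prefix_approximation (A : set (traj X)) : measurable A ->
  forall e, 0 < e -> exists N (W : set (seq X)),
    Pr p s (symdiff A [set om | W (mkseq om N)]) < e.
Proof.
pose G := [set A : set (traj X) | measurable A /\
  forall e, 0 < e -> exists N (W : set (seq X)),
    Pr p s (symdiff A [set om | W (mkseq om N)]) < e].
have mW N (W : set (seq X)) : measurable [set om : traj X | W (mkseq om N)].
  exact: prefix_measurable.
have G0 : G set0.
  split=> // e e0; exists 0%N, set0.
  rewrite (_ : symdiff _ _ = set0) ?Pr_set0//.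
  by apply/seteqP; split => om //= [[]|[]].
have GU B C : G B -> G C -> G (B `|` C).
  move=> [mB GB] [mC GC]; split; first exact: measurableU.
  move=> e e0; have e20 : 0 < e / 2 by rewrite divr_gt0.
  have [N [W HW]] := GB _ e20; have [N' [W' HW']] := GC _ e20.
  exists (maxn N N'), [set w | W (take N w) \/ W' (take N' w)].
  have E (om : traj X) : (take N (mkseq om (maxn N N')) = mkseq om N) *
      (take N' (mkseq om (maxn N N')) = mkseq om N').
    by rewrite /mkseq -!map_take !take_iota (minn_idPl (leq_maxl _ _))
      (minn_idPl (leq_maxr _ _)).
  rewrite (splitr e); apply: le_lt_trans (ltrD HW HW').
  apply: le_trans (Pr_setU _ _ (symdiff_measurable mB (mW _ _))
    (symdiff_measurable mC (mW _ _))).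
  apply: sub_Pr; first apply: symdiff_measurable.
  - exact: measurableU.
  - by rewrite [X in measurable X](_ : _ =
      [set om | W (mkseq om N)] `|` [set om | W' (mkseq om N')]);
      [exact: measurableU|apply/seteqP; split => om /=; rewrite !E].
  - by apply: measurableU; exact: symdiff_measurable.
  - move=> om; rewrite /symdiff /= !E; tauto.
have GC B : G B -> G (~` B).
  move=> [mB GB]; split; first exact: measurableC.
  move=> e /GB[N [W HW]]; exists N, (~` W).
  rewrite (_ : symdiff _ _ = symdiff B [set om | W (mkseq om N)])//.
  rewrite /symdiff !setDE setCK -[[set om | _]]/(~` [set om | W (mkseq om N)]).
  by rewrite setCK setUC setIC [X in _ `|` X]setIC.
suff GS : sigma_algebra setT G.
  move=> mA; suff [] : G A by [].
  move: A mA; apply: smallest_sub => // B [w _ <-].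
  split; first exact: cyl_measurable.
  move=> e e0; exists (size w), [set w].
  rewrite (_ : symdiff _ _ = set0) ?Pr_set0//.
  apply/seteqP; split => om //; rewrite /symdiff /cyl /=; tauto.
split=> // [B|F GF]; first by rewrite setTD; exact: GC.
have mF n : measurable (F n) by have [] := GF n.
pose V n := \big[setU/set0]_(i < n) F i.
have GV n : G (V n).
  rewrite /V; elim: n => [|n IH]; first by rewrite big_ord0.
  by rewrite big_ord_recr; exact: GU.
have mU : measurable (\bigcup_n F n) by exact: bigcupT_measurable.
have mV n : measurable (V n) by have [] := GV n.
split=> // e e0; have e20 : 0 < e / 2 by rewrite divr_gt0.
have [n Hn] : exists n, Pr p s (\bigcup_n F n `\` V n) < e / 2.
  apply: contrapT => /forallNP H.
  have : e / 2 <= Pr p s (\bigcap_n (\bigcup_n F n `\` V n)).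
    apply: Pr_bigcap_ge => [n|n|n]; first exact: measurableD.
    - apply: setDS; rewrite /V big_ord_recr/=; exact: subsetUl.
    - by rewrite leNgt; apply/negP; exact: H.
  rewrite (_ : \bigcap_n _ = set0) ?Pr_set0; first by rewrite leNgt e20.
  apply/seteqP; split => om // H0; have [[k _ Fk] _] := H0 0%N I.
  have [_] := H0 k.+1 I; apply; rewrite /V big_ord_recr/=; by right.
have [N [W HW]] := (GV n).2 _ e20; exists N, W.
rewrite (splitr e); apply: le_lt_trans (ltrD Hn HW).
apply: le_trans (Pr_setU _ _ (measurableD mU (mV n))
  (symdiff_measurable (mV n) (mW _ _))).
apply: sub_Pr; first exact: symdiff_measurable.
  by apply: measurableU; [exact: measurableD|exact: symdiff_measurable].
have VU om : V n om -> (\bigcup_n F n) om.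
  by rewrite /V -bigcup_mkord => -[k _ Fk]; exists k.
move=> om; have := VU om; rewrite /symdiff /=.
by have [] := pselect (V n om); tauto.
Qed.

End approximation.

(** * Switching policies and tail events *)

Section composition.
Context {R : realType} {X : pcountType}.
Implicit Types (p q : policy R X) (s : X) (h : seq X).

(** [good] is an invariant of the histories of positive probability, and the two policies need to
    agree only there. *)
Lemma law_ext p q s (good : seq X -> X -> Prop) :
  good [::] s ->
  (forall h t, good h t -> p h t = q h t /\
     forall u, 0 < p h t u -> good (rcons h t) u) ->
  forall A, measurable A -> law p s A = law q s A.
Proof.
move=> g0 gS.
have pathE w h t : good h t -> path (pshifts p h) t w = path (pshifts q h) t w.
  elim: w h t => // u w IH h t /gS[pq gp].
  rewrite !path_cons !pshift_pshifts /pshifts !cats0 pq.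
  have [qu|] := ltP 0 (q h t u); first by rewrite IH//; apply: gp; rewrite pq.
  move=> qu; have -> : q h t u = 0 by apply/eqP; rewrite eq_le qu gamble_ge0.
  by rewrite !mul0r.
apply: traj_measure_unique; first by rewrite /= probability_setT ltry.
move=> [|u w]; first by rewrite cyl_nil;
  exact: etrans (probability_setT _) (esym (probability_setT _)).
by apply: etrans (law_cyl _ _ _ _) (etrans _ (esym (law_cyl _ _ _ _)));
  rewrite -(pshifts_nil p) -(pshifts_nil q) pathE.
Qed.

Lemma eq_expect p q s F : (forall A, measurable A -> law p s A = law q s A) ->
  expect p s F = expect q s F.
Proof. by move=> pq; congr fine; apply: eq_measure_integral => A mA _;
  exact: pq. Qed.

(* Play [g] in the state [s] and then, from the state [t] that is reached, the
   policy [q t]. Other initial states are irrelevant. *)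
Definition pcons s (g : gamble R X) (q : X -> policy R X) : policy R X :=
  fun h t => if h is _ :: h' then q (head t h') h' t
             else if t == s then g else q t [::] t.

Lemma pcons_nil s g (q : X -> policy R X) : pcons s g q [::] s = g.
Proof. by rewrite /pcons eqxx. Qed.

Lemma law_pcons s g (q : X -> policy R X) t A : measurable A ->
  law (pshift (pcons s g q) s) t A = law (q t) t A.
Proof.
(* The invariant says that the trajectory began in [t]: [head u h] is the first state of the history
   [h] followed by [u]. *)
apply: (@law_ext _ _ _ (fun h u => head u h = t)) => // h u <-.
by split=> [|v _]; [|case: h].
Qed.

Lemma expect_pcons s g (q : X -> policy R X) M F : measurable_fun setT F ->
  bounded_by M F ->
  expect (pcons s g q) s F = av g (fun t => expect (q t) t (F \o tcons s)).
Proof.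
move=> mF MF; rewrite (expect_onestep _ _ mF MF) pcons_nil.
by congr (av _); apply/funext => t; apply: eq_expect => A; exact: law_pcons.
Qed.

Lemma Pr_pcons s g (q : X -> policy R X) A : measurable A ->
  Pr (pcons s g q) s A = av g (fun t => Pr (q t) t (tcons s @^-1` A)).
Proof.
move=> mA; rewrite Pr_onestep// pcons_nil.
by congr (av _); apply/funext => t; congr fine; apply: law_pcons;
  exact: tcons_preimage_measurable.
Qed.

Definition house := X -> set (gamble R X).

Definition in_house (G : house) p := forall h t, G t (p h t).

Lemma in_house_pshift G p s : in_house G p -> in_house G (pshift p s).
Proof. by move=> Gp h t; exact: Gp. Qed.

Lemma in_house_pcons G s g (q : X -> policy R X) : G s g -> (forall t, in_house
  G (q t)) ->
  in_house G (pcons s g q).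
Proof.
move=> Gg Gq [|x h] t; last exact: Gq.
by rewrite /pcons; case: eqP => [->|_]; [|exact: Gq].
Qed.

End composition.

Section tail_events.
Context {R : realType} {X : pcountType}.
Implicit Types (p q : policy R X) (s : X) (h : seq X).

Definition tail (A : set (traj X)) := forall s, tcons s @^-1` A = A.

Let prefix_set N (W : set (seq X)) := [set om : traj X | W (mkseq om N)].

Let mprefix N W : measurable (prefix_set N W).
Proof. exact: prefix_measurable. Qed.

Let prefix_tcons N W s :
  tcons s @^-1` prefix_set N.+1 W = prefix_set N [set w | W (s :: w)].
Proof. by apply/seteqP; split => om; rewrite /prefix_set /= mkseq_tcons. Qed.

Let tcons_setD s (A B : set (traj X)) : tcons s @^-1` (A `\` B) =
  (tcons s @^-1` A) `\` (tcons s @^-1` B).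
Proof. by []. Qed.

Let prefix0 W : prefix_set 0 W = setT \/ prefix_set 0 W = set0.
Proof.
have [W0|W0] := pselect (W [::]); [left|right]; by apply/seteqP; split.
Qed.

(** Zero-one law for values: a nearly optimal policy is modified by switching, when a prefix event
    close to the complement of [A] occurs, to a policy that still has chance [c]. If the value were
    below 1, this would exceed it. *)
Lemma value_zero_one (G : house) (A : set (traj X)) (c : R) :
  measurable A -> tail A -> 0 < c ->
  (forall s, exists p, in_house G p /\ c <= Pr p s A) ->
  forall s e, 0 < e -> exists p, in_house G p /\ 1 - e <= Pr p s A.
Proof.
move=> mA tA c0 valc.
(* If the prefix of length [N] lies in [W], the current chances are given up for a policy that wins
   [A] with probability at least [c] from the state reached. *)
have switch N W p s : in_house G p -> exists q, in_house G q /\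
    Pr p s (A `\` prefix_set N W) + c * Pr p s (prefix_set N W) <= Pr q s A.
  elim: N W p s => [|N IH] W p s Gp.
    have [->|->] := prefix0 W.
      have [q [Gq cq]] := valc s; exists q; split => //.
      by rewrite setDT Pr_set0 Pr_setT add0r mulr1.
    by exists p; split => //; rewrite setD0 Pr_set0 mulr0 addr0.
  have /choice[q qP] : forall t, exists q, in_house G q /\
      Pr (pshift p s) t (A `\` prefix_set N [set w | W (s :: w)]) +
      c * Pr (pshift p s) t (prefix_set N [set w | W (s :: w)]) <= Pr q t A.
    by move=> t; apply: IH; exact: in_house_pshift.
  exists (pcons s (p [::] s) q); split.
    by apply: in_house_pcons => // t; case: (qP t).
  have mAD : measurable (A `\` prefix_set N.+1 W) by exact: measurableD.
  have mAD' : measurable (A `\` prefix_set N [set w | W (s :: w)]).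
    exact: measurableD.
  rewrite Pr_pcons// tA Pr_onestep// [in X in c * X]Pr_onestep//.
  rewrite tcons_setD tA prefix_tcons.
  have b1 B : measurable B -> bounded_by 1 (fun t => Pr (pshift p s) t B).
    by move=> mB t; exact: Pr_bounded.
  have bc B : measurable B -> bounded_by c (fun t => c * Pr (pshift p s) t B).
    move=> mB t; rewrite normrM (gtr0_norm c0) ler_piMr ?(ltW c0)//.
    exact: Pr_bounded.
  rewrite -(avZ _ _ (b1 _ _))// -(avD _ (b1 _ _) (bc _ _))//.
  apply: (ler_av (bounded_byD (b1 _ _) (bc _ _)) (_ : bounded_by 1 _)) => //.
  - by move=> t; exact: Pr_bounded.
  - by move=> t _; case: (qP t).
move=> s e e0; apply: contrapT => H.
have low p : in_house G p -> Pr p s A < 1 - e.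
  by move=> Gp; rewrite ltNge; apply/negP => ?; apply: H; exists p.
pose V := [set Pr p s A | p in in_house G].
have supV : has_sup V.
  have [p [Gp _]] := valc s; split; first by exists (Pr p s A), p.
  by exists 1 => _ [q _ <-]; exact: Pr_le1.
have c1 : c <= 1.
  by have [p [_ cp]] := valc s; exact: le_trans cp (Pr_le1 _ _ mA).
have e1 : e < 1.
  have [p [Gp _]] := valc s; have := low p Gp; have := Pr_ge0 p s A; lra.
(* The losses are [d] from near-optimality, [d] on the part of [A] inside [C], and [c * d] since [C]
   has probability at least [e - d]. They stay below the gain [c * e], which is [4 * d]. *)
pose d := c * e / 4; have d0 : 0 < d by rewrite divr_gt0// mulr_gt0.
have [_ [p Gp <-] pV] := sup_adherent d0 supV.
have mAC : measurable (~` A) by exact: measurableC.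
have [N [W HW]] := prefix_approximation p s mAC d0.
have [q [Gq qP]] := switch N W p s Gp.
have qV : Pr q s A <= sup V by apply: ub_le_sup; [case: supV|exists q].
rewrite -/(prefix_set N W) in HW; set C := prefix_set N W in HW qP.
have mC : measurable C by exact: mprefix.
have mS : measurable (symdiff (~` A) C) by exact: symdiff_measurable.
have E1 : Pr p s A <= Pr p s (A `\` C) + d.
  rewrite (Pr_setD _ _ mA mC) addrC lerD2l (le_trans _ (ltW HW))//.
  by apply: sub_Pr => //; [exact: measurableI|move=> om [a b]; right; split].
have E2 : 1 - Pr p s A <= Pr p s C + d.
  rewrite -Pr_setC// (Pr_setD _ _ mAC mC) lerD//.
    by apply: sub_Pr => //; exact: measurableI.
  rewrite (le_trans _ (ltW HW))//.
  by apply: sub_Pr => //; [exact: measurableD|move=> om [a b]; left; split].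
have E3 : c * (e - d) <= c * Pr p s C.
  by rewrite ler_pM2l//; have := low p Gp; lra.
have E4 : c * d <= d by rewrite ler_piMl ?(ltW d0).
have E5 : c * e = 4 * d by rewrite /d; field.
move: pV qV qP E1 E3 E4 E5; rewrite mulrBr; lra.
Qed.

(** For a tail event [A] this is the conditional probability of [A] given the history [h] and the
    current state [t]. *)
Definition cond_Pr p A h t : R := Pr (pshifts p h) t A.

(** Half of Levy's 0-1 law. By a maximal inequality, the conditional probability ever drops below
    [c] with probability at most that of the complement of [A] divided by [1 - c]. Used after a
    prefix event close to [A], this bound becomes arbitrarily small. *)
Lemma levy_tail p s (A : set (traj X)) (c : R) : measurable A -> tail A ->
  c < 1 ->
  Pr p s (A `&` [set om : traj X | forall N, exists n, (N <= n)%N /\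
    cond_Pr p A (mkseq om n) (om n) < c]) = 0.
Proof.
move=> mA tA c1; have c10 : 0 < 1 - c by rewrite subr_gt0.
have mq p' n : measurable [set om : traj X | cond_Pr p' A (mkseq om n) (om n) < c].
  exact: (@history_measurable _ (fun h t => cond_Pr p' A h t < c)).
pose drop p' N := [set om : traj X | exists n, (N <= n)%N /\
    cond_Pr p' A (mkseq om n) (om n) < c].
have mdrop p' N : measurable (drop p' N).
  by apply: measurable_ex => n; exact: measurable_conj.
have condS p' h t : cond_Pr p' A h t =
    av (p' h t) (fun u => cond_Pr p' A (rcons h t) u).
  by rewrite /cond_Pr Pr_pshifts_onestep// tA.
have maximal p' s' : Pr p' s' (drop p' 0%N) <= Pr p' s' (~` A) / (1 - c).
  have [q0|q0] := ltP (cond_Pr p' A [::] s') c.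
    apply: le_trans (Pr_le1 _ _ (mdrop _ _)) _.
    rewrite ler_pdivlMr// mul1r Pr_setC// lerD2l lerN2.
    by move: q0; rewrite /cond_Pr pshifts_nil => /ltW.
  (* [f] is an affine image of the conditional probability, hence a martingale. It is at most 0
     where that probability is below [c], so its truncation [l] can be killed at the first drop. *)
  pose f h t := 1 - (1 - cond_Pr p' A h t) / (1 - c).
  pose l h t := if cond_Pr p' A h t < c then 0 else f h t.
  pose bad h t u := cond_Pr p' A (rcons h t) u < c.
  have fneg h t : cond_Pr p' A h t < c -> f h t <= 0.
    by move=> qc; rewrite /f subr_le0 ler_pdivlMr// mul1r lerD2l lerN2 ltW.
  have f01 h t : ~~ (cond_Pr p' A h t < c) -> 0 <= f h t <= 1.
    rewrite -leNgt => qc; rewrite /f subr_ge0 ler_pdivrMr// mul1r.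
    rewrite lerD2l lerN2 qc /= gerBl divr_ge0 ?(ltW c10)// subr_ge0.
    exact: Pr_le1.
  have bf h : bounded_by (1 + (1 - c)^-1) (f h).
    move=> t; rewrite (le_trans (ler_normB _ _))// normr1 lerD2l.
    rewrite ger0_norm ?divr_ge0 ?(ltW c10)// ?subr_ge0 ?Pr_le1//.
    by rewrite ler_piMl ?invr_ge0 ?(ltW c10)// gerBl Pr_ge0.
  have favg h t : f h t = av (p' h t) (fun u => f (rcons h t) u).
    have b1 : bounded_by 1 (fun _ : X => 1 : R) by move=> u; rewrite normr1.
    have bq : bounded_by 1 (fun u => cond_Pr p' A (rcons h t) u).
      by move=> u; exact: Pr_bounded.
    have bi : bounded_by (1 + 1) (fun u => 1 - cond_Pr p' A (rcons h t) u).
      by move=> u; rewrite (le_trans (ler_normB _ _))// normr1 lerD2l.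
    rewrite {1}/f condS; apply/esym; rewrite /f.
    under eq_fun do rewrite mulrC.
    rewrite (avB _ b1 (_ : bounded_by ((1 + 1) / (1 - c)) _)); last first.
      move=> u; rewrite normrM mulrC ler_pM ?normr_ge0//.
      by rewrite ger0_norm ?invr_ge0 ?(ltW c10).
    by rewrite av_cst (avZ _ _ bi) (avB _ b1 bq) av_cst mulrC.
  have lN : l [::] s' <= Pr p' s' (never bad).
    apply: never_lower_bound => h t.
      by rewrite /l; case: ifPn => [_|/f01//]; rewrite lexx ler01.
    rewrite {1}/l; case: ifPn => [_|qc].
      apply: av_ge0 => u; case: asboolP => // nb; rewrite /l.
      by case: ifPn => // /f01/andP[].
    rewrite favg; apply: (ler_av (bf _) (_ : bounded_by 1 _)).
      move=> u; case: asboolP => _; first by rewrite normr0.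
      rewrite /l; case: ifPn => [_|/f01/andP[? ?]]; first by rewrite normr0.
      by rewrite ger0_norm.
    move=> u _; case: asboolP => [/fneg//|nb].
    by rewrite /l; case: ifPn => // /nb.
  apply: le_trans (_ : Pr p' s' (~` never bad) <= _).
    apply: ler_Pr => //; first by apply: measurableC; exact: never_measurable.
    move=> om om0 [[|n] [_ qn]] nb.
      by move: qn; rewrite om0 ltNge q0.
    by apply: (nb n); move: qn; rewrite mkseqS.
  rewrite Pr_setC; last exact: never_measurable.
  move: lN; rewrite /l ltNge q0 /= /f Pr_setC// /cond_Pr pshifts_nil; lra.
(* The maximal inequality restarted at time [N], restricted to a prefix event of that length. *)
have key N W p' s' : Pr p' s' (prefix_set N W `&` drop p' N) <=
    Pr p' s' (prefix_set N W `\` A) / (1 - c).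
  elim: N W p' s' => [|N IH] W p' s'.
    have [->|->] := prefix0 W; first by rewrite setTI setTD; exact: maximal.
    by rewrite set0I set0D !Pr_set0 mul0r.
  have mI : measurable (prefix_set N.+1 W `&` drop p' N.+1).
    exact: measurableI.
  have mD : measurable (prefix_set N.+1 W `\` A) by exact: measurableD.
  rewrite Pr_onestep// [in leRHS]Pr_onestep// preimage_setI tcons_setD.
  rewrite prefix_tcons tA.
  have -> : tcons s' @^-1` drop p' N.+1 = drop (pshift p' s') N.
    apply/seteqP; split => om /= [n [Nn qn]].
      case: n Nn qn => // n Nn; rewrite mkseq_tcons /= => qn; exists n; split => //.
    by exists n.+1; split => //; rewrite mkseq_tcons.
  rewrite mulrC -(@avZ _ _ _ 1); last first.
    by move=> t; apply: Pr_bounded; exact: measurableD.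
  apply: (@ler_av _ _ _ 1 ((1 - c)^-1)).
  - by move=> t; apply: Pr_bounded; exact: measurableI.
  - move=> t; rewrite normrM ger0_norm ?invr_ge0 ?(ltW c10)//.
    rewrite ler_piMr ?invr_ge0 ?(ltW c10)//.
    by apply: Pr_bounded; exact: measurableD.
  - by move=> t _; rewrite mulrC; exact: IH.
set I : set (traj X) := [set om | _].
have mI : measurable I by apply: measurable_all => N; exact: mdrop.
have mAI : measurable (A `&` I) by exact: measurableI.
apply/eqP; rewrite eq_le Pr_ge0 andbT; apply/ler_addgt0Pl => e e0.
(* The part of [A] outside the prefix event costs [d] and the maximal inequality costs
   [d / (1 - c)]; together this is [e]. *)
rewrite addr0; pose d := e / (1 + (1 - c)^-1).
have k0 : 0 < 1 + (1 - c)^-1 by rewrite addr_gt0// invr_gt0.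
have d0 : 0 < d by rewrite divr_gt0.
have [N [W HW]] := prefix_approximation p s mA d0.
rewrite -/(prefix_set N W) in HW.
have mS : measurable (symdiff A (prefix_set N W)) by exact: symdiff_measurable.
have -> : e = d + d / (1 - c) by rewrite -[X in X + _]mulr1 -mulrDr /d divfK
  ?gt_eqF.
rewrite (Pr_setD _ _ mAI (mprefix N W)) addrC lerD//.
  rewrite (le_trans _ (ltW HW))//; apply: sub_Pr => //.
    exact: measurableD.
  by move=> om [[a _] b]; left.
apply: le_trans (_ : Pr p s (prefix_set N W `&` drop p N) <= _).
  apply: sub_Pr; [exact: measurableI|exact: measurableI|].
  by move=> om [[_ i] w]; split => //; exact: i.
rewrite (le_trans (key _ _ _ _))// ler_pM2r ?invr_gt0//.
rewrite (le_trans _ (ltW HW))//; apply: sub_Pr => //.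
  exact: measurableD.
by move=> om [a b]; right.
Qed.

End tail_events.

Lemma measurable_ex_count d (T : measurableType d) (I : countType)
    (P : I -> T -> Prop) :
  (forall i, measurable [set x | P i x]) ->
  measurable [set x | exists i, P i x].
Proof.
move=> mP; rewrite (_ : [set _ | _] = [set x | exists n : nat,
    oapp (fun i => P i x) False (pickle_inv n)]).
  apply: measurable_ex => n; case: pickle_inv => [i|] /=; first exact: mP.
  by rewrite (_ : [set _ | _] = set0).
apply/seteqP; split => x /=.
  by move=> [i Pi]; exists (pickle i); rewrite pickleK_inv.
by move=> [n]; case: pickle_inv => //= i; exists i.
Qed.

(** * Expectations and Levy's law for tail payoffs *)

Section expectations.
Context {R : realType} {X : pcountType}.
Implicit Types (p q : policy R X) (s : X) (F K : traj X -> R).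

Lemma expect_cst p s (c : R) : expect p s (fun=> c) = c.
Proof. by rewrite /expect Rintegral_cstT. Qed.

Lemma ler_expect p s M N F K : measurable_fun setT F -> measurable_fun setT K ->
  bounded_by M F -> bounded_by N K -> (forall om, F om <= K om) ->
  expect p s F <= expect p s K.
Proof.
move=> mF mK MF NK FK; apply: le_Rintegral => //.
- exact: bounded_by_integrable MF.
- exact: bounded_by_integrable NK.
Qed.

Lemma expectD p s M N F K : measurable_fun setT F -> measurable_fun setT K ->
  bounded_by M F -> bounded_by N K ->
  expect p s (fun om => F om + K om) = expect p s F + expect p s K.
Proof.
move=> mF mK MF NK; apply: RintegralD => //.
- exact: bounded_by_integrable MF.
- exact: bounded_by_integrable NK.
Qed.

Lemma expectZ p s M (c : R) F : measurable_fun setT F -> bounded_by M F ->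
  expect p s (fun om => c * F om) = c * expect p s F.
Proof. by move=> mF MF; apply: RintegralZl => //;
  exact: bounded_by_integrable MF. Qed.

Lemma expectN p s M F : measurable_fun setT F -> bounded_by M F ->
  expect p s (fun om => - F om) = - expect p s F.
Proof.
move=> mF MF; rewrite -[RHS]mulN1r -(expectZ _ _ _ mF MF).
by congr expect; apply/funext => om; rewrite mulN1r.
Qed.

Lemma expect_bounded p s M F : measurable_fun setT F -> bounded_by M F ->
  `|expect p s F| <= M.
Proof. by move=> mF MF; apply: Rintegral_bounded. Qed.

Lemma Pr_ex_null_count (T : countType) p s (P : T -> traj X -> Prop) :
  (forall t, measurable [set om | P t om]) ->
  (forall t, Pr p s [set om | P t om] = 0) ->
  Pr p s [set om | exists t, P t om] = 0.
Proof.
move=> mP P0.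
rewrite (_ : [set _ | _] = [set om | exists n : nat,
  oapp (fun t => P t om) False (pickle_inv n)]); last first.
  apply/seteqP; split => om /=.
    by move=> [t Pt]; exists (pickle t); rewrite pickleK_inv.
  by move=> [n]; case: pickle_inv => //= t; exists t.
apply: Pr_ex_null => n; case: pickle_inv => [t|] //=.
- by rewrite (_ : [set _ | _] = set0).
- by rewrite (_ : [set _ | _] = set0)// Pr_set0.
Qed.

Lemma Pr_not_null p s A : measurable A -> Pr p s (~` A) = 0 -> Pr p s A = 1.
Proof. by move=> mA; rewrite Pr_setC// => /eqP; rewrite subr_eq0 => /eqP. Qed.

Lemma Pr1_sub p s A B : measurable A -> measurable B -> A `<=` B ->
  Pr p s A = 1 -> Pr p s B = 1.
Proof.
move=> mA mB AB A1; apply/eqP; rewrite eq_le Pr_le1//=.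
by apply: le_trans (sub_Pr p s mA mB AB); rewrite A1.
Qed.

Definition tail_fun F := forall s, F \o tcons s = F.

Definition cond_expect p F h t := expect (pshifts p h) t F.

(** If the conditional expectation exceeds [b] infinitely often where [F] is below [a < b], then the
    conditional probability of the tail event [F < a] is below a fixed [c < 1] infinitely often,
    which [levy_tail] excludes almost surely. Countably many pairs of thresholds suffice. *)
Lemma limsup_cond_expect p s M F : measurable_fun setT F -> bounded_by M F ->
  tail_fun F ->
  exists A, [/\ measurable A, Pr p s A = 1 & forall om, A om ->
    forall k : nat, exists N, forall n, (N <= n)%N ->
      cond_expect p F (mkseq om n) (om n) <= F om + k.+1%:R^-1].
Proof.
move=> mF MF tF; have M0 : 0 <= M by apply: le_trans (MF point).
pose above b := [set om : traj X | forall N, exists n, (N <= n)%N /\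
  b < cond_expect p F (mkseq om n) (om n)].
have mabove b : measurable (above b).
  apply: measurable_all => N; apply: measurable_ex => n.
  apply: measurable_conj => _.
  exact: (@history_measurable _ (fun h t => b < cond_expect p F h t)).
have mlt (a : R) : measurable [set om | F om < a].
  rewrite (_ : [set _ | _] = F @^-1` `]-oo, a[).
    by rewrite -[X in measurable X]setTI; exact: mF.
  by apply/seteqP; split => om; rewrite /= in_itv.
have null (a b : R) : a < b -> Pr p s ([set om | F om < a] `&` above b) = 0.
  move=> ab; set A := [set om | F om < a].
  have mA : measurable A by exact: mlt.
  have tA : tail A.
    move=> t; apply/seteqP; split => om; rewrite /A /=;
    by rewrite -[F (tcons t om)]/((F \o tcons t) om) tF.
  (* [K] is positive and bounds [M - a]; a conditional probability of at least [c] then forces a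
     conditional expectation of at most [b]. *)
  pose K := M + `|a| + 1; have K0 : 0 < K by rewrite ltr_wpDl// addr_ge0.
  pose c := 1 - (b - a) / K.
  have c1 : c < 1 by rewrite /c ltrBlDr ltrDl divr_gt0// subr_gt0.
  have mAa : measurable_fun setT (\1_A : traj X -> R) by exact: measurable_indic.
  (* [F] is at most [a] on [A] and at most [M] elsewhere. *)
  have bound h t : cond_expect p F h t <= M + (a - M) * cond_Pr p A h t.
    rewrite /cond_expect /cond_Pr Pr_expect//.
    rewrite -(expectZ _ _ _ mAa (@indic_bounded _ _ A)) -[X in X +
      _](expect_cst (pshifts p h) t).
    have mc : measurable_fun setT (fun om : traj X => (a - M) * \1_A om).
      by apply: measurable_funM.
    have bc : bounded_by `|a - M| (fun om : traj X => (a - M) * \1_A om).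
      move=> om; rewrite normrM ler_piMr//; exact: indic_bounded.
    rewrite -(expectD _ _ (measurable_cst _) mc (_ : bounded_by M _) bc)//;
      last first.
      by move=> om; rewrite ger0_norm.
    apply: (ler_expect _ _ mF _ MF (bounded_byD (_ : bounded_by M _) bc)).
    - by apply: measurable_funD.
    - by move=> om; rewrite ger0_norm.
    - move=> om; rewrite indicE /=.
      have := MF om; rewrite ler_norml => /andP[_ FM].
      have [Aom|nAom] := pselect (A om).
        by rewrite mem_set// mulr1 addrC subrK ltW.
      by rewrite memNset// mulr0 addr0.
  apply/eqP; rewrite eq_le Pr_ge0 andbT -(levy_tail p s mA tA c1).
  apply: sub_Pr.
  - exact: measurableI.
  - apply: measurableI => //; apply: measurable_all => N; apply: measurable_ex => n.
    apply: measurable_conj => _.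
    exact: (@history_measurable _ (fun h t => cond_Pr p A h t < c)).
  - move=> om [Aom ab_om]; split => // N; have [n [Nn bx]] := ab_om N.
    exists n; split => //; rewrite ltNge; apply/negP => cq.
    move: bx; rewrite ltNge => /negP; apply.
    apply: le_trans (bound _ _) _; set q := cond_Pr _ _ _ _ in cq *.
    have q1 : q <= 1 by exact: Pr_le1.
    have : (M - a) * (1 - q) <= b - a.
      apply: le_trans (_ : K * (1 - q) <= _).
        rewrite ler_wpM2r ?subr_ge0// /K -addrA lerD2l.
        by rewrite (le_trans (ler_norm _))// normrN lerDl.
      rewrite -ler_pdivlMl// mulrC; move: cq; rewrite /c; lra.
    by rewrite mulrBr mulr1; lra.
(* The margin of level [k] is halved: one half leaves room for a rational above [F], the other
   separates the two thresholds. *)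
pose viol (u : nat * rat) := [set om | F om < ratr u.2] `&`
  above (ratr u.2 + (2 * u.1.+1%:R)^-1).
have mI u : measurable (viol u) by apply: measurableI; [exact: mlt|exact: mabove].
pose G := [set om : traj X | exists u : nat * rat, viol u om].
have mG : measurable G by exact: measurable_ex_count.
have G0 : Pr p s (~` ~` G) = 0.
  rewrite setCK; apply: Pr_ex_null_count => // u; apply: null.
  by rewrite ltrDl invr_gt0 mulr_gt0.
have := Pr_not_null (measurableC mG) G0 => G1.
exists (~` G); split=> //; first exact: measurableC.
move=> om nG k /=; apply: contrapT => /forallNP H; apply: nG.
have k0 : 0 < (2 * k.+1%:R)^-1 :> R by rewrite invr_gt0 mulr_gt0.
have [r] := @rat_in_itvoo R (F om) (F om + (2 * k.+1%:R)^-1) (ltac:(by rewrite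
  ltrDl)).
rewrite in_itv /= => /andP[r1 r2]; exists (k, r); split => //= N.
have /existsNP[n /not_implyP[Nn /negP]] := H N; rewrite -ltNge => Hn.
exists n; split => //; apply: le_lt_trans Hn.
have -> : k.+1%:R^-1 = (2 * k.+1%:R)^-1 + (2 * k.+1%:R)^-1 :> R.
  by rewrite invfM (mulrC 2^-1) -splitr.
by rewrite addrA lerD2r ltW.
Qed.

Lemma liminf_cond_expect p s M F : measurable_fun setT F -> bounded_by M F ->
  tail_fun F ->
  exists A, [/\ measurable A, Pr p s A = 1 & forall om, A om ->
    forall k : nat, exists N, forall n, (N <= n)%N ->
      F om - k.+1%:R^-1 <= cond_expect p F (mkseq om n) (om n)].
Proof.
move=> mF MF tF.
have mN : measurable_fun setT (fun om => - F om) by exact: measurableT_comp.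
have MN : bounded_by M (fun om => - F om) by move=> om; rewrite normrN.
have tN : tail_fun (fun om => - F om).
  by move=> t; apply/funext => om; rewrite -[in RHS](tF t).
have [A [mA A1 AP]] := limsup_cond_expect p s mN MN tN.
exists A; split=> // om Aom k; have [N HN] := AP om Aom k; exists N => n /HN.
by rewrite /cond_expect (expectN _ _ mF MF) lerNl opprD opprK.
Qed.

End expectations.

(** * Transient houses *)

Section transience.
Context {R : realType} {X : pcountType}.
Implicit Types (p q : policy R X) (s y : X) (G : @house R X).

Definition finite_visits : set (traj X) :=
  [set om | forall y, exists N, forall n, (N <= n)%N -> om n <> y].

Lemma finite_visits_measurable : measurable finite_visits.
Proof.
rewrite (_ : finite_visits = ~` [set om : traj X | exists y, ~ exists N,
    forall n, (N <= n)%N -> om n <> y]); last first.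
  apply/seteqP; split => om /= H; first by move=> [y]; apply.
  by move=> y; apply: contrapT => H'; apply: H; exists y.
apply: measurableC; apply: measurable_ex_count => y.
rewrite (_ : [set _ | _] = ~` [set om : traj X | exists N : nat,
    forall n, (N <= n)%N -> om n <> y])//.
apply: measurableC; apply: measurable_ex => N; apply: measurable_all => n.
apply: measurable_impl => _.
exact: (@coord_measurable _ [set z | z <> y]).
Qed.

Definition transient_house G :=
  forall p s, in_house G p -> Pr p s finite_visits = 1.

Definition hits y : set (traj X) := [set om | exists n, om n = y].
Definition returns y : set (traj X) := [set om | exists n, om n.+1 = y].

Lemma hits_measurable y : measurable (hits y).
Proof.
by apply: measurable_ex => n; exact: (@coord_measurable _ [set z | z = y]).
Qed.

Lemma returns_measurable y : measurable (returns y).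
Proof.
by apply: measurable_ex => n; exact: (@coord_measurable _ [set z | z = y]).
Qed.

(* Follow [p] until [y] is visited; at the [i]-th visit, continue with [r i]. *)
Fixpoint renew (r : nat -> policy R X) y p i (h : seq X) s : gamble R X :=
  if h is x :: h' then
    if x == y then renew r y (pshift (r i) x) i.+1 h' s
    else renew r y (pshift p x) i h' s
  else if s == y then r i [::] s else p [::] s.

Lemma in_house_renew G (r : nat -> policy R X) y p i : (forall i, in_house G (r
  i)) ->
  in_house G p -> in_house G (renew r y p i).
Proof.
move=> Gr Gp h; elim: h p i Gp => [|x h IH] p i Gp s /=.
  by case: ifP => _; [exact: Gr|exact: Gp].
by case: ifP => _; apply: IH; exact: in_house_pshift.
Qed.

(** Otherwise there are policies [r i] that return to [y] with probability at least [1 - 2^-(i+2)].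
    Playing them one after the other at the successive visits of [y] gives infinitely many visits
    with probability at least 1/2, against transience. *)
Lemma return_bound G y : transient_house G ->
  exists rho, rho < 1 /\ forall p, in_house G p -> Pr p y (returns y) <= rho.
Proof.
move=> trG; apply: contrapT => H.
have /choice[r rP] : forall i, exists p, in_house G p /\
    1 - (2 ^+ i.+2)^-1 <= Pr p y (returns y).
  move=> i; apply: contrapT => Hi; apply: H; exists (1 - (2 ^+ i.+2)^-1).
  split=> [|p Gp]; first by rewrite ltrBlDr ltrDl invr_gt0 exprn_gt0.
  by rewrite leNgt; apply/negP => /ltW ?; apply: Hi; exists p.
(* [c i] is the sum of the errors [2^-(j+2)] over all [j >= i], so [c 0] is 1/2. *)
pose c i : R := (2 ^+ i.+1)^-1.
have cS i : c i = (2 ^+ i.+2)^-1 + c i.+1.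
  by rewrite /c (exprS 2 i.+1) invfM (mulrC 2^-1) -splitr.
have c0 i : 0 <= c i by rewrite invr_ge0 exprn_ge0.
have c1 i : c i <= 1 by rewrite invf_le1 ?exprn_gt0// exprn_ege1// ler1n.
pose V m := [set om : traj X | exists n, (m <= count_mem y (mkseq om n))%N].
have mV m : measurable (V m).
  apply: measurable_ex => n.
  exact: (@prefix_measurable _ (fun w => is_true (m <= count_mem y w)%N)).
have VS m s : tcons s @^-1` V m.+1 = if s == y then V m else V m.+1.
  apply/seteqP; split => om /=.
    move=> [[|n]]; first by [].
    by rewrite mkseq_tcons /=; case: (s == y) => /= mn; exists n.
  by case: ifP => sy [n mn]; exists n.+1; rewrite mkseq_tcons /= sy.
have mtV m s : measurable (tcons s @^-1` V m) by exact: tcons_preimage_measurable.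
have tret s : tcons s @^-1` returns y = hits y by apply/seteqP; split.
(* Induction on the number [m] of visits: up to the remaining error, reaching [y] once already
   yields [m] visits. *)
have low m : forall p i s, Pr p s (hits y) - c i <= Pr (renew r y p i) s (V m).
  elim: m => [|m IHm].
    move=> p i s; rewrite (_ : V 0%N = setT); last first.
      by apply/seteqP; split => om // _; exists 0%N.
    by rewrite Pr_setT; have := Pr_le1 p s (hits_measurable y); have := c0 i; lra.
  have at_y p i : 1 - c i <= Pr (renew r y p i) y (V m.+1).
    rewrite Pr_onestep// VS eqxx /= eqxx.
    have -> : pshift (renew r y p i) y = renew r y (pshift (r i) y) i.+1.
      by apply/funext => h; apply/funext => t; rewrite /pshift /= eqxx.
    have [_ ri] := rP i.
    apply: le_trans (_ : Pr (r i) y (returns y) - c i.+1 <= _).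
      by rewrite cS; move: ri; lra.
    rewrite Pr_onestep ?tret; last exact: returns_measurable.
    have bh : bounded_by 1 (fun t => Pr (pshift (r i) y) t (hits y)).
      by move=> t; apply: Pr_bounded; exact: hits_measurable.
    have bc : bounded_by 1 (fun _ : X => c i.+1) by move=> t; rewrite ger0_norm.
    rewrite -(av_cst (r i [::] y) (c i.+1)) -(avB _ bh bc).
    apply: (@ler_av _ _ _ (1 + 1) 1).
    - by move=> t; rewrite (le_trans (ler_normB _ _))// lerD ?bh ?bc.
    - by move=> t; exact: Pr_bounded.
    - by move=> t _; exact: IHm.
  (* Hitting [y] is exhausted by hitting it within [n] steps; an inner induction on [n] follows [p]
     up to the first visit. *)
  pose Hn n := [set om : traj X | exists i, (i < n)%N /\ om i = y].
  have mHn n : measurable (Hn n).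
    apply: measurable_ex => i; apply: measurable_conj => _.
    exact: (@coord_measurable _ [set z | z = y]).
  have lown n : forall p i s,
      Pr p s (Hn n) - c i <= Pr (renew r y p i) s (V m.+1).
    elim: n => [|n IHn] p i s; have [->|sy] := eqVneq s y.
    - by apply: le_trans (at_y p i); rewrite lerD2r Pr_le1.
    - rewrite (_ : Hn 0%N = set0) ?Pr_set0; last first.
        by apply/seteqP; split => om //= [? []].
      by have := Pr_ge0 (renew r y p i) s (V m.+1); have := c0 i; lra.
    - by apply: le_trans (at_y p i); rewrite lerD2r Pr_le1.
    rewrite Pr_onestep// [in leRHS]Pr_onestep// VS (negbTE sy) /= (negbTE sy).
    have -> : pshift (renew r y p i) s = renew r y (pshift p s) i.
      by apply/funext => h; apply/funext => t; rewrite /pshift /= (negbTE sy).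
    have -> : tcons s @^-1` Hn n.+1 = Hn n.
      apply/seteqP; split => om /= [j].
        by case: j => [[_ /= /eqP]|j [jn oj]]; [rewrite (negbTE sy)|exists j].
      by move=> [jn oj]; exists j.+1.
    have bh : bounded_by 1 (fun t => Pr (pshift p s) t (Hn n)).
      by move=> t; exact: Pr_bounded.
    have bc : bounded_by 1 (fun _ : X => c i) by move=> t; rewrite ger0_norm.
    rewrite -(av_cst (p [::] s) (c i)) -(avB _ bh bc).
    apply: (@ler_av _ _ _ (1 + 1) 1).
    - by move=> t; rewrite (le_trans (ler_normB _ _))// lerD ?bh ?bc.
    - by move=> t; exact: Pr_bounded.
    - by move=> t _; exact: IHn.
  move=> p i s; rewrite lerBlDr (_ : hits y = \bigcup_n Hn n); last first.
    apply/seteqP; split => om /=; first by move=> [n ny]; exists n.+1 => //;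
      exists n.
    by move=> [n _ [j [_ oj]]]; exists j.
  apply: Pr_bigcup_le => // [n om [j [/ltnW jn oj]]|n]; first by exists j.
  by rewrite -lerBlDr; exact: lown.
pose q := renew r y (r 0%N) 0.
have Gq : in_house G q.
  by apply: in_house_renew => [i|]; [case: (rP i)|case: (rP 0%N)].
have Vq : 2^-1 <= Pr q y (\bigcap_m V m).
  apply: Pr_bigcap_ge => // [m om [n mn]|m]; first by exists n; exact: ltnW.
  apply: le_trans (low m (r 0%N) 0%N y); rewrite (_ : Pr _ _ (hits y) = 1).
    by rewrite /c expr1 {2}(splitr 1) div1r addrK.
  apply/eqP; rewrite eq_le Pr_le1/=; last exact: hits_measurable.
  rewrite -(Pr_start (r 0%N) y); apply: sub_Pr.
  - exact: (@coord_measurable _ [set z | z = y]).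
  - exact: hits_measurable.
  - by move=> om; exists 0%N.
have mcapV : measurable (\bigcap_m V m) by exact: bigcapT_measurable.
have := Pr1_setI finite_visits_measurable mcapV (trG q y Gq).
rewrite (_ : _ `&` _ = set0) ?Pr_set0.
  by move=> V0; move: Vq; rewrite -V0 leNgt invr_gt0 ltr0n.
apply/seteqP; split => // om [Vom /(_ y)[N HN]].
have cN n : (count_mem y (mkseq om n) <= N)%N.
  have [nN|Nn] := leqP n N.
    by apply: leq_trans nN; rewrite -{2}(size_mkseq om n) count_size.
  have {Nn} := ltnW Nn; elim: n => [//|n IH]; rewrite leq_eqVlt => /orP[/eqP ->|].
    by rewrite -{2}(size_mkseq om n.+1) count_size.
  rewrite ltnS => Nn; rewrite mkseqS -cats1 count_cat /= addn0.
  by have /eqP/negbTE -> := HN _ Nn; rewrite addn0 IH.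
by have [n] := Vom N.+1 I; rewrite ltnNge cN.
Qed.

(** * A bounded potential for a transient house *)

Section potential.
Variable G : @house R X.
Hypothesis G_inhab : exists p, in_house G p.
Hypothesis trG : transient_house G.

Let reach y s := sup [set Pr p s (hits y) | p in in_house G].

Let reach_sup y s : has_sup [set Pr p s (hits y) | p in in_house G].
Proof.
have [p Gp] := G_inhab; split; first by exists (Pr p s (hits y)), p.
by exists 1 => _ [q _ <-]; apply: Pr_le1; exact: hits_measurable.
Qed.

Let reach_ge p y s : in_house G p -> Pr p s (hits y) <= reach y s.
Proof. by move=> Gp; apply: ub_le_sup; [case: (reach_sup y s)|exists p]. Qed.

Let reach01 y s : 0 <= reach y s <= 1.
Proof.
have [p Gp] := G_inhab; apply/andP; split.
  exact: le_trans (Pr_ge0 _ _ _) (reach_ge y s Gp).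
apply: ge_sup; first by case: (reach_sup y s).
by move=> _ [q _ <-]; apply: Pr_le1; exact: hits_measurable.
Qed.

Let reach1 y : reach y y = 1.
Proof.
have [p Gp] := G_inhab; apply/eqP; rewrite eq_le;
  case/andP: (reach01 y y) => _ -> /=.
apply: le_trans (reach_ge y y Gp); rewrite -(Pr_start p y); apply: sub_Pr.
- exact: (@coord_measurable _ [set z | z = y]).
- exact: hits_measurable.
- by move=> om; exists 0%N.
Qed.

Let reach_bounded y : bounded_by 1 (reach y).
Proof. by move=> s; case/andP: (reach01 y s) => ? ?; rewrite ger0_norm. Qed.

(** Playing [g] and then policies that reach [y] with nearly maximal probability is itself a policy
    of the house, so its return probability bounds the mean of [reach y]. *)
Let reach_av y s g (c : R) : G s g ->
  (forall p, in_house G p -> Pr p s (returns y) <= c) -> av g (reach y) <= c.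
Proof.
move=> Gg cP; apply/ler_addgt0Pr => e e0.
have /choice[q qP] : forall t, exists p, in_house G p /\
    reach y t - e <= Pr p t (hits y).
  move=> t; have [_ [p Gp <-] /ltW pe] := sup_adherent e0 (reach_sup y t).
  by exists p.
rewrite -lerBlDr; apply: le_trans (cP (pcons s g q) _); last first.
  by apply: in_house_pcons => // t; case: (qP t).
rewrite Pr_pcons; last exact: returns_measurable.
have be : bounded_by e (fun _ : X => e) by move=> t; rewrite gtr0_norm.
rewrite -[X in _ - X](av_cst g e) -(avB _ (reach_bounded y) be).
apply: (@ler_av _ _ _ (1 + e) 1).
- by move=> t; rewrite (le_trans (ler_normB _ _))// lerD ?reach_bounded ?be.
- by move=> t; apply: Pr_bounded; apply: tcons_preimage_measurable;
  exact: returns_measurable.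
- by move=> t _; case: (qP t).
Qed.

(* The probability of ever reaching [y] decreases in mean by at least
   [1 - rho y] at [y]; the potential is a weighted sum of these over all [y]. *)
Lemma transient_potential : exists Psi delta : X -> R,
  [/\ forall s, 0 <= Psi s <= 1, forall s, 0 < delta s &
      forall s g, G s g -> av g Psi <= Psi s - delta s].
Proof.
have /choice[rho rhoP] : forall y, exists rho, rho < 1 /\
    forall p, in_house G p -> Pr p y (returns y) <= rho.
  by move=> y; exact: return_bound.
(* Weights of total mass 1, which bound the potential by 1. *)
pose wt n : R := 1 / (2 ^ n.+1)%:R.
have wt0 n : 0 < wt n by rewrite divr_gt0// ltr0n expn_gt0.
pose a s n := wt n * reach (nthX n) s.
have a0 s n : 0 <= a s n by rewrite mulr_ge0 ?(ltW (wt0 n))//;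
  case/andP: (reach01 (nthX n) s).
have asum s : (\sum_(n <oo) (a s n)%:E <= 1)%E.
  apply: le_trans (epsilon_trick0 xpredT (@ler01 R)).
  apply: lee_nneseries => [n _ _|n _]; first by rewrite lee_fin.
  rewrite lee_fin /a -/(wt n) ler_piMr ?(ltW (wt0 n))//.
  by case/andP: (reach01 (nthX n) s).
have asum0 s : (0 <= \sum_(n <oo) (a s n)%:E)%E.
  by apply: nneseries_ge0 => n _ _; rewrite lee_fin.
pose Psi s := fine (\sum_(n <oo) (a s n)%:E)%E.
have PsiE s : (Psi s)%:E = (\sum_(n <oo) (a s n)%:E)%E.
  by rewrite /Psi fineK// ge0_fin_numE// (le_lt_trans (asum s))// ltry.
have Psi01 s : 0 <= Psi s <= 1 by rewrite -!lee_fin PsiE asum asum0.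
exists Psi, (fun s => wt (pickle s) * (1 - rho s)); split => //.
  by move=> s; rewrite mulr_gt0// subr_gt0; case: (rhoP s).
move=> s g Gg; set d := wt _ * _.
have d0 : 0 <= d by rewrite mulr_ge0 ?(ltW (wt0 _))// subr_ge0 ltW//;
  case: (rhoP s).
have bPsi : bounded_by 1 Psi.
  by move=> t; case/andP: (Psi01 t) => ? ?; rewrite ger0_norm.
rewrite lerBrDr -lee_fin EFinD PsiE (av_series _ _ bPsi); last first.
  by move=> t; case/andP: (Psi01 t).
(* Tonelli: the sum over the outcomes of [g] is exchanged with the sum over the states to be hit. *)
have E : (\sum_(n <oo) (weight g n * Psi (nthX n))%:E =
    \sum_(n <oo) (wt n * av g (reach (nthX n)))%:E)%E.
  transitivity (\sum_(n <oo) \sum_(j <oo) (weight g n * a (nthX n) j)%:E)%E.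
    apply: eq_eseriesr => n _; rewrite EFinM PsiE -nneseriesZl// => j _.
    by rewrite lee_fin.
  rewrite nneseries_interchange; last first.
    by move=> i j; rewrite lee_fin mulr_ge0// weight_ge0.
  apply: eq_eseriesr => j _; rewrite EFinM (av_series _ _ (reach_bounded _));
    last first.
    by move=> t; case/andP: (reach01 (nthX j) t).
  rewrite -nneseriesZl; last first.
    move=> n _; rewrite lee_fin mulr_ge0 ?weight_ge0//.
    by case/andP: (reach01 (nthX j) (nthX n)).
  by apply: eq_eseriesr => n _; rewrite -EFinM /a mulrCA.
rewrite E; have avr n : 0 <= wt n * av g (reach (nthX n)).
  rewrite mulr_ge0 ?(ltW (wt0 n))// av_ge0// => t.
  by case/andP: (reach01 (nthX n) t).
pose b n : \bar R := (if n == pickle s then d else 0)%:E.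
have b0 n : (0 <= b n)%E by rewrite /b; case: ifP => _; rewrite lee_fin.
have db : (d%:E <= \sum_(n <oo) b n)%E.
  apply: le_trans (nneseries_lim_ge (pickle s).+1 _) => //.
  rewrite big_nat_recr//= /b eqxx leeDr// sume_ge0// => n _.
  by case: ifP => _; rewrite lee_fin.
apply: le_trans (leeD (lexx _) db) _; rewrite -nneseriesD//; last first.
  by move=> n _ _; rewrite lee_fin.
apply: lee_nneseries => [n _ _|n _].
  by rewrite adde_ge0// lee_fin.
rewrite /b; case: eqP => [->|_]; rewrite -EFinD lee_fin /a.
  rewrite nthX_pickle reach1 /d -mulrDr ler_pM2l// -lerBrDr opprB addrC subrK.
  by apply: (reach_av Gg); case: (rhoP s).
rewrite addr0 ler_pM2l//; apply: (reach_av Gg) => p Gp.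
apply: le_trans (reach_ge _ _ Gp); apply: sub_Pr.
- exact: returns_measurable.
- exact: hits_measurable.
- by move=> om [k <-]; exists k.+1.
Qed.

End potential.

End transience.

(** * Stationary policies for eventual avoidance *)

Section eventual_avoidance.
Context {R : realType} {X : pcountType}.
Implicit Types (p q : policy R X) (s : X) (G : @house R X) (om : traj X).

Lemma never_onestep p s (bad : seq X -> X -> X -> Prop) :
  Pr p s (never bad) = av (p [::] s) (fun t =>
    if `[< bad [::] s t >] then 0
    else Pr (pshift p s) t (never (fun h => bad (s :: h)))).
Proof.
rewrite Pr_onestep; last exact: never_measurable.
have mN := tcons_preimage_measurable s (never_measurable bad).
congr (av _); apply/funext => t; case: asboolP => st.
  rewrite -(Pr_set0 (pshift p s) t); apply: eq_Pr => // om om0.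
  by split=> // /(_ 0%N); rewrite /= om0.
apply: eq_Pr => //; first exact: never_measurable.
move=> om om0; split=> H n; first by have := H n.+1; rewrite mkseq_tcons.
by case: n => [|n]; [rewrite /= om0|rewrite mkseq_tcons; exact: H].
Qed.

Variable Bad : nat -> X -> X -> Prop.

Definition eventually_good : set (traj X) :=
  [set om | forall k, exists N, forall n, (N <= n)%N -> ~ Bad k (om n) (om n.+1)].

Lemma eventually_good_measurable : measurable eventually_good.
Proof.
apply: measurable_all => k; apply: measurable_ex => N; apply: measurable_all => n.
apply: measurable_impl => _.
exact: (@coord2_measurable _ [set u | ~ Bad k u.1 u.2]).
Qed.

Lemma eventually_good_tail : tail eventually_good.
Proof.
move=> s; apply/seteqP; split => om /= H k; have [N HN] := H k.
  by exists N => n Nn; have := HN n.+1 (leqW Nn).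
by exists N.+1 => -[//|n] Nn; exact: HN.
Qed.

(* The condition [j k <= pickle s] excludes only finitely many states. *)
Definition far_bad (j : nat -> nat) s t := exists k, Bad k s t /\ (j k <=
  pickle s)%N.

Definition avoids j : set (traj X) := never (fun _ => far_bad j).

Lemma avoids_measurable j : measurable (avoids j).
Proof. exact: never_measurable. Qed.

(** On [eventually_good] the level [k] has finitely many bad transitions, so those from states of
    code at least [j] disappear as [j] grows. Choosing [j k] with error [e / 2^(k+1)] makes the
    total error at most [e]. *)
Lemma far_bad_cofinal p s (e : R) : 0 < e ->
  exists j, Pr p s eventually_good - e <= Pr p s (avoids j).
Proof.
move=> e0; have mg := eventually_good_measurable.
pose E k j := eventually_good `&` [set om | exists n,
  Bad k (om n) (om n.+1) /\ (j <= pickle (om n))%N].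
have mE k j : measurable (E k j).
  apply: measurableI => //; apply: measurable_ex => n.
  exact: (@coord2_measurable _ [set u | Bad k u.1 u.2 /\ is_true (j <= pickle
    u.1)%N]).
have /choice[j jP] : forall k, exists j, Pr p s (E k j) < e / (2 ^ k.+1)%:R.
  move=> k; apply: contrapT => /forallNP H.
  have e'0 : 0 < e / (2 ^ k.+1)%:R by rewrite divr_gt0// ltr0n expn_gt0.
  have : e / (2 ^ k.+1)%:R <= Pr p s (\bigcap_j E k j).
    apply: Pr_bigcap_ge => // [j om [gom [n [b /ltnW ?]]]|j].
      by split=> //; exists n.
    by rewrite leNgt; apply/negP; exact: H.
  rewrite (_ : \bigcap_j _ = set0) ?Pr_set0; first by rewrite leNgt e'0.
  apply/seteqP; split => // om Eom; have [/(_ k)[N HN] _] := Eom 0%N I.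
  (* The bound exceeds the codes of all states before time [N], and from [N] on there is no bad
     transition of level [k]. *)
  have [_ [n [bn]]] := Eom (\max_(i < N) (pickle (om i)).+1)%N I.
  have nN : (n < N)%N by rewrite ltnNge; apply/negP => /HN.
  rewrite leqNgt => /negP; apply.
  exact: (@leq_bigmax _ (fun i : 'I_N => (pickle (om i)).+1) (Ordinal nN)).
exists j; have ma := avoids_measurable j.
rewrite lerBlDr (Pr_setD _ _ mg ma) lerD//.
  by apply: sub_Pr => //; exact: measurableI.
have mD : measurable (eventually_good `\` avoids j) by exact: measurableD.
rewrite -lee_fin EFin_Pr//.
apply: le_trans (_ : (\sum_(k <oo) law p s (E k (j k)) <= _)%E).
  apply: measure_sigma_subadditive => // om [gom] /existsNP[n /contrapT[k [b jk]]].
  by exists k => //; split=> //; exists n.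
apply: le_trans (epsilon_trick0 xpredT (ltW e0)).
apply: lee_nneseries => [k _ _|k _]; first exact: measure_ge0.
by rewrite -EFin_Pr// lee_fin ltW.
Qed.

(** A trajectory with finite visits leaves the finitely many states of code below [j k] for good;
    from then on every bad transition of level [k] is a far one. *)
Lemma avoids_eventually_good j om : finite_visits om ->
  (exists N, forall n, (N <= n)%N -> ~ far_bad j (om n) (om n.+1)) ->
  eventually_good om.
Proof.
move=> fom [N HN] k.
have [N' HN'] : exists N', forall n, (N' <= n)%N -> (j k <= pickle (om n))%N.
  elim: (j k) => [|J [N1 HN1]]; first by exists 0%N.
  have [N2 HN2] : exists N2, forall n, (N2 <= n)%N -> pickle (om n) <> J.
    case E : (pickle_inv J : option X) => [y|].
      have [N2 HN2] := fom y; exists N2 => n /HN2 ny nJ; apply: ny.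
      by move: E; rewrite -nJ pickleK_inv => -[].
    by exists 0%N => n _ nJ; move: E; rewrite -nJ pickleK_inv.
  exists (maxn N1 N2) => n; rewrite geq_max => /andP[/HN1 H1 /HN2 H2].
  by rewrite ltn_neqAle H1 andbT eq_sym; apply/eqP.
exists (maxn N N') => n; rewrite geq_max => /andP[Nn /HN' jn] b.
by apply: (HN n Nn); exists k.
Qed.

Lemma Pr_avoids_le G p s j : transient_house G -> in_house G p ->
  Pr p s (avoids j) <= Pr p s eventually_good.
Proof.
move=> trG Gp.
have mf := @finite_visits_measurable X; have ma := avoids_measurable j.
rewrite -(Pr1_setI mf ma (trG p s Gp)); apply: sub_Pr.
- exact: measurableI.
- exact: eventually_good_measurable.
- move=> om [aom fom]; apply: (avoids_eventually_good fom).
  by exists 0%N => n _; exact: aom.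
Qed.

Definition stationary (tau : X -> gamble R X) : policy R X := fun _ s => tau s.

Variable D : @house R X.

(** [D] holds the gambles that count as pure. The first alternative is meant for random states,
    whose gamble is imposed, the second for controlled states, where any outcome may be chosen
    outright. *)
Definition purifiable G := forall s g, G s g ->
  D s g \/ forall t, 0 < g t -> G s (dirac_gamble t) /\ D s (dirac_gamble t).

Lemma purifiable_choice G s g M (f : X -> R) : purifiable G -> G s g ->
  bounded_by M f -> exists g', [/\ G s g', D s g' & av g f <= av g' f].
Proof.
move=> dG Gg Mf; have [Dg|dir] := dG s g Gg; first by exists g.
have [t [gt ft]] := av_attained g Mf; have [Gt Dt] := dir t gt.
by exists (dirac_gamble t); split => //; rewrite (av_dirac t Mf).
Qed.

Definition full_value G := forall s e, 0 < e ->
  exists p, in_house G p /\ 1 - e <= Pr p s eventually_good.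

(** * Stationary policies that avoid nearly optimally *)

Section near_optimal.
Variables (G : @house R X) (j : nat -> nat).
Hypotheses (trG : transient_house G) (dG : purifiable G).
Hypothesis G_inhab : exists p, in_house G p.

(** Each state [s] takes a pure gamble that loses at most [e * delta s] of the optimal avoidance
    value [u]. The mean decrease of [e * Psi] pays for these losses, so [u - e * Psi] does not
    decrease in mean and the total loss is at most [e], uniformly in the start state. *)
Lemma near_optimal_avoidance (e : R) : 0 < e -> exists tau : X -> gamble R X,
  (forall s, G s (tau s) /\ D s (tau s)) /\
  forall p s, in_house G p ->
    Pr p s (avoids j) - e <= Pr (stationary tau) s (avoids j).
Proof.
move=> e0; have [Psi [delta [Psi01 delta0 PsiG]]] := transient_potential
  G_inhab trG.
have ma := avoids_measurable j.
pose V s := [set Pr p s (avoids j) | p in in_house G].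
have supV s : has_sup (V s).
  have [p Gp] := G_inhab; split; first by exists (Pr p s (avoids j)), p.
  by exists 1 => _ [q _ <-]; exact: Pr_le1.
pose u s := sup (V s).
have u_ge p s : in_house G p -> Pr p s (avoids j) <= u s.
  by move=> Gp; apply: ub_le_sup; [case: (supV s)|exists p].
have u01 s : 0 <= u s <= 1.
  have [p Gp] := G_inhab; apply/andP; split.
    exact: le_trans (Pr_ge0 _ _ _) (u_ge _ s Gp).
  apply: ge_sup; first by case: (supV s).
  by move=> _ [q _ <-]; exact: Pr_le1.
pose f s t := if `[< far_bad j s t >] then 0 else u t.
have bf s : bounded_by 1 (f s).
  move=> t; rewrite /f; case: ifP => _; first by rewrite normr0.
  by case/andP: (u01 t) => ? ?; rewrite ger0_norm.
have /choice[tau tauP] : forall s, exists g,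
    [/\ G s g, D s g & u s - e * delta s <= av g (f s)].
  move=> s; have ed0 : 0 < e * delta s by rewrite mulr_gt0.
  have [_ [p Gp <-] pu] := sup_adherent ed0 (supV s).
  have [g [Gg Dg fg]] := purifiable_choice dG (Gp [::] s) (bf s).
  exists g; split=> //; apply: le_trans fg; apply: le_trans (ltW pu) _.
  rewrite never_onestep; apply: (ler_av (_ : bounded_by 1 _) (bf s)) => t.
    by case: ifP => _; rewrite ?normr0//; apply: Pr_bounded;
      exact: avoids_measurable.
  move=> _; rewrite /f; case: ifP => // _; apply: u_ge.
  exact: in_house_pshift.
exists tau; split=> [s|p s Gp]; first by case: (tauP s).
(* Truncation at 0 keeps the bounds required by [never_lower_bound] and preserves the submartingale
   property. *)
pose l t := Num.max 0 (u t - e * Psi t).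
have l01 t : 0 <= l t <= 1.
  rewrite /l le_max lexx /= ge_max ler01 /= lerBlDr.
  case/andP: (u01 t) => _ u1; case/andP: (Psi01 t) => P0 _.
  by rewrite (le_trans u1)// lerDl mulr_ge0// ltW.
have : l s <= Pr (stationary tau) s (avoids j).
  apply: (@never_lower_bound _ _ _ s (fun _ => far_bad j) (fun _ => l)) => // h t.
  rewrite /stationary {1}/l ge_max; apply/andP; split.
    by apply: av_ge0 => v; case: ifP => // _; case/andP: (l01 v).
  have [Gt _ ut] := tauP t; have := PsiG t _ Gt => Pt.
  have bP : bounded_by 1 Psi.
    by move=> v; case/andP: (Psi01 v) => ? ?; rewrite ger0_norm.
  have beP : bounded_by e (fun v => e * Psi v).
    by move=> v; rewrite normrM gtr0_norm// ler_piMr ?(ltW e0)// bP.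
  apply: le_trans (_ : av (tau t) (f t) - e * av (tau t) Psi <= _).
    have : e * av (tau t) Psi <= e * (Psi t - delta t) by rewrite ler_pM2l.
    rewrite mulrBr; move: ut; lra.
  rewrite -(avZ _ _ bP) -(avB _ (bf t) beP).
  apply: (@ler_av _ _ _ (1 + e) 1).
  - by move=> v; rewrite (le_trans (ler_normB _ _))// lerD ?bf ?beP.
  - move=> v; case: ifP => _; first by rewrite normr0.
    by case/andP: (l01 v) => ? ?; rewrite ger0_norm.
  - move=> v _; rewrite /f; case: ifP => _.
      by rewrite sub0r oppr_le0 mulr_ge0 ?(ltW e0)//; case/andP: (Psi01 v).
    by rewrite /l le_max lexx orbT.
apply: le_trans; rewrite /l le_max; apply/orP; right.
apply: lerB; first exact: u_ge.
by rewrite ler_piMr ?(ltW e0)//; case/andP: (Psi01 s).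
Qed.

End near_optimal.

(* A stationary choice that is good from [x] is fixed on the set of states
   from which it avoids the far bad transitions with probability at least 1/2:
   this costs little at [x], and no state loses its value, because a run that
   enters the set can follow the fixed choice for ever. *)
Lemma fix_choice G x : transient_house G -> purifiable G -> full_value G ->
  exists G' : @house R X,
    [/\ forall s g, G' s g -> G s g,
        exists g, D x g /\ G' x = [set g],
        purifiable G',
        full_value G' &
        forall p, in_house G' p -> 2^-1 <= Pr p x eventually_good].
Proof.
(* The error [e] is spent three times at [x]: for the value, for the restriction to far bad
   transitions, and for the stationary choice. Hence [w x] is at least [1 - 3 * e], enough for the
   bound 1/2 in the last claim. *)
move=> trG dG vG; pose e : R := 16^-1; have e0 : 0 < e by rewrite invr_gt0.
have e16 : 16 * e = 1 by rewrite /e divff.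
have G_inhab : exists p, in_house G p by have [p []] := vG x 1 ltr01; exists p.
have [p [Gp px]] := vG x e e0.
have [j pj] := far_bad_cofinal p x e0.
have [tau [tauP tau_opt]] := near_optimal_avoidance j trG dG G_inhab e0.
pose w s := Pr (stationary tau) s (avoids j).
have ma := avoids_measurable j.
have w01 s : 0 <= w s <= 1 by rewrite /w Pr_ge0 Pr_le1.
have wE s : w s = av (tau s) (fun t => if `[< far_bad j s t >] then 0 else w t).
  by rewrite {1}/w never_onestep.
have wx : 1 - 3 * e <= w x.
  by have := tau_opt p x Gp; move: px pj; rewrite /w; lra.
pose H s := (2^-1 <= w s).
pose G' : @house R X := fun s => if H s then [set tau s] else G s.
have sub s g : G' s g -> G s g.
  by rewrite /G'; case: ifP => // _ ->; case: (tauP s).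
have trG' : transient_house G' by move=> q s Gq; apply: trG => h t; exact: sub.
have Hx : H x by rewrite /H; lra.
exists G'; split=> //.
- by exists (tau x); split; [case: (tauP x)|rewrite /G' Hx].
- move=> s g; rewrite /G' /purifiable; case: (H s) => [->|]; last exact: dG.
  by left; case: (tauP s).
(* By the zero-one law for values, a uniformly positive value is enough. *)
- suff q4 : forall s, exists q, in_house G' q /\ 4^-1 <= Pr q s eventually_good.
    apply: (value_zero_one eventually_good_measurable eventually_good_tail _ q4).
    by rewrite invr_gt0.
  move=> s; have [p' [Gp' ps]] := vG s e e0.
  have [j' pj'] := far_bad_cofinal p' s e0.
  (* Follow [p'] until [H] is entered, and the fixed choice [tau] from then on, even after leaving
     [H]. *)
  pose q : policy R X := fun h t => if has H (rcons h t) then tau t else p' h t.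
  have Gq : in_house G' q.
    move=> h t; rewrite /q /G' has_rcons; case: ifP => Ht //=.
    by case: ifP => _; [case: (tauP t)|exact: Gp'].
  exists q; split=> //.
  pose bad h t v := if has H (rcons h t) then far_bad j t v else far_bad j' t v.
  pose v' h t := Pr (pshifts p' h) t (avoids j').
  have v'01 h t : 0 <= v' h t <= 1.
    by rewrite /v' Pr_ge0 Pr_le1//; exact: avoids_measurable.
  have v'E h t : v' h t = av (p' h t)
      (fun v => if `[< far_bad j' t v >] then 0 else v' (rcons h t) v).
    by rewrite {1}/v' never_onestep pshift_pshifts /pshifts cats0.
  (* Before [H] is entered, half of the avoidance probability of [p'] is kept. It is at most 1/2,
     which [w] guarantees on entering [H], so [l] is a submartingale across the switch. *)
  pose l h t := if has H (rcons h t) then w t else v' h t / 2.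
  have l01 h t : 0 <= l h t <= 1.
    rewrite /l; case: ifP => // _; case/andP: (v'01 h t) => ? ?; lra.
  have ls : 4^-1 <= l [::] s.
    rewrite /l /= orbF; case: ifP => Hs; first by move: Hs; rewrite /H; lra.
    by rewrite /v' pshifts_nil; move: ps pj'; lra.
  have lN : l [::] s <= Pr q s (never bad).
    apply: never_lower_bound => // h t.
    have bl : bounded_by 1 (fun v =>
        if `[< bad h t v >] then 0 else l (rcons h t) v).
      move=> v; case: ifP => _; first by rewrite normr0.
      by case/andP: (l01 (rcons h t) v) => ? ?; rewrite ger0_norm.
    rewrite {1}/l /q; case: ifP => Ht.
      rewrite wE; apply: (ler_av (_ : bounded_by 1 _) bl) => v.
        case: ifP => _; first by rewrite normr0.
        by case/andP: (w01 v) => ? ?; rewrite ger0_norm.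
      by move=> _; rewrite /bad Ht /l has_rcons Ht orbT.
    have bv : bounded_by 1 (fun v =>
        if `[< far_bad j' t v >] then 0 else v' (rcons h t) v).
      move=> v; case: ifP => _; first by rewrite normr0.
      by case/andP: (v'01 (rcons h t) v) => ? ?; rewrite ger0_norm.
    rewrite v'E mulrC -(avZ _ _ bv).
    apply: (ler_av (_ : bounded_by 2^-1 _) bl) => v.
      by rewrite normrM gtr0_norm ?invr_gt0// ler_piMr ?invr_ge0// bv.
    move=> _; rewrite /bad Ht; case: ifP => _; first by rewrite mulr0.
    rewrite /l has_rcons Ht orbF; case: ifP => Hv; last by rewrite mulrC.
    case/andP: (v'01 (rcons h t) v) => _ v1; apply: le_trans Hv.
    by rewrite ler_piMr// invr_ge0.
  apply: le_trans (le_trans ls lN) _.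
  have mf := @finite_visits_measurable X; have mN := never_measurable bad.
  rewrite -(Pr1_setI mf mN (trG' q s Gq)); apply: sub_Pr.
  + exact: measurableI.
  + exact: eventually_good_measurable.
  + move=> om [nom fom].
    have [[n hn]|nh] := pselect (exists n, has H (rcons (mkseq om n) (om n))).
      apply: (@avoids_eventually_good j) => //; exists n => m nm b.
      apply: (nom m); rewrite /bad (_ : has _ _ = true)//.
      move: hn; rewrite -!mkseqS => /(hasP)[y yn Hy]; apply/hasP; exists y => //.
      move: yn; rewrite /mkseq => /mapP[i]; rewrite mem_iota => /andP[_ ni] ->.
      by apply: map_f; rewrite mem_iota (leq_trans ni).
    apply: (@avoids_eventually_good j') => //; exists 0%N => m _ b.
    apply: (nom m); rewrite /bad; case: ifP => // hm.
    by exfalso; apply: nh; exists m.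
- move=> q Gq; apply: le_trans (Pr_avoids_le _ j trG' Gq).
  (* [2 * w - 1] is nonnegative exactly on [H], where [tau] is imposed and [w] is conserved in mean;
     off [H] the function [l] vanishes, so any move is harmless there. *)
  pose l t := Num.max 0 (2 * w t - 1).
  have l01 t : 0 <= l t <= 1.
    rewrite /l le_max lexx /= ge_max ler01 /=; case/andP: (w01 t) => ? ?; lra.
  apply: le_trans (_ : l x <= _).
    by rewrite /l le_max; apply/orP; right; move: wx; lra.
  apply: (@never_lower_bound _ _ _ x (fun _ => far_bad j) (fun _ => l)) => // h t.
  have := Gq h t; rewrite /G'; case: ifP => Ht; last first.
    move=> _; rewrite {1}/l max_l; last first.
      by move/negbT: Ht; rewrite /H -ltNge; lra.
    by apply: av_ge0 => v; case: ifP => // _; case/andP: (l01 v).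
  move=> ->; rewrite {1}/l max_r; last by move: Ht; rewrite /H; lra.
  have bw : bounded_by 1 (fun v => if `[< far_bad j t v >] then 0 else w v).
    move=> v; case: ifP => _; first by rewrite normr0.
    by case/andP: (w01 v) => ? ?; rewrite ger0_norm.
  have b2w : bounded_by 2 (fun v => 2 * if `[< far_bad j t v >] then 0 else w v).
    by move=> v; rewrite normrM ger0_norm// ler_piMr// bw.
  have b1 : bounded_by 1 (fun _ : X => 1 : R) by move=> v; rewrite normr1.
  rewrite wE -(avZ _ _ bw) -[X in _ - X](av_cst (tau t)) -(avB _ b2w b1).
  apply: (@ler_av _ _ _ (2 + 1) 1).
  + by move=> v; rewrite (le_trans (ler_normB _ _))// lerD ?b2w ?b1.
  + move=> v; case: ifP => _; first by rewrite normr0.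
    by case/andP: (l01 v) => ? ?; rewrite ger0_norm.
  + move=> v _; case: ifP => _; first by rewrite mulr0 sub0r lerN10.
    by rewrite /l le_max lexx orbT.
Qed.

(** The states are treated in the order of their codes by [fix_choice]. The resulting choice [tau]
    belongs to every intermediate house, hence wins with probability at least 1/2 from every state,
    and the zero-one law raises this to 1. *)
Lemma stationary_eventually_good G :
  transient_house G -> purifiable G -> full_value G ->
  exists tau : X -> gamble R X, (forall s, G s (tau s) /\ D s (tau s)) /\
    forall s, Pr (stationary tau) s eventually_good = 1.
Proof.
move=> trG dG vG.
pose ok (H : @house R X) := [/\ transient_house H, purifiable H & full_value H].
pose fixes (H : @house R X) x (H' : @house R X) :=
  [/\ forall s g, H' s g -> H s g, exists g, D x g /\ H' x = [set g] &
      forall p, in_house H' p -> 2^-1 <= Pr p x eventually_good].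
have /choice[nxt nxtP] : forall u : @house R X * X, exists H',
    ok u.1 -> ok H' /\ fixes u.1 u.2 H'.
  move=> [H x]; have [okH|nok] := pselect (ok H); last by exists H.
  have [trH dH vH] := okH; have [H' [sub sing dH' vH' ph]] := fix_choice x trH
    dH vH.
  exists H' => _; split; last by split.
  by split=> // p s Hp; apply: trH => h t; exact: sub.
pose Gn n := iteri n (fun i H => nxt (H, nthX i)) G.
have okn n : ok (Gn n).
  elim: n => [|n IH]; first by split.
  by case: (nxtP (Gn n, nthX n) IH).
have fixn n : fixes (Gn n) (nthX n) (Gn n.+1).
  by case: (nxtP (Gn n, nthX n) (okn n)).
have subn m n s g : (m <= n)%N -> Gn n s g -> Gn m s g.
  elim: n => [|n IH]; first by rewrite leqn0 => /eqP ->.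
  rewrite leq_eqVlt => /orP[/eqP ->//|]; rewrite ltnS => mn Gg.
  by apply: IH => //; case: (fixn n) => + _ _; apply.
have /choice[tau tauP] : forall s, exists g, D s g /\ Gn (pickle s).+1 s = [set g].
  by move=> s; case: (fixn (pickle s)); rewrite nthX_pickle.
(* After the stage that fixes [s], the house is still nonempty at [s], because [full_value] provides
   a policy; so it retains the single choice. *)
have tauG n s : Gn n s (tau s).
  have [Ds Es] := tauP s; have [np|pn] := leqP n (pickle s).+1.
    by apply: subn np _; rewrite Es.
  have [_ _ vn] := okn n; have [p [Gp _]] := vn s 1 ltr01.
  by have := subn _ _ _ _ (ltnW pn) (Gp [::] s); rewrite Es => <-; exact: Gp.
exists tau; split=> [s|s]; first by split; [exact: (tauG 0%N)|case: (tauP s)].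
(* The only policy of this house is [stationary tau], so a statement on its value is one on that
   policy. *)
pose Gt : @house R X := fun s => [set tau s].
have half t : exists p, in_house Gt p /\ 2^-1 <= Pr p t eventually_good.
  exists (stationary tau); split=> //.
  case: (fixn (pickle t)); rewrite nthX_pickle => _ _; apply => h u.
  exact: tauG.
have mg := eventually_good_measurable.
apply/eqP; rewrite eq_le Pr_le1//=; apply/ler_addgt0Pr => e e0.
have h2 : 0 < 2^-1 :> R by rewrite invr_gt0.
have [p [Gp]] := value_zero_one mg eventually_good_tail h2 half s e0.
rewrite lerBlDr; suff -> : p = stationary tau by [].
by apply/funext => h; apply/funext => t; exact: Gp.
Qed.

End eventual_avoidance.

(** * Stationary optimal policies *)

Section optimal_stationary.
Context {R : realType} {X : pcountType}.
Implicit Types (p q : policy R X) (s t : X) (om : traj X).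
Variables (G D : @house R X) (M : R) (r : X -> X -> R) (F : traj X -> R).
Hypotheses (trG : transient_house G) (dG : purifiable D G).
Hypotheses (mF : measurable_fun setT F) (MF : bounded_by M F).
(** Together with [F_above] this says that [F] is the lower limit of [r] along the trajectory. *)
Hypothesis F_below : forall om e, 0 < e ->
  exists N, forall n, (N <= n)%N -> F om - e <= r (om n) (om n.+1).
Hypothesis F_above : forall om c,
  (exists N, forall n, (N <= n)%N -> c <= r (om n) (om n.+1)) -> c <= F om.

Let tF : tail_fun F.
Proof.
move=> s; apply/funext => om /=; apply/eqP; rewrite eq_le; apply/andP; split.
  apply/ler_addgt0Pr => e e0; rewrite -lerBlDr; apply: F_above.
  have [N HN] := F_below (tcons s om) e0; exists N => n Nn.
  exact: (HN n.+1 (leqW Nn)).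
apply/ler_addgt0Pr => e e0; rewrite -lerBlDr; apply: F_above.
by have [N HN] := F_below om e0; exists N.+1 => -[//|n] Nn; exact: HN.
Qed.

Hypothesis G_inhab : exists p, in_house G p.

Let value s := sup [set expect p s F | p in in_house G].

Let value_sup s : has_sup [set expect p s F | p in in_house G].
Proof.
have [p Gp] := G_inhab; split; first by exists (expect p s F), p.
exists M => _ [q _ <-]; have := expect_bounded q s mF MF.
by rewrite ler_norml => /andP[].
Qed.

Let value_ge p s : in_house G p -> expect p s F <= value s.
Proof. by move=> Gp; apply: ub_le_sup; [case: (value_sup s)|exists p]. Qed.

Let value_bounded : bounded_by M value.
Proof.
move=> s; rewrite ler_norml; apply/andP; split.
  have [p Gp] := G_inhab; apply: le_trans (value_ge s Gp).
  by have := expect_bounded p s mF MF; rewrite ler_norml => /andP[].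
apply: ge_sup; first by case: (value_sup s).
move=> _ [q _ <-]; have := expect_bounded q s mF MF.
by rewrite ler_norml => /andP[].
Qed.

(** After [g], nearly optimal policies can be chosen separately for each outcome, and the combined
    policy is bounded by the value at [s]. *)
Let value_excessive s g : G s g -> av g value <= value s.
Proof.
move=> Gg; apply/ler_addgt0Pr => e e0.
have /choice[q qP] : forall t, exists p, in_house G p /\
    value t - e <= expect p t F.
  move=> t; have [_ [p Gp <-] /ltW pe] := sup_adherent e0 (value_sup t).
  by exists p.
have Gc : in_house G (pcons s g q).
  by apply: in_house_pcons => // t; case: (qP t).
rewrite -lerBlDr; apply: le_trans (value_ge s Gc).
rewrite (expect_pcons _ _ _ mF MF) tF.
have be : bounded_by e (fun _ : X => e) by move=> t; rewrite gtr0_norm.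
rewrite -[X in _ - X](av_cst g e) -(avB _ value_bounded be).
apply: (@ler_av _ _ _ (M + e) M).
- by move=> t; rewrite (le_trans (ler_normB _ _))// lerD ?value_bounded ?be.
- by move=> t; exact: expect_bounded.
- by move=> t _; case: (qP t).
Qed.

Let optimal p s := in_house G p /\ expect p s F = value s.

(** The payoff of [p] is the mean of its continuations, which is at most the mean of the values,
    hence at most [value s]. For an optimal [p] all these are equal, and [av_max] gives equality at
    each outcome. *)
Let optimal_step p s : optimal p s -> av (p [::] s) value = value s /\
  forall t, 0 < p [::] s t -> optimal (pshift p s) t.
Proof.
move=> [Gp ps]; have Gs := in_house_pshift s Gp.
have bE : bounded_by M (fun t => expect (pshift p s) t F).
  by move=> t; exact: expect_bounded.
have E : expect p s F = av (p [::] s) (fun t => expect (pshift p s) t F).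
  by rewrite (expect_onestep _ _ mF MF) tF.
have le1 : av (p [::] s) (fun t => expect (pshift p s) t F) <=
    av (p [::] s) value.
  by apply: (ler_av bE value_bounded) => t _; exact: value_ge.
have ve : av (p [::] s) value = value s.
  by apply/eqP; rewrite eq_le value_excessive ?Gp//= -ps E.
split=> // t pt; split=> //.
apply/eqP; rewrite -subr_eq0; apply/eqP.
have bB : bounded_by (M + M) (fun t => expect (pshift p s) t F - value t).
  by move=> u; rewrite (le_trans (ler_normB _ _))// lerD ?bE ?value_bounded.
apply: (av_max bB) pt => [u _|]; first by rewrite subr_le0 value_ge.
by rewrite (avB _ bE value_bounded) -E ps ve subrr.
Qed.

Let O s := exists p, optimal p s.

(** From a state with an optimal policy, moves must conserve the value in mean and lead to such
    states again; elsewhere the house is unchanged, so it offers a gamble in every state. *)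
Let conserving : @house R X := fun s g =>
  G s g /\ (O s -> av g value = value s /\ forall t, 0 < g t -> O t).

Let optimal_conserving p s : optimal p s -> conserving s (p [::] s).
Proof.
move=> ps; have [Gp _] := ps; have [pv pO] := optimal_step ps.
by split=> // _; split=> // t /pO; exists (pshift p s).
Qed.

Let optimal_pshifts p h t u : optimal (pshifts p h) t -> 0 < p h t u ->
  optimal (pshifts p (rcons h t)) u.
Proof.
move=> /optimal_step[_ +] pu; rewrite pshift_pshifts; apply.
by rewrite /pshifts cats0.
Qed.

Let conserving_inhab : exists d : X -> gamble R X, forall s, conserving s (d s).
Proof.
suff /choice[d dP] : forall s, exists g, conserving s g by exists d.
move=> s; have [[p ps]|nO] := pselect (O s).
  by exists (p [::] s); exact: optimal_conserving.
by have [p Gp] := G_inhab; exists (p [::] s); split.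
Qed.

Let transient_conserving : transient_house conserving.
Proof. by move=> p s cp; apply: trG => h t; case: (cp h t). Qed.

(** Each pure outcome is itself an available move, so its value is at most [value s]. As the mean
    equals [value s], every outcome conserves the value. *)
Let purifiable_conserving : purifiable D conserving.
Proof.
move=> s g [Gg cg]; have [|dir] := dG Gg; [by left|right] => t gt.
have [Gt Dt] := dir t gt; split=> //; split=> // Os; have [gv gO] := cg Os.
split; last by move=> u /=; case: eqP => [-> _|_]; [exact: gO|rewrite ltxx].
rewrite (av_dirac t value_bounded).
apply: (av_max value_bounded) gt; last by rewrite gv.
move=> u /dir[Gu _]; have := value_excessive Gu.
by rewrite (av_dirac u value_bounded).
Qed.

Let low_reward (k : nat) s t := O s /\ r s t < value s - k.+1%:R^-1.

Let phi := eventually_good low_reward.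

Let mphi : measurable phi. Proof. exact: eventually_good_measurable. Qed.

(** Under an optimal policy the conditional expectation of [F] is the value of the current state. By
    Levy's law it is eventually at most slightly above [F], and [F] is eventually at most slightly
    above the reward. *)
Let optimal_phi p s : optimal p s -> Pr p s phi = 1.
Proof.
move=> ps; have [A [mA A1 AP]] := limsup_cond_expect p s mF MF tF.
pose bad h t u := ~ optimal (pshifts p (rcons h t)) u.
have N1 : Pr p s (never bad) = 1.
  apply: (@never_as _ _ p s bad (fun h t => optimal (pshifts p h) t)) => //.
  by move=> h t ot u pu; have := optimal_pshifts ot pu; split=> //; apply.
have mN := never_measurable bad.
have mAN : measurable (A `&` never bad) by exact: measurableI.
apply: (Pr1_sub mAN mphi); last by rewrite (Pr1_setI mN mA N1).
(* With index [2k+1] the margin is [1 / (2k+2)], half of the margin of level [k]. *)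
move=> om [Aom nom] k; have [N1' HN1] := AP om Aom (k.*2.+1).
have d0 : 0 < k.*2.+2%:R^-1 :> R by rewrite invr_gt0.
have [N2 HN2] := F_below om d0.
(* [never bad] speaks of the states reached by a transition, hence of times from 1 on. *)
exists (maxn 1 (maxn N1' N2)) => n; rewrite !geq_max => /and3P[n1 n2 n3] [_].
apply/negP; rewrite -leNgt.
have <- : cond_expect p F (mkseq om n) (om n) = value (om n).
  case: n n1 {n2 n3} => // n _; rewrite mkseqS.
  by have /contrapT[_] := nom n.
have E : k.+1%:R^-1 = k.*2.+2%:R^-1 + k.*2.+2%:R^-1 :> R.
  by rewrite -doubleS -mul2n natrM invfM (mulrC 2^-1) -splitr.
rewrite E opprD addrA (le_trans _ (HN2 n n3))// lerD2r lerBlDr.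
exact: HN1.
Qed.

(** An optimal policy conserves only along its own histories; it is replaced by [d] at the others,
    which does not affect its law from [s]. *)
Let conserving_phi s : O s -> exists p, in_house conserving p /\ Pr p s phi = 1.
Proof.
move=> [p ps]; have [d dP] := conserving_inhab.
pose p' : policy R X := fun h t =>
  if `[< conserving t (p h t) >] then p h t else d t.
exists p'; split; first by move=> h t; rewrite /p'; case: asboolP.
rewrite -(optimal_phi ps); congr fine.
apply: (@law_ext _ _ _ _ _ (fun h t => optimal (pshifts p h) t)) => // h t ot.
have ct : conserving t (p h t).
  by have := optimal_conserving ot; rewrite /pshifts cats0.
by rewrite /p' asboolT//; split=> // u; exact: optimal_pshifts.
Qed.

Let full_value_conserving : full_value low_reward conserving.
Proof.
have [d dP] := conserving_inhab.
have /choice[P PP] : forall s, exists p, in_house conserving p /\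
    (O s -> Pr p s phi = 1).
  move=> s; have [/conserving_phi[p [cp p1]]|nO] := pselect (O s).
    by exists p.
  by exists (fun _ => d); split.
(* Wait for a state of [O]; there are no low rewards before. *)
pose Ob s := `[< O s >].
pose q : policy R X := fun h t =>
  let i := find Ob (rcons h t) in
  if (i <= size h)%N then P (nth t (rcons h t) i) (drop i h) t else d t.
have qc : in_house conserving q.
  by move=> h t; rewrite /q; case: ifP => // _;
    case: (PP (nth t (rcons h t) (find Ob (rcons h t)))).
suff q1 s : Pr q s phi = 1.
  by move=> s e e0; exists q; split=> //; rewrite q1 gerBl ltW.
have qO u : O u -> Pr q u (~` phi) = 0.
  move=> Ou; rewrite Pr_setC//; have [_ /(_ Ou) <-] := PP u.
  apply/eqP; rewrite subr_eq0; apply/eqP; congr fine.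
  apply: (@law_ext _ _ _ _ _ (fun h t => head t h = u)) => //.
  move=> h t hs; split=> [|v _]; last by case: h hs.
  have E : find Ob (rcons h t) = 0%N.
    by case: h hs => [|x h] /= ->; rewrite /Ob asboolT.
  rewrite /q E /= drop0 (_ : nth t (rcons h t) 0 = u)//.
  by case: h hs {E}.
have qN u : ~ O u -> pshift q u = q.
  move=> nO; apply/funext => h; apply/funext => t; rewrite /pshift /q /=.
  by rewrite /Ob asboolF//= ltnS.
apply: Pr_not_null => //.
have mH n : measurable [set om : traj X | ~ phi om /\ exists i, (i <= n)%N /\ O
  (om i)].
  rewrite (_ : [set _ | _] = ~` phi `&` [set om : traj X | exists i, (i <= n)%N
    /\ O (om i)])//.
  apply: measurableI; first exact: measurableC.
  apply: measurable_ex => i; apply: measurable_conj => _.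
  exact: (@coord_measurable _ [set t | O t]).
(* Without a visit to [O] there is no low reward, so a failure of [phi] implies a visit to [O] by
   some time [n]. Induction on [n] then leads to a start in [O]. *)
rewrite (_ : ~` phi = [set om | exists n : nat, ~ phi om /\
    exists i, (i <= n)%N /\ O (om i)]); last first.
  apply/seteqP; split => om /=; last by move=> [n []].
  move=> nphi; apply: contrapT => H; apply: (nphi) => k; exists 0%N => n _ [On _].
  by apply: H; exists n; split=> //; exists n.
apply: Pr_ex_null => // n.
have sub0 t : O t -> Pr q t [set om : traj X | ~ phi om /\
    exists i, (i <= n)%N /\ O (om i)] = 0.
  move=> Ot; apply/eqP; rewrite eq_le Pr_ge0 andbT.
  rewrite (le_trans (sub_Pr q t (mH n) (measurableC mphi) _)) ?qO//.
  by move=> om [].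
elim: n s {sub0} (sub0) => [|n IH] s sub0; have [/sub0//|nO] := pselect (O s).
  apply/eqP; rewrite eq_le Pr_ge0 andbT -(Pr_set0 q s); apply: ler_Pr => //.
  by move=> om om0 [_ [i []]]; rewrite leqn0 => /eqP ->; rewrite om0.
rewrite Pr_onestep// qN//.
rewrite (_ : tcons s @^-1` _ = [set om : traj X | ~ phi om /\
    exists i, (i <= n)%N /\ O (om i)]).
  rewrite -[RHS](av_cst (q [::] s)); congr (av _); apply/funext => t; apply: IH.
  move=> u Ou; apply/eqP; rewrite eq_le Pr_ge0 andbT.
  rewrite (le_trans (sub_Pr q u (mH n) (measurableC mphi) _)) ?qO//.
  by move=> om [].
have tphi om : phi (tcons s om) = phi om.
  exact: (congr1 (fun A : set (traj X) => A om) (@eventually_good_tail _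
    low_reward s)).
apply/seteqP; split => om /=; rewrite tphi => -[np [i [ilen Oi]]]; split=> //.
  by case: i ilen Oi => [_ /nO//|i ilen Oi]; exists i.
by exists i.+1.
Qed.

(** Let [d] be the value minus the payoff of [tau], a martingale on [O]. If [d s0] exceeded [e],
    then [d] would stay above [e] for ever with positive probability. There the rewards follow the
    values and the payoffs approach [F], so the rewards would stay above [F] by a fixed margin. *)
Lemma optimal_stationary s0 p0 : in_house G p0 ->
  (forall p, in_house G p -> expect p s0 F <= expect p0 s0 F) ->
  exists tau : X -> gamble R X, (forall s, G s (tau s) /\ D s (tau s)) /\
    expect (stationary tau) s0 F = expect p0 s0 F.
Proof.
move=> Gp0 p0_opt.
have v0 : expect p0 s0 F = value s0.
  apply/eqP; rewrite eq_le value_ge//=; apply: ge_sup.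
    by case: (value_sup s0).
  by move=> _ [p Gp <-]; exact: p0_opt.
have O0 : O s0 by exists p0.
have [tau [tauP tau1]] := stationary_eventually_good transient_conserving
  purifiable_conserving full_value_conserving.
exists tau; split=> [s|]; first by case: (tauP s) => -[].
have Gtau : in_house G (stationary tau) by move=> h s; case: (tauP s) => -[].
apply/eqP; rewrite eq_le p0_opt//= v0.
pose y s := expect (stationary tau) s F.
have yb : bounded_by M y by move=> s; exact: expect_bounded.
have yE s : y s = av (tau s) y by rewrite {1}/y (expect_onestep _ _ mF MF) tF.
pose d s := if `[< O s >] then value s - y s else 0.
have M0 : 0 <= M := bounded_by_ge0 yb.
have d0 s : 0 <= d s by rewrite /d; case: ifP => // _; rewrite subr_ge0 value_ge.
have dM s : d s <= M + M.
  rewrite /d; case: ifP => _; last by rewrite addr_ge0.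
  rewrite (le_trans (ler_norm _))// (le_trans (ler_normB _ _))//.
  by rewrite lerD ?yb ?value_bounded.
have bd : bounded_by (M + M) d by move=> s; rewrite ger0_norm.
have dE s : O s -> d s = av (tau s) d.
  move=> Os; have [[_ /(_ Os)[vs Os']] _] := tauP s.
  rewrite {1}/d asboolT// -vs yE -(avB _ value_bounded yb).
  apply: (av_eq (_ : bounded_by (M + M) _) bd).
    by move=> u; rewrite (le_trans (ler_normB _ _))// lerD ?yb ?value_bounded.
  by move=> u /Os' Ou; rewrite /d asboolT.
suff : d s0 <= 0 by rewrite /d asboolT// subr_le0.
apply/ler_addgt0Pr => e e0; rewrite add0r leNgt; apply/negP => ed.
pose K := M + M + 1; have K0 : 0 < K by rewrite ltr_wpDl// addr_ge0.
(* The excess of [d] over [e], scaled into the unit interval; it is a submartingale killed when [d]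
   falls to [e]. *)
pose l t := Num.max 0 (d t - e) / K.
have l01 t : 0 <= l t <= 1.
  rewrite /l divr_ge0 ?(ltW K0) ?le_max ?lexx//= ler_pdivrMr// mul1r ge_max.
  rewrite (ltW K0) /= /K; have := dM t; lra.
pose bad (h : seq X) (t u : X) := d u <= e.
have lN : l s0 <= Pr (stationary tau) s0 (never bad).
  apply: (@never_lower_bound _ _ _ s0 bad (fun _ => l)) => // h t.
  have [dte|edt] := leP (d t) e.
    rewrite {1}/l max_l ?subr_le0// mul0r; apply: av_ge0 => u.
    by case: ifP => // _; case/andP: (l01 u).
  have Ot : O t.
    by move: edt; rewrite /d; case: asboolP => // _; rewrite ltNge (ltW e0).
  rewrite {1}/l max_r ?subr_ge0 ?(ltW edt)// (dE t Ot).
  have be : bounded_by e (fun _ : X => e) by move=> u; rewrite gtr0_norm.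
  have bde : bounded_by (M + M + e) (fun u => d u - e).
    by move=> u; rewrite (le_trans (ler_normB _ _))// lerD ?bd ?be.
  rewrite -[X in _ - X](av_cst (tau t)) -(avB _ bd be) mulrC -(avZ _ _ bde).
  apply: (@ler_av _ _ _ (K^-1 * (M + M + e)) 1).
  - move=> u; rewrite normrM gtr0_norm ?invr_gt0// ler_pM2l ?invr_gt0//.
  - move=> u; case: ifP => _; first by rewrite normr0.
    by case/andP: (l01 u) => ? ?; rewrite ger0_norm.
  - move=> u _; case: asboolP => [du|_].
      by rewrite pmulr_rle0 ?invr_gt0// subr_le0.
    by rewrite /l mulrC ler_pM2r ?invr_gt0// le_max lexx orbT.
have l0 : 0 < l s0.
  by rewrite /l divr_gt0// lt_max subr_gt0 ed orbT.
have [A [mA A1 AP]] := liminf_cond_expect (stationary tau) s0 mF MF tF.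
have mN := never_measurable bad.
have mNA : measurable (never bad `&` A) by exact: measurableI.
have := lt_le_trans l0 lN; rewrite -(Pr1_setI mA mN A1).
rewrite -(Pr1_setI mphi mNA (tau1 s0)).
rewrite (_ : _ `&` phi = set0) ?Pr_set0 ?ltxx//.
apply/seteqP; split=> // om [[nom Aom] phom].
have e40 : 0 < e / 4 by rewrite divr_gt0.
have [k kP] : exists k, k.+1%:R^-1 < e / 4.
  by have [k] := ltr_add_invr e40; rewrite add0r; exists k.
have [N1 HN1] := AP om Aom k; have [N2 HN2] := phom k.
(* The reward is at least the value minus [e/4], the value at least [y] plus [e], and [y] at least
   [F] minus [e/4]. *)
have : F om + e / 4 <= F om.
  apply: F_above; exists (maxn 1 (maxn N1 N2)) => n.
  rewrite !geq_max => /and3P[n1 n2 n3].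
  have dn : e < d (om n).
    case: n n1 {n2 n3} => // n _; rewrite ltNge; apply/negP.
    exact: (nom n).
  have On : O (om n).
    by move: dn; rewrite /d; case: asboolP => // _; rewrite ltNge (ltW e0).
  have rn : value (om n) - k.+1%:R^-1 <= r (om n) (om n.+1).
    by rewrite leNgt; apply/negP => rv; apply: (HN2 n n3).
  have yn : F om - k.+1%:R^-1 <= y (om n) by exact: HN1.
  move: dn; rewrite /d asboolT// => dn.
  apply: le_trans rn; move: kP yn dn.
  move: (k.+1%:R^-1) (value _) (y _) (F om) => a b c' f.
  lra.
by rewrite gerDl leNgt e40.
Qed.

End optimal_stationary.

(** * Strategies and policies *)

Section liminf.
Context {R : realType} (B : R) (u : nat -> R).
Hypothesis uB : forall n, `|u n| <= B.

Let l := limn_einf (EFin \o u).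

Let lE : l = ereal_sup (range (einfs (EFin \o u))).
Proof. by rewrite /l limn_einf_lim; apply/cvg_lim => //; exact: cvg_einfs_sup. Qed.

Let einfs_le n m : (n <= m)%N -> (einfs (EFin \o u) n <= (u m)%:E)%E.
Proof. by move=> nm; apply: ereal_inf_lbound; exists m. Qed.

Let einfs_ge n c : (forall m, (n <= m)%N -> c <= u m) ->
  (c%:E <= einfs (EFin \o u) n)%E.
Proof.
by move=> cu; apply: le_ereal_inf_tmp => _ [m nm <-]; rewrite lee_fin; exact: cu.
Qed.

Lemma limn_einf_bounded : ((- B)%:E <= limn_einf (EFin \o u) <= B%:E)%E.
Proof.
rewrite -/l lE; apply/andP; split.
  apply: (@le_trans _ _ (einfs (EFin \o u) 0)); last first.
    by apply: ereal_sup_ubound; exists 0%N.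
  by apply: einfs_ge => m _; have := uB m; rewrite ler_norml => /andP[].
apply: ge_ereal_sup => _ [n _ <-]; apply: le_trans (einfs_le (leqnn n)) _.
by rewrite lee_fin; have := uB n; rewrite ler_norml => /andP[].
Qed.

Lemma limn_einf_fin_num : limn_einf (EFin \o u) \is a fin_num.
Proof.
have /andP[l1 l2] := limn_einf_bounded.
by rewrite fin_numE; apply/andP; split; apply/eqP => E; move: l1 l2; rewrite E.
Qed.

Lemma fine_limn_einf_bounded : `|fine (limn_einf (EFin \o u))| <= B.
Proof.
by rewrite ler_norml -!lee_fin fineK ?limn_einf_fin_num ?limn_einf_bounded.
Qed.

Lemma limn_einf_below e : 0 < e -> exists N, forall n, (N <= n)%N ->
  fine (limn_einf (EFin \o u)) - e <= u n.
Proof.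
move=> e0; have : ((fine l - e)%:E < l)%E.
  by rewrite -[ltRHS](fineK limn_einf_fin_num) lte_fin ltrBlDr ltrDl.
rewrite [ltRHS]lE => /ereal_sup_gt[_ [N _ <-] lN]; exists N => n Nn.
by rewrite -lee_fin; apply: le_trans (ltW lN) (einfs_le Nn).
Qed.

Lemma limn_einf_above c : (exists N, forall n, (N <= n)%N -> c <= u n) ->
  c <= fine (limn_einf (EFin \o u)).
Proof.
move=> [N HN]; rewrite -lee_fin fineK ?limn_einf_fin_num// -/l lE.
by apply: le_trans (einfs_ge HN) _; apply: ereal_sup_ubound; exists N.
Qed.

End liminf.

(** * MDPs as gambling houses on states with memory *)

Section encoding.
Context {R : realType} {X Y : pcountType} (M : mdp R X).
(** A state of [Y] is a state of the MDP with a memory: [next] updates the memory along a move and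
    [enc] computes it from the history. It is used with no memory and with a step counter. *)
Variables (proj : Y -> X) (next : Y -> X -> Y) (enc : seq X -> X -> Y).
Hypothesis proj_next : forall y t, proj (next y t) = t.
Hypothesis proj_enc : forall h s, proj (enc h s) = s.
Hypothesis enc_rcons : forall h s t, enc (rcons h s) t = next (enc h s) t.

Lemma gamble_ext (g k : gamble R Y) : (forall y, g y = k y) -> g = k.
Proof.
case: g k => [g gd] [k kd] /= gk.
have E : g = k by apply/funext.
by case: k / E kd gk => kd _; rewrite (Prop_irrelevance gd kd).
Qed.

(** The image of [g] under [next y], which is injective with left inverse [proj]. *)
Definition push_fun y (g : X -> R) z :=
  if next y (proj z) == z then g (proj z) else 0.

Lemma push_distr y (g : gamble R X) : is_distr xpredT (push_fun y g).
Proof.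
have p0 z : 0 <= push_fun y g z.
  by rewrite /push_fun; case: ifP => // _; exact: gamble_ge0.
split=> //; have [_ _ <-] := gval_distr g.
rewrite (esumID (range (next y))); last by move=> z _; rewrite lee_fin.
rewrite !setTI [X in (_ + X)%E]esum1 ?adde0; last first.
  move=> z /= nz; rewrite /push_fun; case: eqP => // E; exfalso; apply: nz.
  by exists (proj z).
rewrite (reindex_esum [set: X] (range (next y)) (next y))//.
- by apply: eq_esum => t _; rewrite /push_fun proj_next eqxx.
- by apply: inj_bij => t u _ _ E; rewrite -(proj_next y t) E proj_next.
Qed.

Definition push y (g : gamble R X) : gamble R Y := Gamble (push_distr y g).

Lemma push_next y g t : push y g (next y t) = g t.
Proof. by rewrite /= /push_fun proj_next eqxx. Qed.

Lemma push_gt0 y g z : 0 < push y g z -> next y (proj z) = z.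
Proof. by rewrite /= /push_fun; case: eqP => //; rewrite ltxx. Qed.

Definition allowed s (g : gamble R X) :=
  (forall t, 0 < g t -> trans M s t) /\
  (~~ controlled M s -> forall t, g t = prob M s t).

Definition mdp_house : @house R Y := fun y g =>
  exists2 k, allowed (proj y) k & g = push y k.

Definition pure_house : @house R Y := fun y g =>
  controlled M (proj y) -> exists t, g = dirac_gamble (next y t).

Lemma purifiable_mdp_house : purifiable pure_house mdp_house.
Proof.
move=> y g [k [kt kr] ->]; case: (boolP (controlled M (proj y))) => cy; last first.
  by left=> /(negP cy).
right=> z gz; have zE := push_gt0 gz.
split; last by move=> _; exists (proj z); rewrite zE.
exists (dirac_gamble (proj z)); last first.
  apply: gamble_ext => w /=; rewrite /push_fun /=.
  case: (eqVneq w z) => [->|wz]; first by rewrite zE !eqxx.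
  case: eqP => // wE; case: eqP => // pE; exfalso.
  by move/eqP: wz; apply; rewrite -wE pE.
split=> [t|/negP//] /=; case: eqP => [-> _|_]; last by rewrite ltxx.
by apply: kt; rewrite -(push_next y) zE.
Qed.

Lemma allowed_distr s g : allowed s g -> is_distr (trans M s) g.
Proof.
move=> [gt _]; have [g0 _ g1] := gval_distr g; split=> // t ntr.
apply/eqP; rewrite eq_le g0 andbT leNgt; apply/negP => /gt.
exact/negP.
Qed.

Fixpoint encs (h0 h : seq X) : seq Y :=
  if h is s :: h' then enc h0 s :: encs (rcons h0 s) h' else [::].

Lemma map_proj_encs h0 h : map proj (encs h0 h) = h.
Proof. by elim: h h0 => //= s h IH h0; rewrite proj_enc IH. Qed.

(* [p] is started after the history [h0]. *)
Definition simulates (p : policy R Y) (sigma : strategy M) h0 :=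
  forall h s, sorted (trans M) (rcons (h0 ++ h) s) -> forall t,
    p (encs h0 h) (enc (h0 ++ h) s) (next (enc (h0 ++ h) s) t) =
    step sigma (h0 ++ h) s t.

Definition proj_traj (om : traj Y) : traj X := fun n => proj (om n).

Lemma proj_traj_cyl_measurable w : measurable (proj_traj @^-1` cyl w).
Proof.
rewrite (_ : _ @^-1` _ = [set om : traj Y |
  [set v | map proj v = w] (mkseq om (size w))]); first exact: prefix_measurable.
by apply: eq_set => om; rewrite /cyl /preimage /= /mkseq -map_comp.
Qed.

Lemma proj_traj_measurable : measurable_fun setT proj_traj.
Proof.
apply: (@measurability _ _ _ _ _ _ (range (@cyl X))) => //.
by move=> _ [_ [w _ <-] <-]; rewrite setTI; exact: proj_traj_cyl_measurable.
Qed.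

HB.instance Definition _ := isMeasurableFun.Build _ _ _ _ _ proj_traj_measurable.

Lemma sorted_rcons_trans h s t : sorted (trans M) (rcons h s) -> trans M s t ->
  sorted (trans M) (rcons (rcons h s) t).
Proof.
case: h => [|a h] /=; first by move=> _ ->.
by rewrite !rcons_path last_rcons => -> ->.
Qed.

(** Induction on [w] by first-step decomposition, with [h0] as the part already played. *)
Lemma Pr_simulates (p : policy R Y) (sigma : strategy M) h0 s w :
  in_house mdp_house p -> simulates p sigma h0 ->
  sorted (trans M) (rcons h0 s) ->
  Pr p (enc h0 s) (proj_traj @^-1` cyl (s :: w)) = path_prob sigma h0 s w.
Proof.
elim: w p h0 s => [|t w IH] p h0 s Gp sim hs.
  rewrite /= -(Pr_setT p (enc h0 s)); apply: eq_Pr => //.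
    exact: proj_traj_cyl_measurable.
  by move=> om om0; split=> // _; rewrite /preimage /cyl /mkset /mkseq /=
    /proj_traj om0 proj_enc.
set y := enc h0 s.
rewrite Pr_onestep; last exact: proj_traj_cyl_measurable.
have -> : tcons y @^-1` (proj_traj @^-1` cyl (s :: t :: w)) =
    proj_traj @^-1` cyl (t :: w).
  have E om : proj_traj (tcons y om) = tcons s (proj_traj om).
    by apply/funext => -[|n] //=; rewrite /proj_traj /= /y proj_enc.
  apply/seteqP; split => om; rewrite /preimage /mkset E.
    rewrite -[cyl (s :: t :: w) _]/((tcons s @^-1` cyl (s :: t :: w))
      (proj_traj om)).
    by rewrite tcons_cyl eqxx.
  move=> H; rewrite -[cyl (s :: t :: w) _]/((tcons s @^-1` cyl (s :: t :: w))
    (proj_traj om)).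
  by rewrite tcons_cyl eqxx.
have [k [kt _] pE] := Gp [::] y.
have st : p [::] y (next y t) = step sigma h0 s t.
  by have := sim [::] s; rewrite cats0; apply.
have sim' : simulates (pshift p y) sigma (rcons h0 s).
  move=> h v; rewrite cat_rcons => hv u.
  by have := sim (s :: h) v hv u.
have mc := proj_traj_cyl_measurable (t :: w).
(* The induction hypothesis asks for a path of the MDP, which is known only if the move to [t] has
   positive probability. Otherwise both sides vanish. *)
rewrite /= -st; have [p0|] := ltP 0 (p [::] y (next y t)); last first.
  move=> p0; have -> : p [::] y (next y t) = 0.
    by apply/eqP; rewrite eq_le p0 gamble_ge0.
  rewrite mul0r -[RHS](av_cst (p [::] y) 0).
  apply: (@av_eq _ _ _ 1 0) => [z|z|z pz].
  - exact: Pr_bounded.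
  - by rewrite normr0.
  - rewrite -(Pr_set0 (pshift p y) z); apply: eq_Pr => // om omz; split=> //.
    rewrite /preimage /cyl /mkset /mkseq /= => -[]; rewrite /proj_traj omz => zt _.
    have := pz; rewrite pE => /push_gt0; rewrite zt => zE.
    by move: pz; rewrite -zE ltNge p0.
have tr : trans M s t by rewrite -(proj_enc h0 s); apply: kt;
  rewrite -(push_next y) -pE.
rewrite -(IH (pshift p y) (rcons h0 s) t (in_house_pshift y Gp) sim'
  (sorted_rcons_trans hs tr)) enc_rcons -/y.
set c := Pr _ _ _; have cb : bounded_by 1 (fun _ : Y => c).
  by move=> z; exact: Pr_bounded.
rewrite mulrC -av_pred1 -(@avZ _ _ _ 1); last first.
  by move=> z; case: eqP; rewrite /= ?normr1 ?normr0.
apply: (@av_eq _ _ _ 1 1) => [z|z|z pz].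
- exact: Pr_bounded.
- case: eqP => _; rewrite /= ?mulr1 ?mulr0 ?normr0//; exact: Pr_bounded.
- have := pz; rewrite pE => /push_gt0 zE.
  case: eqP => [->|zt]; first by rewrite mulr1.
  rewrite mulr0 -(Pr_set0 (pshift p y) z); apply: eq_Pr => // om omz; split=> //.
  rewrite /preimage /cyl /mkset /mkseq /= => -[]; rewrite /proj_traj omz => pz' _.
  by apply: zt; rewrite -zE pz'.
Qed.

Lemma law_simulates (p : policy R Y) (sigma : strategy M) s :
  in_house mdp_house p -> simulates p sigma [::] ->
  forall A, measurable A ->
    law p (enc [::] s) (proj_traj @^-1` A) = run_law sigma s A.
Proof.
move=> Gp sim; pose P : probability (traj X) R := distribution (law p (enc [::]
  s)) proj_traj.
apply: (@traj_measure_unique _ _ P (run_law sigma s)).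
  by rewrite /= probability_setT ltry.
move=> [|t w].
  by rewrite cyl_nil; exact: etrans (probability_setT _) (esym
    (probability_setT _)).
apply: etrans (esym (run_law_cyl _ _ _ _)).
apply: etrans (esym (EFin_Pr _ _ (proj_traj_cyl_measurable (t :: w)))) _.
congr EFin; case: eqP => [->|ts]; first by rewrite mul1r (Pr_simulates _ Gp sim).
rewrite mul0r -(Pr_set0 p (enc [::] s)); apply: eq_Pr => //.
  exact: proj_traj_cyl_measurable.
move=> om om0; split=> //; rewrite /preimage /cyl /mkset /mkseq /= => -[].
by rewrite /proj_traj om0 proj_enc => /esym.
Qed.

Variable B : R.
Hypothesis rB : forall s t, trans M s t -> `|reward M s t| <= B.
Hypothesis B0 : 0 <= B.

(* The value off the transitions keeps the payoff bounded; no run sees it. *)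
Definition total_reward s t := if trans M s t then reward M s t else 0.

Definition payoff (om : traj X) : R :=
  fine (limn_einf (EFin \o (fun n => total_reward (om n) (om n.+1)))).

Lemma total_reward_bounded (om : traj X) n : `|total_reward (om n) (om n.+1)| <= B.
Proof. by rewrite /total_reward; case: ifP => [/rB//|_]; rewrite normr0. Qed.

Lemma payoff_bounded : bounded_by B payoff.
Proof. move=> om; apply: fine_limn_einf_bounded; exact: total_reward_bounded. Qed.

Lemma payoff_measurable : measurable_fun setT payoff.
Proof.
apply: measurableT_comp; first exact: fine_measurable.
apply: measurableT_comp => //; apply: measurable_fun_limn_esup => n.
apply: measurableT_comp => //; apply/measurable_EFinP => _ C mC; rewrite setTI.
exact: (@coord2_measurable _ [set u | C (total_reward u.1 u.2)]).
Qed.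

Lemma expected_liminf_run_law (sigma : strategy M) s :
  expected_liminf s sigma = (\int[run_law sigma s]_om (payoff om)%:E)%E.
Proof.
rewrite integral_distribution; last 2 first.
- by apply: measurableT_comp => //; exact: payoff_measurable.
- apply: (@bounded_by_integrable _ _ _ _ B (payoff \o @run_traj _ _ M s)).
    by apply: measurableT_comp; [exact: payoff_measurable|exact:
      run_traj_measurable].
  by move=> rho; exact: payoff_bounded.
rewrite /expected_liminf; apply: eq_integral => rho _.
rewrite /= /payoff fineK.
  congr limn_einf; apply/funext => n /=.
  by rewrite /total_reward /run_traj state_trans.
by apply: limn_einf_fin_num => n; exact: total_reward_bounded.
Qed.

Lemma expected_liminf_simulates (p : policy R Y) (sigma : strategy M) s :
  in_house mdp_house p -> simulates p sigma [::] ->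
  expected_liminf s sigma = (expect p (enc [::] s) (payoff \o proj_traj))%:E.
Proof.
move=> Gp sim; rewrite expected_liminf_run_law.
have mc : measurable_fun setT (payoff \o proj_traj).
  by apply: measurableT_comp; [exact: payoff_measurable|exact:
    proj_traj_measurable].
have bc : bounded_by B (payoff \o proj_traj) by move=> om; exact: payoff_bounded.
rewrite /expect /Rintegral fineK; last first.
  by apply: integrable_fin_num => //; exact: bounded_by_integrable bc.
transitivity (\int[distribution (law p (enc [::] s)) proj_traj]_om (payoff
  om)%:E)%E.
  by apply: eq_measure_integral => A mA _; apply/esym; exact: law_simulates.
rewrite integral_distribution//.
  by apply: measurableT_comp => //; exact: payoff_measurable.
exact: bounded_by_integrable bc.
Qed.

(** The policy recovers the history of the MDP by [proj]. Where the states seen do not form a path,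
    any allowed gamble will do. *)
Lemma strategy_policy (sigma : strategy M) :
  exists p, in_house mdp_house p /\ simulates p sigma [::].
Proof.
have /choice[g gP] : forall u : seq X * X, exists g, allowed u.2 g /\
    (sorted (trans M) (rcons u.1 u.2) -> forall t, g t = step sigma u.1 u.2 t).
  move=> [h s] /=; case: (boolP (sorted (trans M) (rcons h s))) => hs; last first.
    case: (boolP (controlled M s)) => cs.
      have [t st] := trans_total M s; exists (dirac_gamble t); split=> //.
      by split=> [u|/negP//] /=; case: eqP => [-> //|_]; rewrite ltxx.
    have [d0 dA d1] := prob_distr cs.
    have dd : is_distr xpredT (prob M s) by split.
    exists (Gamble dd); split=> //; split=> // t /= pt.
    by apply/negPn/negP => /dA E; move: pt; rewrite E ltxx.
  have sd : is_distr (trans M s) (step sigma h s).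
    rewrite (_ : step sigma h s = if controlled M s then play sigma h s else
      prob M s).
      by case: ifPn => cs; [apply: play_distr;
        rewrite /is_history hs|exact: prob_distr].
    by apply/funext => t; rewrite /step; case: ifP.
  have [d0 dA d1] := sd.
  have dd : is_distr xpredT (step sigma h s) by split.
  exists (Gamble dd); split=> //; split=> [t /= pt|ncs t].
    by apply/negPn/negP => /dA E; move: pt; rewrite E ltxx.
  by rewrite /= /step (negbTE ncs).
exists (fun h y => push y (g (map proj h, proj y))); split.
  by move=> h y; exists (g (map proj h, proj y)) => //;
    case: (gP (map proj h, proj y)).
move=> h s; rewrite cat0s => hs t; rewrite push_next map_proj_encs proj_enc.
by have [_] := gP (h, s); apply.
Qed.

Lemma policy_play_distr (p : policy R Y) : in_house mdp_house p ->
  forall h s, is_history M h s ->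
    is_distr (trans M s) (fun t => p (encs [::] h) (enc h s) (next (enc h s) t)).
Proof.
move=> Gp h s _; have [k ak ->] := Gp (encs [::] h) (enc h s).
rewrite (_ : (fun t => _) = k); last by apply/funext => t; rewrite push_next.
by rewrite proj_enc in ak; exact: allowed_distr.
Qed.

Definition policy_to_strategy p (Gp : in_house mdp_house p) : strategy M :=
  Strategy (policy_play_distr Gp).

Lemma policy_to_strategy_simulates p (Gp : in_house mdp_house p) :
  simulates p (policy_to_strategy Gp) [::].
Proof.
move=> h s; rewrite cat0s => hs t; rewrite /step; case: ifPn => // ncs.
have [k ak ->] := Gp (encs [::] h) (enc h s).
by rewrite push_next; rewrite proj_enc in ak; case: ak => _; apply.
Qed.

(** Strategies become policies of the house and conversely, with the same expected payoff. So an
    optimal strategy gives an optimal policy, and the stationary one found for it translates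
    back. *)
Lemma optimal_strategy_stationary s0 : transient_house mdp_house ->
  (exists sigma : strategy M, is_optimal s0 sigma) ->
  exists tau : Y -> gamble R Y, exists sigma : strategy M,
    [/\ is_optimal s0 sigma,
        forall h s, play sigma h s = fun t => tau (enc h s) (next (enc h s) t) &
        forall y, pure_house y (tau y)].
Proof.
move=> trG [sigma0 opt0]; have [p0 [Gp0 sim0]] := strategy_policy sigma0.
pose F := payoff \o proj_traj.
have mF : measurable_fun setT F.
  by apply: measurableT_comp; [exact: payoff_measurable|exact:
    proj_traj_measurable].
have bF : bounded_by B F by move=> om; exact: payoff_bounded.
have Fbelow (om : traj Y) e : 0 < e -> exists N, forall n, (N <= n)%N ->
    F om - e <= total_reward (proj (om n)) (proj (om n.+1)).
  exact: (limn_einf_below (total_reward_bounded (proj_traj om))).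
have Fabove (om : traj Y) c : (exists N, forall n, (N <= n)%N ->
    c <= total_reward (proj (om n)) (proj (om n.+1))) -> c <= F om.
  exact: (limn_einf_above (total_reward_bounded (proj_traj om))).
have opt_p0 p : in_house mdp_house p ->
    expect p (enc [::] s0) F <= expect p0 (enc [::] s0) F.
  move=> Gp; rewrite -lee_fin -(expected_liminf_simulates s0 Gp
    (policy_to_strategy_simulates Gp)).
  rewrite -(expected_liminf_simulates s0 Gp0 sim0) opt0.
  by apply: ereal_sup_ubound; exists (policy_to_strategy Gp).
have [tau [tauP tauE]] := optimal_stationary
  (r := fun y z => total_reward (proj y) (proj z)) trG purifiable_mdp_house
  mF bF Fbelow Fabove (ex_intro _ p0 Gp0) Gp0 opt_p0.
have Gtau : in_house mdp_house (stationary tau) by move=> h y; case: (tauP y).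
exists tau, (policy_to_strategy Gtau); split=> //; last by move=> y; case: (tauP y).
rewrite /is_optimal (expected_liminf_simulates s0 Gtau
  (policy_to_strategy_simulates Gtau)).
by rewrite tauE -(expected_liminf_simulates s0 Gp0 sim0).
Qed.

Lemma pure_deterministic (tau : Y -> gamble R Y) (sigma : strategy M) :
  (forall h s, play sigma h s = fun t => tau (enc h s) (next (enc h s) t)) ->
  (forall y, pure_house y (tau y)) -> is_deterministic sigma.
Proof.
move=> playE pure h s /andP[_ cs]; have := pure (enc h s).
rewrite /pure_house proj_enc => /(_ cs)[t tE]; exists t; rewrite playE tE.
apply/funext => u /=; congr (_%:R); congr nat_of_bool.
apply/idP/idP => /eqP E; last by rewrite E.
by rewrite -(proj_next (enc h s) u) E proj_next.
Qed.

End encoding.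

(** * The house without memory *)

Section state_encoding.
Context {R : realType} {X : pcountType} (M : mdp R X).

Lemma state_next (s t : X) : id t = t. Proof. by []. Qed.

Definition state_house := mdp_house M (next := fun _ => id) state_next.

(** A policy of the house plays a strategy with the same law of trajectories, to which the
    transience of the MDP applies. *)
Lemma transient_state_house : universally_transient M ->
  transient_house state_house.
Proof.
move=> trM p s Gp.
pose enc (_ : seq X) (s : X) := s.
have proj_enc h t : id (enc h t) = t by [].
have enc_rcons (h : seq X) (t u : X) : enc (rcons h t) u = id u by [].
pose sigma := policy_to_strategy proj_enc Gp.
have sim : simulates (fun _ => id) enc p sigma [::].
  exact: policy_to_strategy_simulates.
have mf := @finite_visits_measurable X.
apply: Pr_not_null => //; apply: EFin_inj; rewrite EFin_Pr; last exact: measurableC.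
apply: etrans (law_simulates proj_enc enc_rcons s Gp sim (measurableC mf)) _.
have [N [mN N0 sN]] := trM s sigma.
apply/eqP; rewrite eq_le measure_ge0 andbT.
apply: (@le_trans _ _ (induced_measure s sigma N)); last by rewrite N0.
rewrite -[leLHS]/(induced_measure s sigma (@run_traj _ _ M s @^-1` (~`
  finite_visits))).
apply: le_measure; rewrite ?inE//.
  rewrite -[X in measurable X]setTI; apply: run_traj_measurable => //.
  exact: measurableC.
move=> rho nf; apply: sN => fin; apply: nf => t.
have /finite_seqP[w wE] := fin t.
exists (\max_(i <- w) i).+1 => n; rewrite leqNgt => /negP Nn nt; apply: Nn.
rewrite ltnS; apply: (@leq_bigmax_seq _ _ _ id) => //.
suff : [set` w] n by [].
by rewrite -wE.
Qed.

End state_encoding.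

HB.instance Definition _ (X : pcountType) := Pointed.on (X * nat)%type.

(** * The house with a step counter *)

Section step_encoding.
Context {R : realType} {X : pcountType} (M : mdp R X).

Definition count_next (y : X * nat) (t : X) : X * nat := (t, y.2.+1).

Lemma fst_count_next y t : (count_next y t).1 = t. Proof. by []. Qed.

Definition count_house := mdp_house M fst_count_next.

(** Almost surely the counter grows by one at each step, so no state is visited twice. *)
Lemma transient_count_house : transient_house count_house.
Proof.
move=> p y Gp.
pose bad (_ : seq (X * nat)%type) (z u : X * nat) := u.2 <> z.2.+1.
have N1 : Pr p y (never bad) = 1.
  apply: (@never_as _ _ p y bad (fun _ _ => True)) => // h z _ u pu; split=> //.
  apply; have [k _ pk] := Gp h z.
  by move: pu; rewrite pk => /push_gt0 <-.
apply: Pr1_sub N1; first exact: never_measurable.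
  exact: finite_visits_measurable.
move=> om nom z; have cnt n : (om n).2 = ((om 0%N).2 + n)%N.
  elim: n => [|n IH]; first by rewrite addn0.
  by have /contrapT := nom n; rewrite IH addnS.
exists z.2.+1 => n zn on; have := cnt n; rewrite on => E.
by move: zn; rewrite E ltnNge leq_addl.
Qed.

End step_encoding.

(** * The two parts of the result *)

Lemma optimal_pointed (R : realType) (X : pcountType) (M : mdp R X) (s0 : X) :
  bounded_rewards M ->
  (exists sigma : strategy M, is_optimal s0 sigma) ->
  (universally_transient M ->
     exists sigma : strategy M,
       [/\ is_optimal s0 sigma, is_memoryless sigma & is_deterministic sigma]) /\
  (exists sigma : strategy M,
     [/\ is_optimal s0 sigma, is_markov sigma & is_deterministic sigma]).
Proof.
move=> [B rB] opt.
have B0 : 0 <= B by have [t /rB] := trans_total M s0; apply: le_trans.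
split=> [/transient_state_house trM|].
  have [tau [sigma [osig playE pure]]] := optimal_strategy_stationary
    (enc := fun (_ : seq X) s => s) (fun _ _ => erefl) (fun _ _ _ => erefl) rB
      B0 trM opt.
  exists sigma; split=> //; last first.
    exact: (pure_deterministic (enc := fun (_ : seq X) s => s) (@state_next X)
      (fun _ _ => erefl) playE pure).
  by move=> h h' s _ _; rewrite !playE.
pose enc (h : seq X) (s : X) : (X * nat)%type := (s, size h).
have enc_rcons h s t : enc (rcons h s) t = count_next (enc h s) t.
  by rewrite /enc size_rcons.
have [tau [sigma [osig playE pure]]] := optimal_strategy_stationary
  (enc := enc) (fun _ _ => erefl) enc_rcons rB B0 (@transient_count_house _ _
    M) opt.
exists sigma; split=> //; last first.
  exact: (pure_deterministic (enc := enc) (@fst_count_next X) (fun _ _ => erefl)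
    playE pure).
by move=> h h' s _ _ hh'; rewrite !playE /enc hh'.
Qed.

Theorem theorem36 (R : realType) (S : countType) (M : mdp R S) (s0 : S) :
  bounded_rewards M ->
  (exists sigma : strategy M, is_optimal s0 sigma) ->
  (universally_transient M ->
     exists sigma : strategy M,
       [/\ is_optimal s0 sigma, is_memoryless sigma & is_deterministic sigma]) /\
  (exists sigma : strategy M,
     [/\ is_optimal s0 sigma, is_markov sigma & is_deterministic sigma]).
Proof.
case: S M s0 => T [m1 m2 m3] M s0.
(* The start state itself serves as the distinguished point. *)
pose X : pcountType := HB.pack T m1 m2 m3 (isPointed.Build T s0).
exact: (@optimal_pointed R X M s0).
Qed.
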